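(* Let $K=\mathbb{Q}(\sqrt{-D})$ with $D>4$ and class number $h$, $\mathfrak f$ an integral ideal, $\epsilon:(\mathcal O_K/\mathfrak f)^*\to\mathbb{C}^*$ a character with $\epsilon(-1)=-1$, $\chi:I(\mathfrak f)\to\mathbb{C}^*$ an algebraic Hecke character with $\chi(\alpha\mathcal O_K)=\epsilon(\alpha)\alpha$ for $\alpha\in K^*$ prime to $\mathfrak f$, and $T=K(\chi)$. (1) If $[T:K]=h$, then $\mathrm{Im}(\epsilon)\subset\mu_2$ if $\gcd(6,D)=1$; $\subset\mu_4$ if $3\nmid D$; $\subset\mu_6$ if $2\nmid D$; $\subset\mu_{12}$ if $6\mid D$ (the first applicable case). Call this condition ( * ). (2) Conversely, if $\epsilon$ satisfies ( * ), then $[T:K]=h$ or $2h$, and $[T:K]=h$ if and only if $\sqrt{\xi}\notin T_g$, where $\xi$ is a generator of $\mu_2(\epsilon)$. (3) Whether $[T:K]=h$ depends only on $\epsilon$: if $\chi'$ is another such Hecke character with the same $\epsilon$, then $[K(\chi):K]=h$ if and only if $[K(\chi'):K]=h$.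
   Context: $-D$ is a fundamental discriminant; $I(\mathfrak f)$ is the group of fractional ideals prime to $\mathfrak f$; $K(\chi)$ is generated over $K$ by the values of $\chi$; $\mu_n$ is the group of $n$-th roots of unity; $\mu_2(\epsilon)$ is the set of elements of $\mathrm{Im}(\epsilon)$ of $2$-power order; $T_g$ is the subfield of $T$ generated over $K$ by $\chi(\mathfrak a)$ for $\mathfrak a\in I(\mathfrak f)$ with $\mathfrak a^2$ principal. Note $[T:K]$ equals the dimension of the simple CM abelian variety over $K$ associated with $\chi$. *)

(* Defs.v *)
From HB Require Import structures.
From mathcomp Require Import all_boot all_order all_algebra.
From mathcomp Require Import all_classical all_reals.
From mathcomp Require Import complex.

Set Implicit Arguments.
Unset Strict Implicit.
Unset Printing Implicit Defensive.

Import Order.TTheory GRing.Theory Num.Theory.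
Local Open Scope classical_set_scope.
Local Open Scope ring_scope.

(* All number fields, rings of integers and ideals are subsets of an          *)
(* algebraically closed field C, taken to be R[i] in the theorem.             *)

Definition subfield_gen (C : fieldType) (S : set C) : set C :=
  smallest (fun A : set C => divring_closed (fun x => x \in A)) S.

Definition has_degree (C : fieldType) (K T : set C) (n : nat) : Prop :=
  exists b : 'I_n -> C,
    [/\ forall i, T (b i),
        forall c : 'I_n -> C, (forall i, K (c i)) ->
          \sum_(i < n) c i * b i = 0 -> forall i, c i = 0 &
        forall x, T x -> exists2 c : 'I_n -> C,
          forall i, K (c i) & x = \sum_(i < n) c i * b i].

Definition squarefree (m : nat) : Prop :=
  forall p : nat, prime p -> ~~ (p ^ 2 %| m)%N.

Definition fundamental_discriminant (d : int) : Prop :=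
  [/\ (d = 1 %[mod 4])%Z, d != 1 & squarefree `|d|%N] \/
  exists m : int, [/\ d = 4 * m,
    (m = 2 %[mod 4])%Z \/ (m = 3 %[mod 4])%Z & squarefree `|m|%N].

Definition imag_quadratic (C : numClosedFieldType) (D : nat) : set C :=
  subfield_gen [set sqrtC (- D%:R)].

Definition ring_of_integers (C : fieldType) (K : set C) : set C :=
  [set x | K x /\ integralOver (intr : int -> C) x].

Definition fractional_ideal (C : fieldType) (K a : set C) : Prop :=
  [/\ a `<=` K,
      exists2 x, a x & x != 0,
      forall x y, a x -> a y -> a (x + y),
      forall r x, ring_of_integers K r -> a x -> a (r * x) &
      exists d, [/\ ring_of_integers K d, d != 0 &
        forall x, a x -> ring_of_integers K (d * x)]].

(* Nonzero, because fractional ideals are. *)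
Definition integral_ideal (C : fieldType) (K a : set C) : Prop :=
  fractional_ideal K a /\ a `<=` ring_of_integers K.

Definition principal (C : fieldType) (K : set C) (alpha : C) : set C :=
  [set alpha * r | r in ring_of_integers K].

Definition ideal_mul (C : fieldType) (a b : set C) : set C :=
  [set x | exists n (u v : 'I_n -> C),
    (forall i, a (u i) /\ b (v i)) /\ x = \sum_(i < n) u i * v i].

Definition comaximal (C : fieldType) (a b : set C) : Prop :=
  exists x y, [/\ a x, b y & x + y = 1].

Definition ideal_class (C : fieldType) (K a : set C) : set (set C) :=
  [set b | exists alpha,
    [/\ K alpha, alpha != 0 & b = [set alpha * x | x in a]]].

Definition class_group (C : fieldType) (K : set C) : set (set (set C)) :=
  [set ideal_class K a | a in [set a | fractional_ideal K a]].

Definition is_class_number (C : fieldType) (K : set C) (h : nat) : Prop :=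
  (class_group K #= `I_h)%card.

(* I(f): the a = b c^-1 with b and c integral ideals prime to f. *)
Definition ideals_prime_to (C : fieldType) (K f : set C) : set (set C) :=
  [set a | fractional_ideal K a /\
    exists b c, [/\ integral_ideal K b, integral_ideal K c,
      comaximal b f, comaximal c f & ideal_mul a c = b]].

Definition integers_prime_to (C : fieldType) (K f : set C) : set C :=
  [set alpha | ring_of_integers K alpha /\ comaximal (principal K alpha) f].

(* A character of (O_K / f)^*, as a function on representatives; its values   *)
(* at elements that are not units modulo f are irrelevant.                    *)
Definition is_character_mod (C : fieldType) (K f : set C) (eps : C -> C) :
    Prop :=
  [/\ forall alpha, integers_prime_to K f alpha -> eps alpha != 0,
      forall alpha beta,
        integers_prime_to K f alpha -> integers_prime_to K f beta ->
        f (alpha - beta) -> eps alpha = eps beta &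
      forall alpha beta,
        integers_prime_to K f alpha -> integers_prime_to K f beta ->
        eps (alpha * beta) = eps alpha * eps beta].

Definition image_eps (C : fieldType) (K f : set C) (eps : C -> C) : set C :=
  eps @` integers_prime_to K f.

(* The elements of K^* prime to f are the nonzero quotients beta / gamma of   *)
(* integers prime to f, and eps extends to them multiplicatively by           *)
(* eps (beta / gamma) = eps beta / eps gamma.  The values of chi outside I(f) *)
(* are irrelevant.                                                            *)
Definition is_hecke_character (C : fieldType) (K f : set C) (eps : C -> C)
    (chi : set C -> C) : Prop :=
  [/\ forall a, ideals_prime_to K f a -> chi a != 0,
      forall a b, ideals_prime_to K f a -> ideals_prime_to K f b ->
        chi (ideal_mul a b) = chi a * chi b &
      forall alpha beta gamma, alpha != 0 ->
        integers_prime_to K f beta -> integers_prime_to K f gamma ->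
        alpha = beta / gamma ->
        chi (principal K alpha) = eps beta / eps gamma * alpha].

Definition field_of_values (C : fieldType) (K f : set C) (chi : set C -> C) :
    set C :=
  subfield_gen (K `|` chi @` ideals_prime_to K f).

(* T_g *)
Definition genus_field_of_values (C : fieldType) (K f : set C)
    (chi : set C -> C) : set C :=
  subfield_gen (K `|` chi @` [set a | ideals_prime_to K f a /\
    exists alpha, [/\ K alpha, alpha != 0 & ideal_mul a a = principal K alpha]]).

Definition mu (C : fieldType) (n : nat) : set C := [set z | n.-unity_root z].

Definition mu2_eps (C : fieldType) (K f : set C) (eps : C -> C) : set C :=
  [set z | image_eps K f eps z /\ exists k : nat, (2 ^ k)%N.-primitive_root z].

Definition generates (C : fieldType) (G : set C) (xi : C) : Prop :=
  G xi /\ forall z, G z -> exists k : nat, z = xi ^+ k.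

(* Condition ( * ) *)
Definition condition_star (C : fieldType) (D : nat) (K f : set C)
    (eps : C -> C) : Prop :=
  image_eps K f eps `<=`
    mu (if gcdn 6 D == 1%N then 2%N
        else if ~~ (3 %| D)%N then 4%N
        else if ~~ (2 %| D)%N then 6%N
        else 12%N).

(* Main.v *)
Require Import Defs.
From HB Require Import structures.
From mathcomp Require Import all_boot all_order all_algebra.
From mathcomp Require Import all_classical all_reals.
From mathcomp Require Import complex.
From mathcomp Require Import separable algC algnum cyclotomic ring lra zify.

Set Implicit Arguments.
Unset Strict Implicit.
Unset Printing Implicit Defensive.

Import Order.TTheory GRing.Theory Num.Theory.
Local Open Scope classical_set_scope.
Local Open Scope ring_scope.

(* The values of chi and K^* generate a group G in which mu_m K^*, where mu_m
   is the image of eps, has index h, and T = K(G).  Let G2 be the group of the x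
   in G with x^2 in mu_m K^*, let c be its index over mu_m K^*, and let W be the
   field generated over K by the square roots of the k in K^* with k mu_m meeting
   the squares of G.  Then T_g = K(G2), and W and T_g(mu_2m) are related by
   - [W : K] = 2c and W <= T_g(mu_2m), by Kummer theory;
   - [T : T_g] = h / c: an element of G lying in W(mu_N) has its square in
     mu_m K^*, because W(mu_N) / K is abelian (Sah's lemma), so representatives
     of G / G2 are linearly independent over W(mu_N), which contains T_g;
   - [T_g(mu_2m) : T_g] <= 2.
   Hence [T : K] = h forces mu_2m <= W; conversely, if mu_2m <= W, then [T : K] is
   h or 2h according to whether mu_2m is contained in T_g or not.  Finally
   mu_2m <= W is condition ( * ): automorphisms of W are involutions, so that 2m
   divides 24, and a prime p has a square root up to sign in W exactly when the
   ideal pO is the square of an ideal, that is, when p divides D. *)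

(** * Subfields *)

(** Why mu_m K^* has index h in G: a relation chi(a) = w k, with w a root of unity and k in K,
    forces a = kO, because fractional ideals have no torsion and, as D > 4, the only roots of unity
    of K are 1 and -1. So the classes of G modulo mu_m K^* are the ideal classes, and an element of
    G that lies in mu_N K^* for some N > 0 already lies in mu_m K^*. The obstacle is that K has too
    few roots of unity for Kummer theory with exponents above 2. Exponent 2 over K gives W; for the
    other classes of G the roots of unity must be adjoined first, and Sah's lemma controls which
    classes this makes dependent. The number 24 is the largest n for which every unit modulo n has
    square 1. No Galois group is built: it suffices that an element outside a subfield is moved by
    some embedding over that subfield. Part (3) follows from the criterion of part (2): where a^2 is
    principal, eps determines chi(a) up to sign, and therefore determines T_g. *)

Definition is_subfield (C : fieldType) (A : set C) : Prop :=
  divring_closed (fun x => x \in A).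

Section SubfieldClosure.
Variables (C : fieldType) (A : set C) (hA : is_subfield A).

Lemma subfield1 : A 1.
Proof. by case: hA => h _ _; exact: set_mem h. Qed.

Lemma subfieldB x y : A x -> A y -> A (x - y).
Proof.
by case: hA => _ h _ Ax Ay; exact: set_mem (h x y (mem_set Ax) (mem_set Ay)).
Qed.

Lemma subfield_div x y : A x -> A y -> A (x / y).
Proof.
by case: hA => _ _ h Ax Ay; exact: set_mem (h x y (mem_set Ax) (mem_set Ay)).
Qed.

Lemma subfield0 : A 0.
Proof. by rewrite -(subrr 1); apply: subfieldB subfield1 subfield1. Qed.

Lemma subfieldN x : A x -> A (- x).
Proof. by move=> Ax; rewrite -sub0r; apply: subfieldB Ax; exact: subfield0. Qed.

Lemma subfieldD x y : A x -> A y -> A (x + y).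
Proof. by move=> Ax Ay; rewrite -[y]opprK; apply/subfieldB/subfieldN. Qed.

Lemma subfieldV x : A x -> A x^-1.
Proof. by move=> Ax; rewrite -div1r; apply: subfield_div Ax; exact: subfield1. Qed.

Lemma subfieldM x y : A x -> A y -> A (x * y).
Proof. by move=> Ax Ay; rewrite -[y]invrK; apply/subfield_div/subfieldV. Qed.

Lemma subfieldX x n : A x -> A (x ^+ n).
Proof.
move=> Ax; elim: n => [|n IHn]; first by rewrite expr0; exact: subfield1.
by rewrite exprS; apply: subfieldM.
Qed.

Lemma subfield_sum (I : Type) (r : seq I) (P : pred I) (F : I -> C) :
  (forall i, P i -> A (F i)) -> A (\sum_(i <- r | P i) F i).
Proof.
move=> AF; elim/big_ind: _ => // [|x y]; [exact: subfield0|exact: subfieldD].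
Qed.

Lemma subfield_nat n : A n%:R.
Proof.
by elim: n => [|n IHn]; [exact: subfield0|rewrite -natr1; apply: subfieldD subfield1].
Qed.

Lemma subfield_int n : A n%:~R.
Proof. by case: n => n; rewrite ?NegzE ?mulrNz; [|apply/subfieldN]; exact: subfield_nat. Qed.

End SubfieldClosure.

Lemma is_subfieldP (C : fieldType) (A : set C) :
  A 1 -> (forall x y, A x -> A y -> A (x - y)) ->
  (forall x y, A x -> A y -> y != 0 -> A (x / y)) -> is_subfield A.
Proof.
move=> A1 AB Ad.
have A0 : A 0 by rewrite -(subrr 1); apply: AB.
split=> [|x y /set_mem Ax /set_mem Ay|x y /set_mem Ax /set_mem Ay].
- exact/mem_set.
- exact/mem_set/AB.
apply/mem_set; have [->|y0] := eqVneq y 0; first by rewrite invr0 mulr0.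
exact: Ad.
Qed.

Section SubfieldGen.
Variable C : fieldType.
Implicit Types S B : set C.

Lemma subfield_gen_is_subfield S : is_subfield (subfield_gen S).
Proof.
apply: is_subfieldP => [B [hB _]|x y Sx Sy B [hB SB]|x y Sx Sy _ B [hB SB]].
- exact: subfield1.
- by apply: (subfieldB hB); [apply: Sx|apply: Sy].
- by apply: (subfield_div hB); [apply: Sx|apply: Sy].
Qed.

Lemma sub_subfield_gen S : S `<=` subfield_gen S.
Proof. by move=> x Sx B [_ SB]; apply: SB. Qed.

Lemma subfield_gen_min S B : is_subfield B -> S `<=` B -> subfield_gen S `<=` B.
Proof. by move=> hB SB x; apply. Qed.

End SubfieldGen.

Section SubfieldType.
Variables (C : fieldType) (A : set C) (hA : is_subfield A).

(** The proof is an argument of the predicate so that unification can recover it when the closure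
    instance is looked up. *)
Definition subfield_pred of is_subfield A : {pred C} := fun x => x \in A.

HB.instance Definition _ := GRing.isDivringClosed.Build C (subfield_pred hA) hA.

Record subfield_type :=
  Subfield { subfield_val : C; _ : subfield_val \in subfield_pred hA }.

HB.instance Definition _ := [isSub for subfield_val].
HB.instance Definition _ := [Choice of subfield_type by <:].
HB.instance Definition _ :=
  [SubChoice_isSubIntegralDomain of subfield_type by <:].
HB.instance Definition _ := [SubIntegralDomain_isSubField of subfield_type by <:].

Definition incl (u : subfield_type) : C := \val u.
HB.instance Definition _ := GRing.RMorphism.copy incl \val.
Arguments incl : simpl never.

Lemma inclP (u : subfield_type) : A (incl u).
Proof. exact: set_mem (valP u). Qed.

Lemma incl_inj : injective incl.
Proof. exact: val_inj. Qed.

Lemma incl_surj x : A x -> exists u, incl u = x.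
Proof.
by move=> Ax; exists (Subfield (mem_set Ax : x \in subfield_pred hA)).
Qed.

End SubfieldType.

(** An embedding of E into C, given by a total function whose values outside E are arbitrary.
    Nothing requires [tau] to map E into itself. *)
Definition hom_on (C : fieldType) (E : set C) (tau : C -> C) : Prop :=
  [/\ tau 1 = 1, forall x y, E x -> E y -> tau (x - y) = tau x - tau y &
      forall x y, E x -> E y -> tau (x * y) = tau x * tau y].

(** * Embeddings *)

Section Embeddings.
Variables (C : numClosedFieldType) (A : set C) (hA : is_subfield A).
Local Notation F := (subfield_type hA).
Local Notation iota := (@incl C A hA).
Local Notation "p ^iota" := (map_poly iota p) (at level 2, format "p ^iota").

Definition algebraic_on (x : C) : Prop := algebraicOver iota x.

Lemma algebraic_on_root x n : (0 < n)%N -> A (x ^+ n) -> algebraic_on x.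
Proof.
move=> n0 /(incl_surj hA) [u ux]; exists ('X^n - u%:P); first exact/monic_neq0/monicXnsubC.
by rewrite rmorphB /= map_polyXn map_polyC /root !hornerE /= ux subrr.
Qed.

Lemma primitive_element (s : seq C) : (forall x, x \in s -> algebraic_on x) ->
  exists z, algebraic_on z /\
    forall x, x \in s -> exists p : {poly F}, p^iota.[z] = x.
Proof.
elim: s => [|x s IHs] algs.
  by exists 0; split=> //; exact: algebraic0.
have [z' [algz' sz']] := IHs (fun y ys => algs y (@mem_behead _ (x :: s) y ys)).
have algx := algs x (mem_head _ _).
have [p p0 px] := algx; have [q q0 qz'] := algz'.
have F0 : [pchar F] =i pred0.
  move=> l; rewrite -(fmorph_pchar iota); exact: pchar_num.
have [n [[px' pe] [qx' qe]]] := pchar0_PET q0 qz' p0 px F0.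
exists (x *+ n - z'); split.
  apply: algebraic_sub => //.
  rewrite -mulr_natr; apply: algebraic_mul => //.
  rewrite -(rmorph_nat iota); exact: algebraic_id.
move=> y; rewrite inE => /orP[/eqP->|/sz' [r <-]]; first by exists qx'.
by exists (r \Po px'); rewrite map_comp_poly horner_comp pe.
Qed.

Lemma minimal_polynomial z : algebraic_on z ->
  exists P : {poly F}, [/\ P != 0, P^iota.[z] = 0 &
    forall q : {poly F}, q^iota.[z] = 0 -> P %| q].
Proof.
move=> [p0 p00 /eqP p0z].
have ex : exists n, `[< exists p : {poly F}, [/\ p != 0, p^iota.[z] = 0 & size p = n] >].
  by exists (size p0); apply/asboolP; exists p0.
case: (ex_minnP ex) => n /asboolP [P [P0 Pz <-]] minP.
exists P; split=> // q qz; apply/modp_eq0P/eqP.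
rewrite -[_ == _]negbK; apply/negP => r0.
have : (size P <= size (q %% P)%R)%N.
  apply: minP; apply/asboolP; exists (q %% P); split=> //.
  have := divp_eq q P => /(congr1 (fun r => (map_poly iota r).[z])).
  by rewrite qz rmorphD rmorphM /= hornerD hornerM Pz mulr0 add0r.
by rewrite leqNgt ltn_modp P0.
Qed.

(** Write P = r g with g the gcd. Either r vanishes at z, and then P divides r and g is constant, or
    g vanishes at z, and then so does p. *)
Lemma minimal_coprime z (P p : {poly F}) : P != 0 -> P^iota.[z] = 0 ->
  (forall q : {poly F}, q^iota.[z] = 0 -> P %| q) -> p^iota.[z] != 0 -> coprimep P p.
Proof.
move=> P0 Pz minP pz; have /dvdpP [r Pr] := dvdp_gcdl P p.
have r0 : r != 0 by apply: contraNneq P0 => r0; rewrite Pr r0 mul0r.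
have g0 : gcdp P p != 0 by apply: contraNneq P0 => g0; rewrite Pr g0 mulr0.
have /eqP := Pz; rewrite {1}Pr rmorphM /= hornerM mulf_eq0 => /orP[/eqP rz|/eqP gz].
  have := dvdp_leq r0 (minP _ rz); rewrite {1}Pr size_mul // /coprimep.
  have : (0 < size r)%N by rewrite size_poly_gt0.
  have : (0 < size (gcdp P p))%N by rewrite size_poly_gt0.
  by case: (size r) => // a; case: (size (gcdp P p)) => [//|[//|b]] _ _; rewrite !addnS /= ltnNge leq_addr.
case/eqP: pz; have /dvdpP [r' ->] := dvdp_gcdr P p.
by rewrite rmorphM /= hornerM gz mulr0.
Qed.

(** The inverse of a nonzero value q(z) is read off a Bezout relation between q and the minimal
    polynomial of z. *)
Lemma poly_values_subfield z : algebraic_on z ->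
  is_subfield [set x | exists p : {poly F}, p^iota.[z] = x].
Proof.
move=> algz; have [P [P0 Pz minP]] := minimal_polynomial algz.
apply: is_subfieldP => [|_ _ [p <-] [q <-]|_ _ [p <-] [q <-] qz].
- by exists 1; rewrite rmorph1 hornerC.
- by exists (p - q); rewrite rmorphB /= !hornerE.
have /Bezout_coprimepP [[u v] /= /eqpP [[a b] /= /andP[a0 b0] e]] := minimal_coprime P0 Pz minP qz.
exists (p * ((a / b) *: v)); rewrite rmorphM hornerM /= map_polyZ hornerZ; congr (_ * _).
have := congr1 (fun r => (map_poly iota r).[z]) e => /=.
rewrite !map_polyZ !hornerZ rmorphD !rmorphM /= hornerD !hornerM Pz mulr0 add0r rmorph1 hornerC mulr1 => e'.
apply: (mulIf qz); rewrite mulVf // fmorphV mulrAC -mulrA mulrAC.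
by rewrite [X in _ * X / _]mulrC /= e' divff // fmorph_eq0.
Qed.

(* A root z' of the minimal polynomial P of a primitive element z, with
   p(z') <> p(z), exists because p - p(z) has fewer roots than P. *)
Lemma exists_moving_embedding (s : seq C) (x : C) :
  (forall y, y \in s -> algebraic_on y) ->
  let E := subfield_gen (A `|` [set` s]) in
  E x -> ~ A x ->
  exists tau, [/\ hom_on E tau, forall a, A a -> tau a = a & tau x <> x].
Proof.
move=> algs E Ex nAx.
have [z [algz sz]] := primitive_element algs.
have Ez y : E y -> exists p : {poly F}, p^iota.[z] = y.
  apply: (subfield_gen_min (poly_values_subfield algz)) => a [/(incl_surj hA) [u <-]|/= /sz//].
  by exists u%:P; rewrite map_polyC hornerC.
have [P [P0 Pz minP]] := minimal_polynomial algz.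
have [r Pr] := closed_field_poly_normal P^iota.
have PI0 : P^iota != 0 by rewrite map_poly_eq0.
have szP : size P = (size r).+1.
  by rewrite -(size_map_poly iota) Pr size_scale ?lead_coef_eq0 // size_prod_XsubC.
have r_gt0 : (0 < size r)%N.
  case: r Pr {szP} => [|//] Pr; move: Pz; rewrite Pr big_nil hornerZ hornerC mulr1 => /eqP.
  by rewrite lead_coef_eq0 (negPf PI0).
have uniq_r : uniq r.
  rewrite -separable_prod_XsubC.
  suff: separable_poly P^iota.
    by apply: dvdp_separable; rewrite Pr dvdpZr ?lead_coef_eq0.
  rewrite separable_map unlock; apply: (minimal_coprime P0 Pz minP).
  (* Separability: in characteristic 0 the derivative is nonzero and of smaller degree than P, so P
     cannot divide it. *)
  apply/eqP => /minP dP; have P'0 : P^`() != 0.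
    apply/eqP => /(congr1 (fun q : {poly F} => iota q`_(size r).-1)) /=.
    rewrite coef_deriv coef0 rmorph0 rmorphMn prednK //= => /eqP.
    rewrite mulrn_eq0 -[size r]/(_.+1.-1) -szP fmorph_eq0 lead_coef_eq0 (negPf P0) szP /=.
    by case: (r) r_gt0.
  have := dvdp_leq P'0 dP; rewrite leqNgt => /negP; apply.
  exact: lt_size_deriv.
have [p0 p0z] := Ez x Ex.
pose p : {poly F} := p0 %% P.
have pz : p^iota.[z] = x.
  rewrite -p0z (divp_eq p0 P) -/p rmorphD rmorphM /= hornerD hornerM Pz mulr0 add0r //.
have [z' rz' pz'] : exists2 z', z' \in r & p^iota.[z'] != x.
  apply: contrapT => no; apply: nAx.
  have d0 : p^iota - x%:P = 0.
    apply/eqP; apply: contraT => d0.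
    have := @max_poly_roots _ _ r d0; rewrite uniq_r => /(_ _ isT).
    have -> : all (root (p^iota - x%:P)) r.
      apply/allP => y ry; rewrite /root !hornerE subr_eq0; apply: contraT => ne.
      by case: no; exists y.
    move=> /(_ isT); rewrite ltnNge => /negP; case.
    have := size_polyD (p^iota) (- x%:P); rewrite size_polyN => /leq_trans -> //.
    rewrite geq_max size_map_poly.
    have : (size p < size P)%N by rewrite ltn_modp.
    rewrite szP ltnS => ->; by rewrite (leq_trans (size_polyC_leq1 _)).
  move/eqP: d0; rewrite subr_eq0 => /eqP/(congr1 (fun q : {poly C} => q`_0)).
  by rewrite coef_map coefC /= => <-; exact: inclP.
have Pz' : P^iota.[z'] = 0.
  by apply/eqP; rewrite -/(root _ _) Pr rootZ ?lead_coef_eq0 // root_prod_XsubC.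
(* P divides the difference of two polynomials with the same value at z, so p(z) |-> p(z') is well
   defined. *)
have wd (q1 q2 : {poly F}) : q1^iota.[z] = q2^iota.[z] -> q1^iota.[z'] = q2^iota.[z'].
  move=> e; have /minP /dvdpP [g /(congr1 (fun r => (map_poly iota r).[z']))] : (q1 - q2)^iota.[z] = 0.
    by rewrite rmorphB /= !hornerE e subrr.
  rewrite rmorphB rmorphM /= !hornerE Pz' mulr0 => /eqP.
  by rewrite subr_eq0 => /eqP.
pose rep y : {poly F} := xget 0 [set p : {poly F} | p^iota.[z] = y].
have repP y : E y -> (rep y)^iota.[z] = y.
  by move=> /Ez [q qy]; rewrite /rep; case: xgetP => [_ ->//|/(_ q)].
have repE (q : {poly F}) : (rep q^iota.[z])^iota.[z'] = q^iota.[z'].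
  by apply: wd; rewrite /rep; case: xgetP => [_ ->//|/(_ q)]; case.
exists (fun y => (rep y)^iota.[z']); split; first split.
- have -> : 1 = (1 : {poly F})^iota.[z] by rewrite rmorph1 hornerC.
  by rewrite repE rmorph1 !hornerC.
- move=> a b /Ez [qa <-] /Ez [qb <-].
  have -> : qa^iota.[z] - qb^iota.[z] = (qa - qb)^iota.[z] by rewrite rmorphB /= !hornerE.
  by rewrite !repE rmorphB /= !hornerE.
- move=> a b /Ez [qa <-] /Ez [qb <-].
  have -> : qa^iota.[z] * qb^iota.[z] = (qa * qb)^iota.[z] by rewrite rmorphM /= !hornerE.
  by rewrite !repE rmorphM /= !hornerE.
- move=> a /(incl_surj hA) [u <-].
  have -> : iota u = (u%:P)^iota.[z] by rewrite map_polyC hornerC.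
  by rewrite repE map_polyC !hornerC.
- by rewrite -pz repE; apply/eqP; rewrite pz.
Qed.

End Embeddings.

(** * Linear algebra over a subfield *)

Section LinearAlgebra.
Variables (C : fieldType) (K : set C) (hK : is_subfield K).

Definition spanned (I : finType) (v : I -> C) : set C :=
  [set x | exists2 c : I -> C, forall i, K (c i) & x = \sum_i c i * v i].

Definition free_over (I : finType) (v : I -> C) : Prop :=
  forall c : I -> C, (forall i, K (c i)) -> \sum_i c i * v i = 0 ->
    forall i, c i = 0.

Lemma mem_spanned (I : finType) (v : I -> C) i : spanned v (v i).
Proof.
exists (fun j => (j == i)%:R) => [j|]; first exact: subfield_nat.
rewrite (bigD1 i) //= eqxx mul1r big1 ?addr0 // => j /negPf ->.
by rewrite mul0r.
Qed.

Lemma spannedD (I : finType) (v : I -> C) x y :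
  spanned v x -> spanned v y -> spanned v (x + y).
Proof.
move=> [c Kc ->] [d Kd ->]; exists (fun i => c i + d i) => [i|]; first exact: subfieldD.
by rewrite -big_split; apply: eq_bigr => i _; rewrite mulrDl.
Qed.

Lemma spannedZ (I : finType) (v : I -> C) a x : K a -> spanned v x -> spanned v (a * x).
Proof.
move=> Ka [c Kc ->]; exists (fun i => a * c i) => [i|]; first exact: subfieldM.
by rewrite mulr_sumr; apply: eq_bigr => i _; rewrite mulrA.
Qed.

Lemma spanned0 (I : finType) (v : I -> C) : spanned v 0.
Proof.
exists (fun=> 0) => [_|]; first exact: subfield0.
by rewrite big1 // => i _; rewrite mul0r.
Qed.

Lemma spanned_sum (I J : finType) (P : pred J) (v : I -> C) (F : J -> C) :
  (forall j, P j -> spanned v (F j)) -> spanned v (\sum_(j | P j) F j).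
Proof. by move=> h; elim/big_ind: _ => //; [exact: spanned0|exact: spannedD]. Qed.

Lemma free_neq0 (I : finType) (v : I -> C) i : free_over v -> v i != 0.
Proof.
move=> fv; apply/eqP => vi; suff /(_ i)/eqP : forall j, (j == i)%:R = 0 :> C.
  by rewrite eqxx oner_eq0.
apply: fv => [j|]; first exact: subfield_nat.
by rewrite (bigD1 i) //= vi mulr0 big1 ?addr0 // => j /negPf ->; rewrite mul0r.
Qed.

Lemma free_ratio (I : finType) (v : I -> C) i j :
  free_over v -> K (v i / v j) -> i = j.
Proof.
move=> fv Kij; apply/eqP; apply: contraT => /negPf ij.
have vj0 := free_neq0 j fv.
have /(_ i)/eqP : forall l, (l == i)%:R - (l == j)%:R * (v i / v j) = 0.
  apply: fv => [l|].
    by apply: (subfieldB hK (subfield_nat hK _) (subfieldM hK (subfield_nat hK _) Kij)).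
  under eq_bigr do rewrite mulrBl.
  rewrite sumrB (bigD1 i) //= eqxx mul1r big1 ?addr0 => [|l /negPf ->]; last by rewrite mul0r.
  rewrite (bigD1 j) //= eqxx mul1r mulfVK // big1 ?addr0 ?subrr // => l /negPf ->.
  by rewrite !mul0r.
by rewrite eqxx ij mul0r subr0 oner_eq0.
Qed.

(** The coefficients form a matrix; with more rows than columns it has a nonzero vector in its left
    kernel, which is a relation among the [w j]. *)
Lemma free_le_ord m n (v : 'I_n -> C) (w : 'I_m -> C) :
  free_over w -> (forall j, spanned v (w j)) -> (m <= n)%N.
Proof.
move=> fw sw; rewrite leqNgt; apply/negP => nm.
have /choice [c hc] j : exists c : 'I_n -> subfield_type hK,
    w j = \sum_i incl (c i) * v i.
  have [c Kc ->] := sw j.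
  have /choice [d hd] i := incl_surj hK (Kc i).
  by exists d; apply: eq_bigr => i _; rewrite hd.
pose M : 'M[subfield_type hK]_(m, n) := \matrix_(j, i) c j i.
have : kermx M != 0.
  rewrite kermx_eq0 /row_free neq_ltn (leq_ltn_trans _ nm) //.
  exact: rank_leq_col.
case/rowV0Pn => u /sub_kermxP uM u0; case/negP: u0; apply/eqP/rowP => j.
rewrite mxE; apply: (incl_inj (hA := hK)); rewrite rmorph0.
apply: (fw (fun j => incl (u 0 j))) => [i|]; first exact: inclP.
under eq_bigr do rewrite hc mulr_sumr.
rewrite exchange_big big1 //= => i _.
under eq_bigr do rewrite mulrA.
rewrite -mulr_suml; have /matrixP/(_ 0 i) := uM; rewrite !mxE.
under eq_bigr do rewrite mxE.
move/(congr1 (@incl _ _ hK)); rewrite rmorph_sum rmorph0.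
under eq_bigr do rewrite rmorphM /=.
by move=> ->; rewrite mul0r.
Qed.

Lemma spanned_ord (I : finType) (v : I -> C) x :
  spanned v x -> spanned (fun k : 'I_#|I| => v (enum_val k)) x.
Proof.
move=> [c Kc ->]; exists (fun k => c (enum_val k)) => //.
by rewrite (reindex (@enum_val I xpredT)) //=; exact/onW_bij/enum_val_bij.
Qed.

Lemma free_ord (I : finType) (v : I -> C) :
  free_over v -> free_over (fun k : 'I_#|I| => v (enum_val k)).
Proof.
move=> fv c Kc c0 k; rewrite -[k]enum_valK; apply: (fv (fun i => c (enum_rank i))) => //.
rewrite (reindex (@enum_val I xpredT)) /=; last exact/onW_bij/enum_val_bij.
by rewrite -[RHS]c0; apply: eq_bigr => i _; rewrite enum_valK.
Qed.

Lemma free_le (I J : finType) (v : I -> C) (w : J -> C) :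
  free_over w -> (forall j, spanned v (w j)) -> (#|J| <= #|I|)%N.
Proof.
move=> /free_ord fw sw; apply: (free_le_ord fw) => j.
exact: spanned_ord.
Qed.

Lemma has_degree_basis (I : finType) (T : set C) (v : I -> C) :
  (forall i, T (v i)) -> free_over v -> T `<=` spanned v -> has_degree K T #|I|.
Proof.
move=> Tv fv sv; exists (fun k => v (enum_val k)); split=> //; first exact: free_ord.
by move=> x /sv/spanned_ord.
Qed.

Lemma has_degree_uniq (T : set C) a b :
  has_degree K T a -> has_degree K T b -> a = b.
Proof.
move=> [u [Tu fu su]] [v [Tv fv sv]]; apply/eqP; rewrite eqn_leq.
by rewrite (free_le_ord fu (fun j => sv _ (Tu j))) (free_le_ord fv (fun j => su _ (Tv j))).
Qed.

Definition fcons n (x : C) (w : 'I_n -> C) (i : 'I_n.+1) : C :=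
  if unlift ord0 i is Some j then w j else x.

Lemma free_fcons n (x : C) (w : 'I_n -> C) :
  free_over w -> ~ spanned w x -> free_over (fcons x w).
Proof.
move=> fw nx c Kc; rewrite big_ord_recl /fcons unlift_none.
under eq_bigr do rewrite liftK.
move=> e; have c0 : c ord0 = 0.
  apply: contrapT => /eqP c0; apply: nx.
  exists (fun i => - (c (lift ord0 i) / c ord0)) => [i|].
    by apply: (subfieldN hK); apply: subfield_div.
  apply: (mulfI c0); move/eqP: e; rewrite addr_eq0 => /eqP ->.
  rewrite mulr_sumr -sumrN; apply: eq_bigr => i _.
  by rewrite mulrA mulrN mulrCA divff // mulr1 mulNr.
move: e; rewrite c0 mul0r add0r => e i.
case: (unliftP ord0 i) => [j ->|-> //].
exact: (fw (fun i => c (lift ord0 i)) _ e j).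
Qed.

Lemma free_spans_ord (T : set C) n (w : 'I_n -> C) :
  has_degree K T n -> (forall i, T (w i)) -> free_over w -> T `<=` spanned w.
Proof.
move=> [b [Tb fb sb]] Tw fw x Tx; apply: contrapT => nx.
have := @free_le_ord n.+1 n b (fcons x w) (free_fcons fw nx).
rewrite ltnn => h; suff : false by []; apply: h => j; apply: sb; rewrite /fcons.
by case: unliftP.
Qed.

Definition lin_closed (T : set C) : Prop :=
  [/\ T 0, forall x y, T x -> T y -> T (x + y) & forall a x, K a -> T x -> T (a * x)].

Lemma lin_closed_sum (T : set C) (I : finType) (F : I -> C) :
  lin_closed T -> (forall i, T (F i)) -> T (\sum_i F i).
Proof. by move=> [T0 TD _] TF; elim/big_ind: _. Qed.

Lemma spanned_sub (T : set C) (I : finType) (v : I -> C) :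
  lin_closed T -> (forall i, T (v i)) -> spanned v `<=` T.
Proof.
move=> lT Tv x [c Kc ->]; apply: lin_closed_sum => // i.
by case: lT => _ _; apply.
Qed.

Lemma spanned_lin_closed (I : finType) (v : I -> C) : lin_closed (spanned v).
Proof. by split; [exact: spanned0|exact: spannedD|move=> a x; exact: spannedZ]. Qed.

(** A free family of maximal length in T is a basis; lengths are bounded by the size of the spanning
    family. *)
Lemma has_degree_exists (T : set C) (I : finType) (v : I -> C) :
  lin_closed T -> T `<=` spanned v -> exists2 d, has_degree K T d & (d <= #|I|)%N.
Proof.
move=> lT sT.
pose P d := `[< exists w : 'I_d -> C, (forall i, T (w i)) /\ free_over w >].
have exP : exists d, P d.
  by exists 0%N; apply/asboolP; exists (fun=> 0); split=> [[]//|c _ _ []].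
have ubP d : P d -> (d <= #|I|)%N.
  move=> /asboolP [w [Tw fw]]; rewrite -[d]card_ord; apply: (free_le fw) => j.
  exact: sT.
case: (ex_maxnP exP ubP) => d Pd maxd; exists d; last exact: ubP.
move/asboolP: Pd => [w [Tw fw]]; exists w; split=> // x Tx.
apply: contrapT => nx; have := maxd d.+1; rewrite ltnn => h; suff : false by [].
apply: h; apply/asboolP; exists (fcons x w); split; last exact: free_fcons.
by move=> i; rewrite /fcons; case: unliftP.
Qed.

(** A basis of W together with an element of V outside W would be n + 1 independent elements in a
    span of at most n. *)
Lemma has_degree_full (W V : set C) n (I : finType) (v : I -> C) :
  has_degree K W n -> W `<=` V -> lin_closed W -> V `<=` spanned v -> (#|I| <= n)%N ->
  V `<=` W.
Proof.
move=> [b [Wb fb sb]] WV lW sV In x Vx; apply: contrapT => nx.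
have nx' : ~ spanned b x by move/(spanned_sub lW Wb).
have := @free_le _ _ v (fcons x b) (free_fcons fb nx').
rewrite card_ord => h; suff : (n.+1 <= #|I|)%N by rewrite ltnNge In.
by apply: h => j; apply: sV; rewrite /fcons; case: unliftP => // i _; apply: WV.
Qed.

(** Multiplication by y != 0 is injective, so it takes a basis of V to a basis of V; writing 1 in
    the new basis gives the inverse of y. *)
Lemma finite_subring_subfield (V : set C) (I : finType) (v : I -> C) :
  K `<=` V -> lin_closed V -> (forall x y, V x -> V y -> V (x * y)) ->
  V `<=` spanned v -> is_subfield V.
Proof.
move=> KV lV VM sV; have [_ VD VZ] := lV.
have VN x : V x -> V (- x).
  by move=> Vx; rewrite -mulN1r; apply: VZ => //; exact: (subfieldN hK (subfield1 hK)).
apply: is_subfieldP => [|x y Vx Vy|x y Vx Vy y0]; first exact/KV/(subfield1 hK).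
  by apply: VD => //; apply: VN.
apply: (VM) => //; have [d Vd _] := has_degree_exists lV sV; have [b [Vb fb sb]] := Vd.
have fyb : free_over (fun i => y * b i).
  move=> c Kc e; apply: fb => //; apply: (mulfI y0); rewrite mulr0 -[RHS]e mulr_sumr.
  by apply: eq_bigr => i _; rewrite mulrCA.
have [c Kc e] := free_spans_ord Vd (fun i => VM _ _ Vy (Vb i)) fyb (KV _ (subfield1 hK)).
suff -> : y^-1 = \sum_i c i * b i.
  by apply: lin_closed_sum => // i; apply: VZ.
apply: (mulfI y0); rewrite divff // [LHS]e mulr_sumr.
by apply: eq_bigr => i _; rewrite mulrCA.
Qed.

End LinearAlgebra.

Lemma subfield_lin_closed (C : fieldType) (K L : set C) :
  is_subfield L -> K `<=` L -> lin_closed K L.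
Proof.
move=> hL KL; split; [exact: subfield0|exact: subfieldD|].
by move=> a x /KL La Lx; apply: subfieldM.
Qed.

Lemma tower (C : fieldType) (K L T : set C) (I J : finType) (u : I -> C) (w : J -> C) :
  is_subfield K -> is_subfield L -> K `<=` L ->
  (forall i, L (u i)) -> free_over K u -> L `<=` spanned K u ->
  free_over L w -> T `<=` spanned L w ->
  free_over K (fun ij : I * J => u ij.1 * w ij.2) /\
  T `<=` spanned K (fun ij : I * J => u ij.1 * w ij.2).
Proof.
move=> hK hL KL Lu fu su fw sw; split.
  move=> c Kc; have -> : \sum_ij c ij * (u ij.1 * w ij.2) = \sum_j \sum_i c (i, j) * (u i * w j).
    by rewrite exchange_big pair_bigA /=; apply: eq_bigr => -[].
  move=> e [i j]; apply: (fu (fun i => c (i, j))) => // {i}.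
  apply: (fw (fun j => \sum_i c (i, j) * u i)) => [k|].
    by apply: subfield_sum => // i _; apply: subfieldM => //; apply: KL.
  rewrite -[RHS]e; apply: eq_bigr => k _; rewrite mulr_suml.
  by apply: eq_bigr => i _; rewrite mulrA.
move=> x /sw [c Lc ->].
have /choice [d hd] j : exists d : I -> C, (forall i, K (d i)) /\ c j = \sum_i d i * u i.
  by have [d Kd e] := su _ (Lc j); exists d.
exists (fun ij => d ij.2 ij.1) => [[i j]|]; first by case: (hd j).
rewrite -(pair_bigA _ (fun i j => d j i * (u i * w j))) /= exchange_big /=.
apply: eq_bigr => j _; case: (hd j) => _ {1}->; rewrite mulr_suml.
by apply: eq_bigr => i _; rewrite mulrA.
Qed.

Lemma has_degree_tower (C : fieldType) (K L T : set C) a b :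
  is_subfield K -> is_subfield L -> is_subfield T -> K `<=` L -> L `<=` T ->
  has_degree K L a -> has_degree L T b -> has_degree K T (a * b).
Proof.
move=> hK hL hT KL LT [u [Lu fu su]] [w [Tw fw sw]].
have [f s] := tower hK hL KL Lu fu su fw sw.
have -> : (a * b)%N = #|{: 'I_a * 'I_b}| by rewrite card_prod !card_ord.
by apply: has_degree_basis f s => // -[i j] /=; apply: subfieldM => //; apply: LT.
Qed.

(** * Calculus of embeddings *)

Section Homs.
Variables (C : fieldType) (E : set C) (tau : C -> C).
Hypotheses (hE : is_subfield E) (htau : hom_on E tau).

Lemma hom1 : tau 1 = 1. Proof. by case: htau. Qed.

Lemma homB x y : E x -> E y -> tau (x - y) = tau x - tau y.
Proof. by case: htau => _ + _; apply. Qed.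

Lemma homM x y : E x -> E y -> tau (x * y) = tau x * tau y.
Proof. by case: htau => _ _; apply. Qed.

Lemma hom0 : tau 0 = 0.
Proof. by have := homB (subfield1 hE) (subfield1 hE); rewrite !subrr. Qed.

Lemma homN x : E x -> tau (- x) = - tau x.
Proof. by move=> Ex; rewrite -sub0r (homB (subfield0 hE)) // hom0 sub0r. Qed.

Lemma homD x y : E x -> E y -> tau (x + y) = tau x + tau y.
Proof.
by move=> Ex Ey; rewrite -[y]opprK homB ?homN ?opprK //; exact: (subfieldN hE).
Qed.

Lemma homX x n : E x -> tau (x ^+ n) = tau x ^+ n.
Proof.
move=> Ex; elim: n => [|n IHn]; first by rewrite !expr0 hom1.
by rewrite !exprS homM ?IHn //; exact: subfieldX.
Qed.

Lemma hom_neq0 x : E x -> x != 0 -> tau x != 0.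
Proof.
move=> Ex x0; apply/eqP => tx0; have : tau (x / x) = 1 by rewrite divff // hom1.
rewrite (homM Ex (subfieldV hE Ex)) tx0 mul0r => /eqP.
by rewrite eq_sym oner_eq0.
Qed.

Lemma homV x : E x -> tau x^-1 = (tau x)^-1.
Proof.
move=> Ex; have [->|x0] := eqVneq x 0; first by rewrite invr0 hom0 invr0.
apply: (mulfI (hom_neq0 Ex x0)); rewrite divff ?hom_neq0 // -homM ?divff ?hom1 //.
exact: subfieldV.
Qed.

Lemma hom_div x y : E x -> E y -> tau (x / y) = tau x / tau y.
Proof. by move=> Ex Ey; rewrite homM ?homV //; exact: subfieldV. Qed.

Lemma hom_sum (I : finType) (F : I -> C) :
  (forall i, E (F i)) -> tau (\sum_i F i) = \sum_i tau (F i).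
Proof.
move=> EF; suff [] : tau (\sum_i F i) = \sum_i tau (F i) /\ E (\sum_i F i) by [].
elim/big_ind2: _ => [|x y x' y' [<- Ex] [<- Ey]|i _] //.
  by rewrite hom0; split=> //; exact: subfield0.
by rewrite homD //; split=> //; exact: subfieldD.
Qed.

End Homs.

Lemma sqrf_eq_sign (C : fieldType) (x y : C) : x ^+ 2 = y ^+ 2 -> x = y \/ x = - y.
Proof. by move/eqP; rewrite eqf_sqr => /orP[] /eqP; [left|right]. Qed.

(* Apply an embedding moving the ratio of two terms of a shortest relation. *)
Lemma kummer_free (C : numClosedFieldType) (A : set C) (I : finType) (d : I -> C) n :
  is_subfield A -> (0 < n)%N -> (forall z, z ^+ n = 1 -> A z) ->
  (forall i, d i != 0) -> (forall i, A (d i ^+ n)) ->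
  (forall i j, A (d i / d j) -> i = j) -> free_over A d.
Proof.
move=> hA n0 muA d0 Ad dinj.
suff H k (c : I -> C) : (#|[pred i | c i != 0%R]| <= k)%N -> (forall i, A (c i)) ->
    \sum_i c i * d i = 0 -> forall i, c i = 0.
  by move=> c Ac e; apply: (H _ c (leqnn _)).
elim: k c => [|k IHk] c; first by rewrite leqn0 => /eqP/card0_eq c0 _ _ i; have := c0 i; rewrite !inE => /eqP.
move=> ck Ac e i; apply/eqP; apply: contraT => ci.
have [j /andP[ji cj]|others] := pickP [pred j | (j != i) && (c j != 0)]; last first.
  move: e; rewrite (bigD1 i) //= big1 ?addr0 => [/eqP|j ji].
    by rewrite mulf_eq0 (negPf ci) (negPf (d0 i)).
  by have := others j; rewrite /= ji /= => /negbFE/eqP ->; rewrite mul0r.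
pose E := subfield_gen (A `|` [set` codom d]).
have hE : is_subfield E := subfield_gen_is_subfield _.
have AE : A `<=` E by move=> x Ax; apply: sub_subfield_gen; left.
have Ed l : E (d l) by apply: sub_subfield_gen; right; exact: codom_f.
have [|||tau [htau tauA tauji]] := @exists_moving_embedding C A hA (codom d) (d j / d i).
- move=> _ /codomP [l ->]; exact: (algebraic_on_root hA n0).
- exact: (subfield_div hE).
- by move=> /dinj ij; rewrite ij eqxx in ji.
pose w l := tau (d l) / d l.
have Aw l : A (w l).
  apply: muA; rewrite expr_div_n -(homX hE) // tauA // divff //.
  by rewrite expf_neq0.
(* Apply [tau] to the relation and subtract [w i] times it: the i-th coefficient disappears, and the
   j-th is multiplied by [w j - w i], nonzero since [tau] moves [d j / d i]. *)
have e' : \sum_l (c l * (w l - w i)) * d l = 0.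
  rewrite (eq_bigr (fun l => tau (c l * d l) - w i * (c l * d l))) => [|l _].
    rewrite sumrB -mulr_sumr e mulr0 subr0 -(hom_sum hE htau) ?e ?(hom0 hE htau) // => l.
    by apply: (subfieldM hE) => //; apply: AE.
  rewrite (homM htau (AE _ (Ac l)) (Ed l)) tauA //.
  rewrite mulrBr mulrBl [w i * _]mulrCA mulrA; congr (_ - _).
  by rewrite -mulrA /w mulfVK.
have /eqP : c j * (w j - w i) = 0.
  apply: (IHk (fun l => c l * (w l - w i)) _ _ e' j).
  - rewrite -ltnS (leq_trans _ ck) //; apply: proper_card.
  apply/fintype.properP; split; last by exists i; rewrite !inE ?subrr ?mulr0 ?eqxx.
  by apply/fintype.subsetP => l; rewrite !inE mulf_eq0 negb_or => /andP[].
  - by move=> l; apply: (subfieldM hA) => //; apply: (subfieldB hA).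
rewrite mulf_eq0 (negPf cj) subr_eq0 /= => /eqP wji; case: tauji.
have td l : tau (d l) = w l * d l by rewrite mulfVK.
rewrite (hom_div hE htau) // !td wji -mulf_div divff ?mul1r //.
by rewrite mulf_eq0 invr_eq0 negb_or d0 (hom_neq0 hE htau).
Qed.

Lemma primitive_root_exists (C : numClosedFieldType) n :
  (0 < n)%N -> exists z : C, n.-primitive_root z.
Proof.
move=> n0; have [r Pr] := closed_field_poly_normal ('X^n - 1 : {poly C}).
move: Pr; rewrite (monicP (monicXnsubC 1 n0)) scale1r => Pr.
have uniq_r : uniq r.
  rewrite -separable_prod_XsubC -Pr; apply: separable_Xn_sub_1.
  by rewrite pnatr_eq0 -lt0n.
have szr : size r = n.
  by apply/eqP; rewrite -eqSS -(size_prod_XsubC _ id) -Pr size_XnsubC.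
have /hasP [z _ zP] : has n.-primitive_root r.
  apply: cyclic.has_prim_root; rewrite ?szr //; apply/allP => z.
  by rewrite unity_rootE -root_prod_XsubC -Pr /root !hornerE subr_eq0.
by exists z.
Qed.

(** * Radical extensions *)

(** The group mu_n K^*. Exponents other than m serve for elements whose root of unity is not yet
    known to lie in mu_m. *)
Definition root_multiples (C : fieldType) (K : set C) (n : nat) : set C :=
  [set x | exists w k, [/\ w ^+ n = 1, K k, k != 0 & x = w * k]].

Section RootMultiples.
Variables (C : fieldType) (K : set C) (hK : is_subfield K) (n : nat).
Local Notation muK := (root_multiples K n).

Lemma root_multiples_neq0 x : (0 < n)%N -> muK x -> x != 0.
Proof.
move=> n0 [w [k [wn _ k0 ->]]]; rewrite mulf_eq0 negb_or k0 andbT.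
by apply: contra_eq_neq wn => ->; rewrite expr0n gtn_eqF // eq_sym oner_neq0.
Qed.

Lemma root_multiples_root w : w ^+ n = 1 -> muK w.
Proof. by move=> wn; exists w, 1; split; rewrite ?oner_neq0 ?mulr1 //; exact: subfield1. Qed.

Lemma root_multiplesM x y : muK x -> muK y -> muK (x * y).
Proof.
move=> [w [k [wn Kk k0 ->]]] [w' [k' [wn' Kk' k0' ->]]]; exists (w * w'), (k * k').
split; first by rewrite exprMn wn wn' mulr1.
- exact: subfieldM.
- by rewrite mulf_neq0.
- by rewrite mulrACA.
Qed.

Lemma root_multiplesV x : muK x -> muK x^-1.
Proof.
move=> [w [k [wn Kk k0 ->]]]; exists w^-1, k^-1.
split; first by rewrite exprVn wn invr1.
- exact: subfieldV.
- by rewrite invr_eq0.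
- by rewrite invfM.
Qed.

Lemma root_multiplesX x i : muK x -> muK (x ^+ i).
Proof.
move=> mx; elim: i => [|i IHi]; rewrite ?expr0 ?exprS; last exact: root_multiplesM.
by apply: root_multiples_root; rewrite expr1n.
Qed.

Lemma root_multiples_dvd N x : (n %| N)%N -> muK x -> root_multiples K N x.
Proof.
move=> /dvdnP [q ->] [w [k [wn Kk k0 ->]]]; exists w, k; split=> //.
by rewrite mulnC exprM wn expr1n.
Qed.

End RootMultiples.

(* Sah's argument: as E / K is abelian, x^(t - 1) lies in mu_N K for every
   embedding acting on mu_N by z |-> z^t; the exponents j such that x^j lies in
   mu_N K are therefore the multiples of some g with mu_g <= K. *)
Lemma abelian_radical (C : numClosedFieldType) (K : set C) (N n a : nat) (z x : C)
    (ys : seq C) :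
  is_subfield K -> (forall w i, (0 < i)%N -> K w -> w ^+ i = 1 -> w = 1 \/ w = -1) ->
  (0 < n)%N -> (0 < N)%N -> N.-primitive_root z -> (n * a %| N)%N ->
  (forall y, y \in ys -> K (y ^+ 2)) ->
  subfield_gen (K `|` [set` z :: ys]) x ->
  root_multiples K a (x ^+ n) -> root_multiples K N (x ^+ 2).
Proof.
move=> hK K1 n0 N0 zP naN Kys Ex xn.
set E := subfield_gen _ in Ex; have hE : is_subfield E := subfield_gen_is_subfield _.
have KE : K `<=` E by move=> y Ky; apply: sub_subfield_gen; left.
have Ez : E z by apply: sub_subfield_gen; right; exact: mem_head.
have Eys y : y \in ys -> E y.
  by move=> yys; apply: sub_subfield_gen; right; rewrite /= inE yys orbT.
have aN : (a %| N)%N by apply: dvdn_trans naN; rewrite dvdn_mull.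
have nN : (n %| N)%N by apply: dvdn_trans naN; rewrite dvdn_mulr.
have x0 : x != 0.
  have := root_multiples_neq0 (dvdn_gt0 N0 aN) xn.
  by apply: contraNneq => ->; rewrite expr0n gtn_eqF.
pose J j := root_multiples K N (x ^+ j).
have Jn : J n by apply: root_multiples_dvd xn.
have JB i j : J (i + j)%N -> J i -> J j.
  rewrite /J exprD => Jij Ji; rewrite -[_ ^+ j](mulKf (expf_neq0 i x0)).
  by apply: root_multiplesM => //; exact: root_multiplesV.
have JM i j : J i -> J (j * i)%N.
  by move=> Ji; rewrite /J mulnC exprM; exact: root_multiplesX.
have EmuN w : w ^+ N = 1 -> E w.
  by move=> /(prim_rootP zP) [i ->]; exact: (subfieldX hE).
(* With the exponent written as [t.+1], tau - 1 acts on mu_N by the t-th power. Adding N to [i]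
   makes the exponent positive even when [i] is 0. *)
have muN_tau tau : hom_on E tau -> exists t, forall w, w ^+ N = 1 -> tau w = w ^+ t.+1.
  move=> htau; have : tau z ^+ N = 1 by rewrite -(homX hE) // (prim_expr_order zP) (hom1 htau).
  move=> /(prim_rootP zP) [i zi]; exists (i + N).-1 => w /(prim_rootP zP) [j ->].
  rewrite prednK ?addn_gt0 ?N0 ?orbT // (homX hE) // zi -exprM -[RHS]exprM mulnDr exprD.
  by rewrite [(j * N)%N]mulnC [z ^+ (N * j)]exprM (prim_expr_order zP) expr1n mulr1 mulnC.
have tau_x tau : hom_on E tau -> (forall k, K k -> tau k = k) ->
    exists2 w, w ^+ N = 1 & tau x = w * x.
  move=> htau tauK; exists (tau x / x); last by rewrite mulfVK.
  have [w [k [wa Kk k0 xk]]] := xn.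
  have wN : w ^+ N = 1.
    by case/dvdnP: aN => q ->; rewrite mulnC exprM wa expr1n.
  case/dvdnP: naN => q ->; rewrite [(q * _)%N]mulnC exprM [_ ^+ (n * a)]exprM expr_div_n.
  rewrite -(homX hE htau _ Ex) // xk.
  rewrite (homM htau (EmuN _ wN) (KE _ Kk)) (tauK _ Kk) -mulf_div divff // mulr1 expr_div_n.
  by rewrite -(homX hE htau _ (EmuN _ wN)) wa (hom1 htau) divr1 expr1n.
have tau_ys tau y : hom_on E tau -> (forall k, K k -> tau k = k) -> y \in ys ->
    tau y = y \/ tau y = - y.
  move=> htau tauK yys; apply: sqrf_eq_sign.
  rewrite -(homX hE) //; last exact: Eys.
  exact/tauK/Kys.
(* On the generators the embeddings act by powers of z and by signs, so any two of them commute on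
   E. This is all that is used of E / K being abelian. *)
have comm s tau u : hom_on E s -> (forall k, K k -> s k = k) ->
    hom_on E tau -> (forall k, K k -> tau k = k) -> E u ->
    [/\ E (s u), E (tau u) & s (tau u) = tau (s u)].
  move=> hs sK htau tauK.
  suff EB : E `<=` [set u | E u /\ [/\ E (s u), E (tau u) & s (tau u) = tau (s u)]].
    by move=> /EB [].
  apply: subfield_gen_min.
    apply: is_subfieldP.
    - by rewrite /= (hom1 hs) (hom1 htau) (hom1 hs); do !split=> //; exact: (subfield1 hE).
    - move=> u1 u2 [E1 [Es1 Et1 c1]] [E2 [Es2 Et2 c2]]; split; first exact: (subfieldB hE).
      rewrite (homB hs E1 E2) (homB htau E1 E2) (homB hs Et1 Et2) (homB htau Es1 Es2) c1 c2.
      by split=> //; exact: (subfieldB hE).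
    - move=> u1 u2 [E1 [Es1 Et1 c1]] [E2 [Es2 Et2 c2]] _; split; first exact: (subfield_div hE).
      rewrite (hom_div hE hs E1 E2) (hom_div hE htau E1 E2).
      rewrite (hom_div hE hs Et1 Et2) (hom_div hE htau Es1 Es2) c1 c2.
      by split=> //; exact: (subfield_div hE).
  move=> {}u [Ku|/=].
    split; first exact: KE.
    by rewrite sK // tauK // sK //; split=> //; exact: KE.
  rewrite inE => /predU1P[->|uys].
    have [t tP] := muN_tau _ hs; have [t' tP'] := muN_tau _ htau.
    have zN := prim_expr_order zP.
    have zN' i : (z ^+ i) ^+ N = 1 by rewrite exprAC zN expr1n.
    rewrite (tP _ zN) (tP' _ zN) tP ?tP' //; split=> //; split; try exact: (subfieldX hE).
    by rewrite exprAC.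
  have Eu := Eys _ uys; have ENu := subfieldN hE Eu.
  by case: (tau_ys _ _ hs sK uys) (tau_ys _ _ htau tauK uys) => [] su [] tu;
    rewrite ?su ?tu ?(homN hE hs Eu) ?(homN hE htau Eu) ?su ?tu.
(* If tau x = w x and s x = v x, commutation gives s w = v^t w. So every s fixes x^t / w, which
   therefore lies in K. *)
have Jt tau t : hom_on E tau -> (forall k, K k -> tau k = k) ->
    (forall w, w ^+ N = 1 -> tau w = w ^+ t.+1) -> J t.
  move=> htau tauK tauN; have [w wN xw] := tau_x _ htau tauK.
  have w0 : w != 0.
    by apply: contra_eq_neq wN => ->; rewrite expr0n gtn_eqF // eq_sym oner_neq0.
  suff Ky : K (x ^+ t / w).
    exists w, (x ^+ t / w); split=> //; last by rewrite mulrC mulfVK.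
    by rewrite mulf_neq0 ?invr_eq0 ?expf_neq0.
  apply: contrapT => nKy.
  have [||s [hs sK]] := @exists_moving_embedding C K hK (z :: ys) (x ^+ t / w) _ _ nKy.
  - move=> u; rewrite inE => /predU1P[->|/Kys Ku]; last exact: (algebraic_on_root hK _ Ku).
    by apply: (algebraic_on_root hK N0); rewrite (prim_expr_order zP); exact: (subfield1 hK).
  - by apply: (subfield_div hE); [exact: (subfieldX hE)|exact: EmuN].
  have Ew := EmuN _ wN; case.
  have [v vN xv] := tau_x _ hs sK; have Ev := EmuN _ vN.
  have [_ _] := comm _ _ _ hs sK htau tauK Ex.
  rewrite xw xv (homM hs Ew Ex) (homM htau Ev Ex) xw xv tauN // exprSr => e.
  have v0 : v != 0.
    by apply: contra_eq_neq vN => ->; rewrite expr0n gtn_eqF // eq_sym oner_neq0.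
  have {e} sw : s w = v ^+ t * w.
    apply: (mulIf v0); apply: (mulIf x0); rewrite -mulrA e -!mulrA; congr (_ * _).
    by rewrite mulrCA.
  rewrite (hom_div hE hs) //; last exact: (subfieldX hE).
  by rewrite (homX hE) // sw xv exprMn -mulf_div divff ?mul1r // expf_neq0.
have [g [g0 Jg ming]] : exists g, [/\ (0 < g)%N, J g & forall j, J j -> (g %| j)%N].
  have ex : exists g, (0 < g)%N && `[< J g >] by exists n; rewrite n0; apply/asboolP.
  case: (ex_minnP ex) => g /andP[g0 /asboolP Jg] ming; exists g; split=> // j Jj.
  rewrite /dvdn; apply: contraT; rewrite -lt0n => r0.
  have := ming (j %% g)%N; rewrite r0 leqNgt ltn_mod g0 /= => h; apply: h; apply/asboolP.
  by apply: (JB (j %/ g * g)%N); rewrite -?divn_eq //; exact: JM.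
have gN : (g %| N)%N by apply: dvdn_trans (ming _ Jn) nN.
have zg : (z ^+ (N %/ g)) ^+ N = 1 by rewrite exprAC (prim_expr_order zP) expr1n.
have Kzg : K (z ^+ (N %/ g)).
  apply: contrapT => nK.
  have [||s [hs sK]] := @exists_moving_embedding C K hK (z :: ys) (z ^+ (N %/ g)) _ _ nK.
  - move=> u; rewrite inE => /predU1P[->|/Kys Ku]; last exact: (algebraic_on_root hK _ Ku).
    by apply: (algebraic_on_root hK N0); rewrite (prim_expr_order zP); exact: (subfield1 hK).
  - exact: (subfieldX hE).
  have [t tP] := muN_tau _ hs; have /ming/dvdnP [q tq] := Jt _ _ hs sK tP.
  rewrite tP // exprS tq mulnC [_ ^+ (g * q)]exprM -[_ ^+ _ ^+ g]exprM (divnK gN).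
  by rewrite (prim_expr_order zP) expr1n mulr1; case.
(* The root of unity z^(N/g) has order g and lies in K, so it is 1 or -1 and g divides 2. *)
have : (z ^+ (N %/ g)) ^+ 2 = 1.
  by case: (K1 _ N N0 Kzg zg) => ->; rewrite ?sqrrN expr1n.
rewrite -exprM => /eqP; rewrite -(prim_order_dvd zP) => N2.
have /dvdnP [q ->] : (g %| 2)%N.
  have Ng0 : (0 < N %/ g)%N by rewrite divn_gt0 // dvdn_leq.
  by rewrite -(dvdn_pmul2l Ng0) (divnK gN).
exact: JM.
Qed.

(* A field generated by a group whose classes modulo K^* have finitely many
   representatives is linearly spanned by them. *)
Lemma subfield_gen_group (C : fieldType) (K G : set C) (I : finType) (v : I -> C) :
  is_subfield K -> G 1 -> (forall x y, G x -> G y -> G (x * y)) ->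
  (forall i, G (v i)) -> (forall i, v i != 0) -> (forall x, G x -> exists i, K (x / v i)) ->
  subfield_gen (K `|` G) `<=` spanned K v.
Proof.
move=> hK G1 GM Gv v0 Gcov; pose V := spanned K v.
have lV : lin_closed K V := spanned_lin_closed hK v.
have GV : G `<=` V.
  move=> x /Gcov [i Kx]; rewrite -[x](mulfVK (v0 i)); apply: (spannedZ hK) => //.
  exact: mem_spanned.
have KV : K `<=` V.
  by move=> k Kk; rewrite -[k]mulr1; apply: (spannedZ hK) => //; exact: GV.
apply: subfield_gen_min; last by move=> x [/KV|/GV].
apply: (finite_subring_subfield hK KV lV (v := v)) => // x y [c Kc ->] [d Kd ->].
rewrite mulr_suml; apply: (spanned_sum hK) => i _; rewrite mulr_sumr.
apply: (spanned_sum hK) => j _; rewrite mulrACA; apply: (spannedZ hK).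
  exact: subfieldM.
by apply: GV; exact: GM.
Qed.

Lemma field_gen_base (C : fieldType) (K S : set C) : K `<=` subfield_gen (K `|` S).
Proof. by move=> x Kx; apply: sub_subfield_gen; left. Qed.

Lemma field_gen_gen (C : fieldType) (K S : set C) : S `<=` subfield_gen (K `|` S).
Proof. by move=> x Sx; apply: sub_subfield_gen; right. Qed.

(* In the application, G is generated by K^* and the values of chi, and the
   image of eps is mu_m, so that subfield_gen (K `|` half_group K G m) is T_g. *)
Definition square_classes (C : fieldType) (K G : set C) (m : nat) : set C :=
  [set k | [/\ K k, k != 0 & exists x z, [/\ G x, z ^+ m = 1 & x ^+ 2 = z * k]]].

Definition sqrt_field (C : fieldType) (K G : set C) (m : nat) : set C :=
  subfield_gen (K `|` [set y | square_classes K G m (y ^+ 2)]).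

Definition half_group (C : fieldType) (K G : set C) (m : nat) : set C :=
  [set x | G x /\ root_multiples K m (x ^+ 2)].

(** * Degrees in the tower K <= T_g <= T *)

Section RadicalGroup.
Variables (C : numClosedFieldType) (K G : set C) (m h : nat) (d : 'I_h -> C).
Hypotheses (hK : is_subfield K)
  (K1 : forall w i, (0 < i)%N -> K w -> w ^+ i = 1 -> w = 1 \/ w = -1)
  (m0 : (0 < m)%N) (m2 : (2 %| m)%N)
  (G0 : forall x, G x -> x != 0)
  (GM : forall x y, G x -> G y -> G (x * y))
  (GV : forall x, G x -> G x^-1)
  (KG : forall x, K x -> x != 0 -> G x)
  (muG : forall z, z ^+ m = 1 -> G z)
  (GH : forall x n, (0 < n)%N -> G x -> root_multiples K n x -> root_multiples K m x)
  (Gd : forall i, G (d i))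
  (dinj : forall i j, root_multiples K m (d i / d j) -> i = j)
  (dsurj : forall x, G x -> exists i, root_multiples K m (x / d i)).

Local Notation muK := (root_multiples K m).
Local Notation G2 := (half_group K G m).
Local Notation R := (square_classes K G m).
Local Notation W := (sqrt_field K G m).
Local Notation T := (subfield_gen (K `|` G)).
Local Notation Tg := (subfield_gen (K `|` G2)).
Local Notation I2 := {i : 'I_h | `[< G2 (d i) >]}.

Let muKM := @root_multiplesM C K hK m.
Let muKV := @root_multiplesV C K hK m.
Let muKX := @root_multiplesX C K hK m.

Let sqr1 (z : C) : z ^+ 2 = 1 -> z ^+ m = 1.
Proof. by case/dvdnP: m2 => q -> z2; rewrite mulnC exprM z2 expr1n. Qed.

Let d0 i : d i != 0. Proof. exact: G0. Qed.

Let G1 : G 1. Proof. by apply: muG; rewrite expr1n. Qed.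

Let Gdiv x y : G x -> G y -> G (x / y).
Proof. by move=> Gx Gy; apply: GM => //; exact: GV. Qed.

Let muKG x : muK x -> G x.
Proof. by move=> [w [k [wm Kk k0 ->]]]; apply: GM; [exact: muG|exact: KG]. Qed.

Let h_gt0 : (0 < h)%N.
Proof. by have [i _] := dsurj G1; apply: leq_ltn_trans (ltn_ord i). Qed.

(** Among h + 1 powers of x two lie in the same class; the difference of their exponents is at most
    h and so divides h!. *)
Lemma group_exponent x : G x -> muK (x ^+ h`!).
Proof.
move=> Gx; have Gxn n : G (x ^+ n).
  by elim: n => [|n IHn]; rewrite ?expr0 ?exprS //; exact: GM.
have /choice [f fP] (i : 'I_h.+1) := dsurj (Gxn i).
suff [i [j [ij fij]]] : exists i j : 'I_h.+1, (i < j)%N /\ f i = f j.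
  have Mij : muK (x ^+ (j - i)).
    have -> : x ^+ (j - i) = (x ^+ j / d (f j)) / (x ^+ i / d (f i)).
      rewrite fij invfM invrK mulrACA mulVf // mulr1 -{2}(subnK (ltnW ij)) exprD.
      by rewrite mulfK // expf_neq0 // G0.
    by apply: muKM => //; exact: muKV.
  have /dvdnP [q ->] : (j - i %| h`!)%N.
    apply: dvdn_fact; rewrite subn_gt0 ij /=.
    by rewrite (leq_trans (leq_subr _ _)) // -ltnS.
  by rewrite mulnC exprM; exact: muKX.
have /injectivePn [i [j ij fij]] : ~~ injectiveb f.
  by apply/negP => /injectiveP/leq_card; rewrite !card_ord ltnn.
case: (ltngtP i j) => [lij|lij|/val_inj eij]; first by exists i, j.
  by exists j, i.
by rewrite eij eqxx in ij.
Qed.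

Let R1 : R 1.
Proof.
split; [exact: subfield1|exact: oner_neq0|exists 1, 1].
by split; rewrite ?expr1n ?mulr1.
Qed.

Lemma square_classesM k l : R k -> R l -> R (k * l).
Proof.
move=> [Kk k0 [x [z [Gx zm xk]]]] [Kl l0 [y [w [Gy wm yl]]]].
split; [exact: subfieldM|by rewrite mulf_neq0|exists (x * y), (z * w)].
by split; [exact: GM|rewrite exprMn zm wm mulr1|rewrite exprMn xk yl mulrACA].
Qed.

Lemma square_classesN k : R k -> R (- k).
Proof.
move=> [Kk k0 [x [z [Gx zm xk]]]]; split; [exact: subfieldN|by rewrite oppr_eq0|].
exists x, (- z); split=> //; last by rewrite mulrNN.
by rewrite -mulN1r exprMn zm mulr1; apply: sqr1; rewrite sqrrN expr1n.
Qed.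

Lemma square_classes_sqr k : K k -> k != 0 -> R (k ^+ 2).
Proof.
move=> Kk k0; split; [exact: subfieldX|by rewrite expf_neq0|exists k, 1].
by split; rewrite ?expr1n ?mul1r //; exact: KG.
Qed.

Let nKi : ~ K 'i.
Proof.
have i4 : 'i ^+ 4 = 1 :> C by rewrite (exprM _ 2 2) sqrCi sqrrN expr1n.
move=> /(@K1 _ 4 isT)/(_ i4) h'; have : 'i ^+ 2 = 1 :> C.
  by case: h' => ->; rewrite ?sqrrN expr1n.
by rewrite sqrCi => /eqP; rewrite eq_sym -subr_eq0 opprK (_ : 1 + 1 = 2%:R) // pnatr_eq0.
Qed.

(** The square classes modulo squares of K number 2c: a class of G2 with representative [d i] fixes
    k in [d i ^+ 2 = z * k] up to squares and up to the elements 1 and -1 of mu_m in K. The boolean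
    chooses between sqrt k and sqrt(-k) = 'i sqrt k, and Kummer theory with exponent 2 gives
    independence. *)
Lemma sqrt_field_basis : exists y : I2 * bool -> C,
  [/\ forall j, R (y j ^+ 2), free_over K y & W `<=` spanned K y].
Proof.
have /choice [kz kzP] (i : I2) : exists kz : C * C,
    [/\ K kz.1, kz.1 != 0, kz.2 ^+ m = 1 & d (val i) ^+ 2 = kz.2 * kz.1].
  by have /asboolP [_ [z [k [zm Kk k0 e]]]] := valP i; exists (k, z).
pose e (b : bool) : C := if b then 'i else 1.
have e2 b : e b ^+ 2 = (-1) ^+ b by case: b; rewrite /= ?sqrCi ?expr1n.
have e0 b : e b != 0 by case: b; rewrite /= ?neq0Ci ?oner_neq0.
pose y (j : I2 * bool) := e j.2 * sqrtC (kz j.1).1.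
have y2 j : y j ^+ 2 = (-1) ^+ j.2 * (kz j.1).1 by rewrite exprMn e2 sqrtCK.
have Rk i : R (kz i).1.
  by case: (kzP i) => Kk k0 zm dk; split=> //; exists (d (val i)), (kz i).2.
have Ry j : R (y j ^+ 2).
  rewrite y2; case: (j.2); last by rewrite mul1r.
  by rewrite mulN1r; exact: square_classesN.
have y0 j : y j != 0 by rewrite -sqrf_eq0; case: (Ry j).
have ycov x : R (x ^+ 2) -> exists j, K (x / y j).
  move=> [Kx x0 [u [z [Gu zm ux]]]].
  have [i [w [k [wm Kk k0 ui]]]] := dsurj Gu.
  have G2i : `[< G2 (d i) >].
    apply/asboolP; split=> //; have -> : d i ^+ 2 = u ^+ 2 / (u / d i) ^+ 2.
      by field; rewrite d0 G0.
    apply: muKM; last by apply: muKV; apply: muKX; rewrite ui; exists w, k.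
    by rewrite ux; exists z, (x ^+ 2).
  pose i' : I2 := Sub i G2i; have [Kk' k0' zm' dk'] := kzP i'.
  have e1 : u = w * k * d i by rewrite -ui mulfVK.
  have rt : (x ^+ 2 / ((kz i').1 * k ^+ 2)) ^+ m = 1.
    have -> : x ^+ 2 / ((kz i').1 * k ^+ 2) = w ^+ 2 * (kz i').2 / z.
      have z0 : z != 0 by apply/G0/muG.
      have -> : x ^+ 2 = w ^+ 2 * k ^+ 2 * ((kz i').2 * (kz i').1) / z.
        by apply: (mulIf z0); rewrite mulfVK // mulrC -ux e1 !exprMn (dk' : d i ^+ 2 = _).
      by field; rewrite z0 k0 k0'.
    by rewrite expr_div_n exprMn zm zm' -exprM mulnC exprM wm expr1n divr1 mulr1.
  have Kq : K (x ^+ 2 / ((kz i').1 * k ^+ 2)).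
    by apply: subfield_div => //; apply: subfieldM => //; exact: subfieldX.
  have [b eb] : exists b : bool, x ^+ 2 = (y (i', b) * k) ^+ 2.
    have [q1|q1] := K1 m0 Kq rt.
      exists false; rewrite exprMn y2 mul1r /=.
      by rewrite -[LHS](mulfVK (mulf_neq0 k0' (expf_neq0 2 k0))) q1 mul1r.
    exists true; rewrite exprMn y2 mulN1r /= mulNr.
    by rewrite -[LHS](mulfVK (mulf_neq0 k0' (expf_neq0 2 k0))) q1 mulN1r.
  exists (i', b); case: (sqrf_eq_sign eb) => ->.
    by rewrite mulrAC divff // mul1r.
  by rewrite mulNr; apply: (subfieldN hK); rewrite mulrAC divff // mul1r.
exists y; split=> //.
  apply: (@kummer_free _ K _ y 2) => // [z /eqP|i|[i b] [j c] Kij].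
  - rewrite -[1](expr1n _ 2) eqf_sqr => /orP[] /eqP ->; first exact: subfield1.
    by apply: (subfieldN hK); exact: subfield1.
  - by case: (Ry i).
  have [[Ki ki0 zi di] [Kj kj0 zj dj]] := (kzP i, kzP j).
  have ij : i = j.
    (* If the ratio of the two square roots lies in K, then [d i / d j] is a 2m-th root of unity
       times that ratio, and [GH] brings it back to mu_m K^*. *)
    apply/val_inj/dinj; apply: (@GH _ (2 * m)); rewrite ?muln_gt0 //; first exact: Gdiv.
    exists (d (val i) / d (val j) / (y (i, b) / y (j, c))), (y (i, b) / y (j, c)).
    split=> //; last by rewrite mulfVK // mulf_neq0 ?invr_eq0.
    - rewrite exprM !expr_div_n di dj !y2 /=.
      have sgn (a : bool) : ((-1 : C) ^+ a) ^+ m = 1.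
        by apply: sqr1; rewrite -exprM mulnC exprM sqrrN !expr1n.
      by rewrite !exprMn zi zj !sgn !mul1r divff // mulf_neq0 ?invr_eq0 ?expf_neq0.
    - by rewrite mulf_neq0 ?invr_eq0.
  rewrite -ij in Kij *; congr (_, _).
  move: Kij; rewrite /y /= -mulf_div divff ?mulr1; last by rewrite sqrtC_eq0.
  case: b c => [] [] //=; rewrite ?divr1 => //.
  by rewrite div1r => /(subfieldV hK); rewrite invrK.
apply: subfield_gen_group => //=.
- by rewrite expr1n.
- by move=> a b Ra Rb; rewrite exprMn; exact: square_classesM.
Qed.

Let G2M x y : G2 x -> G2 y -> G2 (x * y).
Proof. by move=> [Gx x2] [Gy y2]; split; rewrite ?exprMn; [exact: GM|exact: muKM]. Qed.

Let G2V x : G2 x -> G2 x^-1.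
Proof. by move=> [Gx x2]; split; rewrite ?exprVn; [exact: GV|exact: muKV]. Qed.

Let muKG2 x : muK x -> G2 x.
Proof. by move=> mx; split; [exact: muKG|exact: muKX]. Qed.

Let G2div x y : G2 x -> G2 y -> G2 (x / y).
Proof. by move=> ? /G2V; exact: G2M. Qed.

Let hTg : is_subfield Tg. Proof. exact: subfield_gen_is_subfield. Qed.

Let G2Tg : G2 `<=` Tg. Proof. exact: field_gen_gen. Qed.

Let KTg : K `<=` Tg. Proof. exact: field_gen_base. Qed.

Let TgT : Tg `<=` T.
Proof.
apply: subfield_gen_min; first exact: subfield_gen_is_subfield.
by move=> x [/(@field_gen_base _ K G)|[/(@field_gen_gen _ K G)]].
Qed.

Let eqv i j : bool := `[< G2 (d i / d j) >].

Let eqv_refl i : eqv i i.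
Proof. by apply/asboolP; rewrite divff //; apply/muKG2/root_multiples_root; rewrite ?expr1n. Qed.

Let eqv_sym i j : eqv i j -> eqv j i.
Proof. by move=> /asboolP/G2V; rewrite invf_div => ?; apply/asboolP. Qed.

Let eqv_trans i j k : eqv i j -> eqv j k -> eqv i k.
Proof.
move=> /asboolP ij /asboolP jk; apply/asboolP.
have -> : d i / d k = (d i / d j) * (d j / d k) by field; rewrite !d0.
exact: G2M.
Qed.

(** [pick] depends only on the extension of the predicate, so equivalent indices get the same
    representative; the default is never reached, by reflexivity. *)
Let rep i : 'I_h := odflt i [pick j | eqv i j].

Let rep_eqv i : eqv i (rep i).
Proof. by rewrite /rep; case: pickP => //= _; exact: eqv_refl. Qed.

Let rep_eq i j : eqv i j -> rep i = rep j.
Proof.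
move=> ij; have e : eqv i =1 eqv j.
  move=> k; apply/idP/idP => [|]; first by apply: eqv_trans; exact: eqv_sym.
  exact: eqv_trans.
rewrite /rep (eq_pick e); case: pickP => //= /(_ j).
by rewrite eqv_refl.
Qed.

Local Notation Q := {i : 'I_h | rep i == i}.

(** Multiplicativity of the index along mu_m K^* <= G2 <= G, by an injection in each direction:
    split a class as (class in G2) times (representative modulo G2), or multiply the two. *)
Let card_half_group : h = (#|{: I2}| * #|{: Q}|)%N.
Proof.
have /choice [ix ixP] (x : C) : exists i, G x -> muK (x / d i).
  have [Gx|nGx] := pselect (G x); last by exists (Ordinal h_gt0).
  by have [i mi] := dsurj Gx; exists i.
apply/eqP; rewrite -[h in h == _]card_ord -card_prod eqn_leq; apply/andP; split.
  have repK i : rep (rep i) == rep i by apply/eqP/esym/rep_eq; exact: rep_eqv.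
  have G2ix i : `[< G2 (d (ix (d i / d (rep i)))) >].
    have /asboolP g := rep_eqv i; have gx := ixP _ (g.1); apply/asboolP.
    have -> : d (ix (d i / d (rep i))) = (d i / d (rep i)) / ((d i / d (rep i)) / d (ix (d i / d (rep i)))).
      by field; rewrite !d0.
    by apply: G2div => //; exact: muKG2.
  pose f i : I2 * Q :=
    (exist (fun i => `[< G2 (d i) >]) _ (G2ix i), exist (fun i => rep i == i) _ (repK i)).
  apply: (@leq_card _ _ f) => i j [e1 e2]; apply: dinj.
  have /asboolP gi := rep_eqv i; have /asboolP gj := rep_eqv j.
  have mi := ixP _ gi.1; have mj := ixP _ gj.1.
  have -> : d i / d j = (d i / d (rep i) / d (ix (d i / d (rep i)))) /
      (d j / d (rep j) / d (ix (d j / d (rep j)))).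
    by rewrite e1 e2; field; rewrite !d0.
  by apply: muKM => //; exact: muKV.
pose f (p : I2 * Q) : 'I_h := ix (d (val p.1) * d (val p.2)).
apply: (@leq_card _ _ f) => -[[i i2] [q q2]] [[j j2] [r r2]]; rewrite /f /= => e.
have mi := ixP _ (GM (Gd i) (Gd q)); have mj := ixP _ (GM (Gd j) (Gd r)).
have gi : G2 (d i) by apply/asboolP.
have gj : G2 (d j) by apply/asboolP.
have qr : q = r.
  rewrite -(eqP q2) -(eqP r2); apply: rep_eq; apply/asboolP.
  have -> : d q / d r = (d j / d i) * ((d i * d q / d (ix (d i * d q))) / (d j * d r / d (ix (d j * d r)))).
    by rewrite e; field; rewrite !d0.
  by apply: G2M; [exact: G2div|apply: muKG2; apply: muKM => //; exact: muKV].
subst r; have ij : i = j.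
  apply: dinj.
  have -> : d i / d j = (d i * d q / d (ix (d i * d q))) / (d j * d q / d (ix (d j * d q))).
    by rewrite e; field; rewrite !d0.
  by apply: muKM => //; exact: muKV.
by subst j; congr (_, _); apply: val_inj.
Qed.

Let sqrt_mu (w : C) : w ^+ m = 1 -> sqrtC w ^+ (2 * m) = 1.
Proof. by rewrite exprM sqrtCK. Qed.

(** From x^2 = w k, x is sqrt w times sqrt k up to sign. Hence T_g <= W(mu_2m). *)
Let half_group_sqrt x : G2 x -> exists w k, [/\ w ^+ (2 * m) = 1, R (k ^+ 2) & x = w * k].
Proof.
move=> [Gx [w [k [wm Kk k0 x2]]]].
have Rk : R k by split=> //; exists x, w.
have : x ^+ 2 = (sqrtC w * sqrtC k) ^+ 2 by rewrite exprMn !sqrtCK.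
case/sqrf_eq_sign => ->; last rewrite -mulrN.
  by exists (sqrtC w), (sqrtC k); rewrite sqrtCK; split=> //; exact: sqrt_mu.
by exists (sqrtC w), (- sqrtC k); rewrite sqrrN sqrtCK; split=> //; exact: sqrt_mu.
Qed.

Let sqrt_field_sqrt k : R (k ^+ 2) -> W k.
Proof. by move=> Rk; apply: (@field_gen_gen _ K [set y | R (y ^+ 2)]). Qed.

Let degree_over_Tg : has_degree Tg T #|{: Q}|.
Proof.
have [y [Ry _ Wy]] := sqrt_field_basis.
(* Sah's argument, for h!-th powers in mu_m K^*, needs h! m to divide N. The factor 2 ensures mu_2m
   <= E, hence T_g <= E. *)
pose N := (2 * (h`! * m))%N.
have N0 : (0 < N)%N by rewrite !muln_gt0 fact_gt0 m0.
have [z zP] := primitive_root_exists C N0.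
pose E := subfield_gen (K `|` [set` z :: codom y]).
have hE : is_subfield E := subfield_gen_is_subfield _.
have KE : K `<=` E by exact: field_gen_base.
have muE n w : (n %| N)%N -> w ^+ n = 1 -> E w.
  case/dvdnP => l Nl wn; have /(prim_rootP zP) [i ->] : w ^+ N = 1.
    by rewrite Nl mulnC exprM wn expr1n.
  by apply: (subfieldX hE); apply: field_gen_gen; exact: mem_head.
have WE : W `<=` E.
  move=> x /Wy; apply: (spanned_sub (subfield_lin_closed hE KE)) => j.
  by apply: field_gen_gen; rewrite /= inE codom_f orbT.
have TgE : Tg `<=` E.
  apply: subfield_gen_min => // x [/KE//|/half_group_sqrt [w [k [wm Rk ->]]]].
  apply: (subfieldM hE); last exact: (WE _ (sqrt_field_sqrt Rk)).
  by apply: muE wm; rewrite dvdn_pmul2l // dvdn_mull.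
have GE x : G x -> E x -> G2 x.
  move=> Gx Ex; split=> //; apply: (GH N0); first by rewrite expr2; exact: GM.
  apply: (abelian_radical hK K1 (fact_gt0 h) N0 zP (a := m) _ _ Ex).
  - by rewrite dvdn_mull.
  - by move=> _ /codomP [j ->]; case: (Ry j).
  - exact: group_exponent.
apply: (@has_degree_basis _ Tg _ T (fun i : Q => d (val i))) => [i||].
- exact: field_gen_gen.
- have fE : free_over E (fun i : Q => d (val i)).
    apply: (kummer_free hE (fact_gt0 h)) => // [w|i|i j Eij].
    + by apply: muE; rewrite /N mulnCA dvdn_mulr.
    + have [w [k [wm Kk _ ->]]] := group_exponent (Gd (val i)).
      apply: (subfieldM hE); last exact: KE.
      by apply: muE wm; rewrite /N mulnA dvdn_mull.
    + apply/val_inj; rewrite -(eqP (valP i)) -(eqP (valP j)); apply: rep_eq.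
      by apply/asboolP; apply: GE => //; exact: Gdiv.
  by move=> c Tc; apply: fE => i; exact: TgE.
have TTg : T `<=` subfield_gen (Tg `|` G).
  apply: subfield_gen_min; first exact: subfield_gen_is_subfield.
  by move=> x [/KTg|]; [exact: field_gen_base|exact: field_gen_gen].
move=> x /TTg; apply: (subfield_gen_group hTg) => // {}x Gx.
have [i mi] := dsurj Gx.
have repK : rep (rep i) == rep i by apply/eqP/esym/rep_eq; exact: rep_eqv.
exists (exist _ (rep i) repK) => /=; apply: G2Tg.
have -> : x / d (rep i) = (x / d i) * (d i / d (rep i)) by field; rewrite !d0.
by apply: G2M; [exact: muKG2|exact/asboolP/rep_eqv].
Qed.

Let zeta2_exists : exists z : C, (2 * m).-primitive_root z.
Proof. by apply: primitive_root_exists; rewrite muln_gt0. Qed.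

(** Only finiteness matters here; the value of the degree comes later, by comparison with W or T. *)
Let degree_Tg : exists dg, has_degree K Tg dg.
Proof.
have [z zP] := zeta2_exists; have zm : (z ^+ 2) ^+ m = 1.
  by rewrite -exprM (prim_expr_order zP).
pose v (p : I2 * 'I_m) : C := d (val p.1) * z ^+ 2 ^+ p.2.
have zi i : muK (z ^+ 2 ^+ i) by apply: muKX; exact: root_multiples_root.
have Tgv : Tg `<=` spanned K v.
  apply: subfield_gen_group => // [|[i j]|[i j]|x G2x].
  - by apply/muKG2/root_multiples_root; rewrite ?expr1n.
  - by apply: G2M; [exact/asboolP/(valP i)|exact: muKG2].
  - by apply: mulf_neq0; rewrite ?d0 // G0 //; exact: muKG.
  have [i mi] := dsurj G2x.1; have [w [k [wm Kk k0 xi]]] := mi.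
  have G2i : `[< G2 (d i) >].
    apply/asboolP; have -> : d i = x / (x / d i) by field; rewrite d0 G0 //; case: G2x.
    by apply: G2div => //; exact: muKG2.
  have z2P : m.-primitive_root (z ^+ 2).
    by have := exp_prim_root zP 2; rewrite gcdnMr mulKn.
  have [j wj] := prim_rootP z2P wm.
  exists (exist _ i G2i, j); rewrite /v /= invfM mulrA xi wj mulrAC divff ?mul1r //.
  by rewrite G0 //; exact: muKG.
have [dg hdg _] := has_degree_exists hK (subfield_lin_closed hTg KTg) Tgv.
by exists dg.
Qed.

Let degree_W : has_degree K W (#|{: I2}| * 2).
Proof.
have [y [Ry fy Wy]] := sqrt_field_basis.
have -> : (#|{: I2}| * 2)%N = #|{: I2 * bool}| by rewrite card_prod card_bool.
by apply: has_degree_basis fy Wy => j; exact: sqrt_field_sqrt.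
Qed.

Local Notation Tg' := (subfield_gen (Tg `|` [set z | z ^+ (2 * m) = 1])).

Let hTg' : is_subfield Tg'. Proof. exact: subfield_gen_is_subfield. Qed.

Let muTg w : w ^+ m = 1 -> Tg w.
Proof. by move=> wm; apply: (G2Tg (muKG2 (root_multiples_root hK wm))). Qed.

Let WTg' : W `<=` Tg'.
Proof.
apply: subfield_gen_min => // x [/KTg|[Kx x0 [u [z [Gu zm ux]]]]]; first exact: field_gen_base.
have z0 : sqrtC z != 0 by rewrite sqrtC_eq0; exact/G0/muG.
have G2u : G2 u by split=> //; rewrite ux; exists z, (x ^+ 2).
have Tu : Tg' (u / sqrtC z).
  apply: (subfield_div hTg'); first exact: (field_gen_base (G2Tg G2u)).
  by apply: field_gen_gen; exact: sqrt_mu.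
have : x ^+ 2 = (u / sqrtC z) ^+ 2.
  by rewrite expr_div_n sqrtCK ux mulrAC divff ?mul1r // G0 //; exact: muG.
by case/sqrf_eq_sign => -> //; exact: (subfieldN hTg').
Qed.

(** The square of z is in mu_m <= T_g, so a power of z is in T_g or in T_g z according to the parity
    of its exponent. *)
Let Tg'_span z : (2 * m).-primitive_root z -> Tg' `<=` spanned Tg (fun b : bool => if b then z else 1).
Proof.
move=> zP; have z0 : z != 0.
  apply/eqP => z0; have := prim_expr_order zP; rewrite z0 expr0n muln_eq0 /= gtn_eqF //.
  by move/eqP; rewrite eq_sym oner_eq0.
apply: subfield_gen_group => //.
- by rewrite /= expr1n.
- by move=> x y /= xm ym; rewrite exprMn xm ym mulr1.
- by case=> /=; rewrite ?expr1n ?(prim_expr_order zP).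
- by case; rewrite ?oner_neq0.
move=> x /= /(prim_rootP zP) [i ->]; move: (nat_of_ord i) => {x}i; exists (odd i).
have e : z ^+ i = (z ^+ 2) ^+ i./2 * (if odd i then z else 1).
  rewrite -exprM mul2n -{1}(odd_double_half i) addnC exprD; congr (_ * _).
  by case: (odd i); rewrite ?expr1 ?expr0.
rewrite e mulfK; last by case: (odd i); rewrite ?oner_neq0.
by apply: muTg; rewrite [_ ^+ m]exprAC -[z ^+ 2 ^+ m]exprM (prim_expr_order zP) expr1n.
Qed.

Let nTg z : (2 * m).-primitive_root z -> Tg z -> forall w, w ^+ (2 * m) = 1 -> Tg w.
Proof. by move=> zP Tz w /(prim_rootP zP) [i ->]; exact: (subfieldX hTg). Qed.

(** Degree h for T means [T_g : K] = c. Then T_g(mu_2m) has degree at most 2c = [W : K], so it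
    equals its subfield W. *)
Lemma mu_sub_sqrt_field : has_degree K T h -> forall z, z ^+ (2 * m) = 1 -> W z.
Proof.
move=> hT z zm; have [dg hdg] := degree_Tg; have [x xP] := zeta2_exists.
have hT' := has_degree_tower hK hTg (subfield_gen_is_subfield _) KTg TgT hdg degree_over_Tg.
have dgE : dg = #|{: I2}|.
  have := has_degree_uniq hK hT hT'; rewrite {1}card_half_group => /eqP.
  rewrite eqn_pmul2r; first by move/eqP.
  by move: h_gt0; rewrite {1}card_half_group muln_gt0 => /andP[].
have [b [Tb fb sb]] := hdg.
have Tg'K : Tg' `<=` spanned K (fun p : 'I_dg * bool => b p.1 * (if p.2 then x else 1)).
  move=> y /(Tg'_span xP) [c Tc ->]; apply: (spanned_sum hK) => j _.
  have [e Ke ->] := sb _ (Tc j); rewrite mulr_suml; apply: (spanned_sum hK) => i _.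
  by rewrite -mulrA; apply: (spannedZ hK) => //; exact: (mem_spanned hK _ (i, j)).
have hW : is_subfield W := subfield_gen_is_subfield _.
have := has_degree_full hK degree_W WTg' (subfield_lin_closed hW (@field_gen_base _ _ _)) Tg'K.
rewrite card_prod card_ord card_bool dgE leqnn => /(_ isT); apply.
exact: field_gen_gen.
Qed.

(** If mu_2m <= W then T_g(mu_2m) = W has degree 2c, so T_g has degree 2c when it contains mu_2m and
    degree c otherwise; multiply by [T : T_g] = h / c. *)
Lemma degree_of_mu_sub (muW : forall z, z ^+ (2 * m) = 1 -> W z) :
  [/\ has_degree K T h \/ has_degree K T (2 * h) &
      has_degree K T h <-> ~ (forall z, z ^+ (2 * m) = 1 -> Tg z)].
Proof.
have [dg hdg] := degree_Tg; have [x xP] := zeta2_exists.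
have hT := has_degree_tower hK hTg (subfield_gen_is_subfield _) KTg TgT hdg degree_over_Tg.
have hW : is_subfield W := subfield_gen_is_subfield _.
have TgW : Tg `<=` W.
  apply: subfield_gen_min => // y [|/half_group_sqrt [w [k [wm Rk ->]]]]; first exact: field_gen_base.
  by apply: (subfieldM hW); [exact: muW|exact: sqrt_field_sqrt].
have Tg'W : Tg' = W.
  by apply/seteqP; split=> //; apply: subfield_gen_min => // y [/TgW|/muW].
have [muTg2|nmu] := pselect (forall z, z ^+ (2 * m) = 1 -> Tg z).
  have TgE : Tg = W.
    apply/seteqP; split=> //; rewrite -Tg'W; apply: subfield_gen_min => //.
    by move=> y [|/muTg2].
  have h2 : has_degree K T (2 * h).
    have -> : (2 * h = dg * #|{: Q}|)%N => //.
    move: hdg; rewrite TgE => hdg; rewrite (has_degree_uniq hK hdg degree_W).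
    by rewrite {1}card_half_group mulnA [(2 * _)%N]mulnC.
  split; first by right.
  split=> // hh; have := has_degree_uniq hK hh h2; move: h_gt0 => h0.
  by lia.
have nx : ~ Tg x by move=> Tx; apply: nmu; exact: nTg Tx.
have x0 : x != 0 by apply/eqP => x0; apply: nx; rewrite x0; exact: (subfield0 hTg).
have fx : free_over Tg (fun b : bool => if b then x else 1).
  apply: (@kummer_free _ Tg _ _ 2) => //.
  - by move=> z /sqr1; exact: muTg.
  - by case; rewrite ?oner_neq0.
  - case; last by rewrite expr1n; exact: (subfield1 hTg).
    by apply: muTg; rewrite -exprM (prim_expr_order xP).
  - case=> [] [] //; rewrite ?divr1 // div1r.
    by move=> /(subfieldV hTg); rewrite invrK.
have hTgW : has_degree Tg W 2.
  rewrite -card_bool -Tg'W; apply: has_degree_basis fx _; last exact: Tg'_span.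
  case; last exact: (subfield1 hTg').
  by apply: field_gen_gen; exact: prim_expr_order.
have := has_degree_tower hK hTg hW KTg TgW hdg hTgW.
move=> /(has_degree_uniq hK degree_W)/eqP; rewrite eqn_pmul2r // => /eqP dgE.
have hh : has_degree K T h by rewrite card_half_group dgE.
by split; [left|split].
Qed.

(** The converse half of Kummer theory: were y not a K-multiple of a basis element of W, adjoining y
    to the basis would keep it free, against the dimension of W. *)
Lemma square_classes_of_sqrt_field y : W y -> K (y ^+ 2) -> y != 0 -> R (y ^+ 2).
Proof.
move=> Wy Ky y0; have [b [Rb fb Wb]] := sqrt_field_basis.
have b0 j : b j != 0 by rewrite -sqrf_eq0; case: (Rb j).
have [[j Kj]|nK] := pselect (exists j, K (y / b j)).
  rewrite -[y](mulfVK (b0 j)) exprMn; apply: square_classesM => //.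
  by apply: square_classes_sqr => //; rewrite mulf_neq0 ?invr_eq0.
pose b' (o : option (I2 * bool)) := if o is Some j then b j else y.
have fb' : free_over K b'.
  apply: (@kummer_free _ K _ b' 2) => //.
  - move=> z /eqP; rewrite -[1](expr1n _ 2) eqf_sqr => /orP[] /eqP ->; first exact: (subfield1 hK).
    by apply: (subfieldN hK); exact: (subfield1 hK).
  - by case.
  - by case=> [j|] //=; case: (Rb j).
  case=> [j|] [l|] //= Kjl.
  - by congr Some; exact: (free_ratio hK fb Kjl).
  - by case: nK; exists j; rewrite -[_ / _]invrK invf_div; exact: subfieldV.
  - by case: nK; exists l.
exfalso; have := free_le hK fb' (v := b) _.
rewrite card_option ltnn => h'; suff : false by []; apply: h'.
by case=> [j|] /=; [exact: mem_spanned|exact: Wb].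
Qed.

End RadicalGroup.

(** * Imaginary quadratic fields *)

(** The monic equation of a rational number already holds over the rationals, so it can be moved to
    [algC], whose rational algebraic integers are integers. *)
Lemma rational_integral (C : numClosedFieldType) (a : rat) :
  integralOver (intr : int -> C) (ratr a) -> exists n : int, a = n%:~R.
Proof.
move=> [p mon_p /rootP pa].
have pa0 : (map_poly (intr : int -> rat) p).[a] = 0.
  apply: (fmorph_inj (@ratr C)); rewrite rmorph0 -horner_map -map_poly_comp /=.
  by rewrite -{}[RHS]pa; congr (_.[_]); apply: eq_map_poly => n /=; rewrite rmorph_int.
have Aa : (ratr a : algC) \in Aint.
  apply: (@root_monic_Aint (map_poly (intr : int -> algC) p)).
  - apply/rootP; have -> : map_poly (intr : int -> algC) p = map_poly (@ratr algC) (map_poly intr p).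
      by rewrite -map_poly_comp; apply: eq_map_poly => n /=; rewrite rmorph_int.
    by rewrite horner_map /= pa0 rmorph0.
  - exact: monic_map.
  - by apply/polyOverP => i; rewrite coef_map /= intr_int.
have /intrP [n e] : (ratr a : algC) \in Num.int by apply: Cint_rat_Aint => //; exact: Crat_rat.
exists n; apply: (fmorph_inj (@ratr algC)); rewrite -[LHS]/(ratr a) e.
by rewrite -[RHS]/(ratr n%:~R) rmorph_int.
Qed.

(* Embeddings over K act as involutions on a field generated by square roots. *)
Lemma multiquadratic_root (C : numClosedFieldType) (K : set C) (J : finType)
    (y : J -> C) (n e : nat) (z : C) :
  is_subfield K -> (forall j, K (y j ^+ 2)) -> n.-primitive_root z -> spanned K y z ->
  (forall t, (t * t = 1 %[mod n] -> e * t = e %[mod n] \/ e * t + e = 0 %[mod n])%N) ->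
  K (z ^+ e + z ^- e).
Proof.
move=> hK Ky zP zy tP; apply: contrapT => nKz.
pose E := subfield_gen (K `|` [set` codom y]).
have hE : is_subfield E := subfield_gen_is_subfield _.
have KE : K `<=` E by exact: field_gen_base.
have Ey j : E (y j) by apply: field_gen_gen; exact: codom_f.
have Ez : E z by apply: (spanned_sub (subfield_lin_closed hE KE)) zy.
have Eze : E (z ^+ e) by exact: (subfieldX hE).
have zN := prim_expr_order zP.
have z0 : z != 0.
  apply: contra_eq_neq zN => ->; rewrite expr0n gtn_eqF ?(prim_order_gt0 zP) //.
  by rewrite eq_sym oner_neq0.
have [||tau [htau tauK]] := @exists_moving_embedding C K hK (codom y) (z ^+ e + z ^- e) _ _ nKz.
- by move=> _ /codomP [j ->]; exact: (algebraic_on_root hK _ (Ky j)).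
- by exact: (subfieldD hE Eze (subfieldV hE Eze)).
case; have EV : E `<=` [set u | E u /\ E (tau u) /\ tau (tau u) = u].
  apply: subfield_gen_min.
    apply: is_subfieldP => [|u v [Eu [Etu uu]] [Ev [Etv vv]]|u v [Eu [Etu uu]] [Ev [Etv vv]] _].
    - by rewrite /= !(hom1 htau); do !split=> //; exact: (subfield1 hE).
    - split; first exact: (subfieldB hE).
      rewrite (homB htau Eu Ev) (homB htau Etu Etv) uu vv; split=> //.
      exact: (subfieldB hE).
    - split; first exact: (subfield_div hE).
      rewrite (hom_div hE htau Eu Ev) (hom_div hE htau Etu Etv) uu vv; split=> //.
      exact: (subfield_div hE).
  move=> u [Ku|/= /codomP [j ->]].
    by split; [exact: KE|rewrite !tauK //; split=> //; exact: KE].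
  split=> //; have : tau (y j) ^+ 2 = y j ^+ 2 by rewrite -(homX hE htau _ (Ey j)) tauK.
  case/sqrf_eq_sign => tj; rewrite tj; first by rewrite tj.
  by rewrite (homN hE htau (Ey j)) tj opprK; split=> //; exact: (subfieldN hE).
have : tau z ^+ n = 1 by rewrite -(homX hE htau _ Ez) zN (hom1 htau).
move=> /(prim_rootP zP) [t tz].
have tt : (t * t = 1 %[mod n])%N.
  have [_ [_]] := EV _ Ez; rewrite tz (homX hE htau _ Ez) tz -exprM -[in RHS](expr1 z).
  by move/eqP; rewrite (eq_prim_root_expr zP) => /eqP.
(* As e t is e or -e modulo n, [tau] fixes or inverts z^e, and in both cases fixes z^e + z^-e. *)
rewrite (homD hE htau Eze (subfieldV hE Eze)) (homV hE htau Eze) (homX hE htau _ Ez) tz.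
rewrite -exprM mulnC; case: (tP _ tt) => /eqP.
  by rewrite -(eq_prim_root_expr zP) => /eqP ->.
rewrite -(eq_prim_root_expr zP) expr0 exprD => /eqP zz.
have -> : z ^+ (e * t) = (z ^+ e)^-1.
  by apply: (mulIf (expf_neq0 e z0)); rewrite zz mulVf // expf_neq0.
by rewrite invrK addrC.
Qed.

Lemma fundamental_cases (D : nat) : fundamental_discriminant (- D%:Z) ->
  (D %% 4 = 3 /\ squarefree D)%N \/
  exists n, [/\ D = (4 * n)%N, (n %% 4 = 1 \/ n %% 4 = 2)%N & squarefree n].
Proof.
case=> [[D4 _]|[m [Dm m4]]]; first by rewrite abszN absz_nat; left; split=> //; lia.
have {Dm} [n [mn Dn]] : exists n : nat, m = - n%:Z /\ D = (4 * n)%N by exists `|m|%N; lia.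
rewrite mn abszN absz_nat => sq; right; exists n; split=> //.
by case: m4; rewrite mn; lia.
Qed.

(** * Products of ideals *)

Section IdealProducts.
Variable C : fieldType.
Implicit Types a b c : set C.

Lemma mem_ideal_mul a b x y : a x -> b y -> ideal_mul a b (x * y).
Proof. by move=> ax bY; exists 1%N, (fun=> x), (fun=> y); rewrite big_ord1. Qed.

Lemma ideal_mul0 a b : ideal_mul a b 0.
Proof. by exists 0%N, (fun=> 0), (fun=> 0); rewrite big_ord0; split=> // -[]. Qed.

Lemma ideal_mulD a b x y : ideal_mul a b x -> ideal_mul a b y -> ideal_mul a b (x + y).
Proof.
move=> [n [u [v [uv ->]]]] [n' [u' [v' [uv' ->]]]].
pose glue (w : 'I_n -> C) (w' : 'I_n' -> C) (i : 'I_(n + n')) :=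
  match fintype.split i with inl j => w j | inr j => w' j end.
exists (n + n')%N, (glue u u'), (glue v v'); split.
  by move=> i; rewrite /glue; case: fintype.splitP => j _.
rewrite big_split_ord /=; congr (_ + _); apply: eq_bigr => i _; rewrite /glue.
  by case: fintype.splitP => j /= e; [congr (u _ * v _); apply: val_inj|
    have := ltn_ord i; rewrite e ltnNge leq_addr].
case: fintype.splitP => j /= e; first by have := ltn_ord j; rewrite -e ltnNge leq_addr.
by congr (u' _ * v' _); apply: val_inj => /=; apply/eqP; rewrite -(eqn_add2l n) e.
Qed.

Lemma ideal_mul_min a b c : (forall x y, a x -> b y -> c (x * y)) -> c 0 ->
  (forall x y, c x -> c y -> c (x + y)) -> ideal_mul a b `<=` c.
Proof.
move=> abc c0 cD _ [n [u [v [uv ->]]]]; elim/big_ind: _ => // i _.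
by apply: abc; case: (uv i).
Qed.

Lemma ideal_mulC a b : ideal_mul a b = ideal_mul b a.
Proof.
suff H a' b' : ideal_mul a' b' `<=` ideal_mul b' a' by apply/seteqP; split; exact: H.
apply: ideal_mul_min; [|exact: ideal_mul0|exact: ideal_mulD].
by move=> x y ax bY; rewrite mulrC; exact: mem_ideal_mul.
Qed.

Lemma ideal_mulA a b c : ideal_mul a (ideal_mul b c) = ideal_mul (ideal_mul a b) c.
Proof.
suff H a' b' c' : ideal_mul (ideal_mul a' b') c' `<=` ideal_mul a' (ideal_mul b' c').
  apply/seteqP; split; last exact: H.
  rewrite ideal_mulC (ideal_mulC b) (ideal_mulC (ideal_mul a b)) (ideal_mulC a).
  exact: H.
apply: ideal_mul_min; [|exact: ideal_mul0|exact: ideal_mulD].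
move=> x z abx cz; move: x abx; apply: ideal_mul_min.
- by move=> x y ax bY; rewrite -mulrA; apply: mem_ideal_mul => //; exact: mem_ideal_mul.
- by rewrite mul0r; exact: ideal_mul0.
- by move=> x y; rewrite mulrDl; exact: ideal_mulD.
Qed.

Lemma ideal_mulS a b a' b' : a `<=` a' -> b `<=` b' -> ideal_mul a b `<=` ideal_mul a' b'.
Proof.
move=> aa bb; apply: ideal_mul_min; [|exact: ideal_mul0|exact: ideal_mulD].
by move=> x y /aa ax /bb bY; exact: mem_ideal_mul.
Qed.

Definition ideal_exp (K a : set C) (n : nat) : set C := iter n (ideal_mul a) (principal K 1).

End IdealProducts.

(** The choice of r and t leaves one term of the form nonzero modulo each prime p of n: if p does
    not divide A, then p divides t only and A r^2 remains; if p divides A but not E, then p divides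
    r only and E t^2 remains; if p divides both, it divides none of B, r, t and B r t remains. *)
Lemma primitive_form_coprime (A B E u v w : int) (n : nat) : (0 < n)%N ->
  u * A + v * B + w * E = 1 ->
  exists r t : nat, coprime `|A * r%:Z ^+ 2 + B * (r%:Z * t%:Z) + E * t%:Z ^+ 2| n.
Proof.
move=> n0 prim.
pose P1 p := ~~ (p %| `|A|)%N; pose P2 p := (p %| `|A|)%N && ~~ (p %| `|E|)%N.
pose r := (\prod_(p <- primes n | P2 p) p)%N; pose t := (\prod_(p <- primes n | P1 p) p)%N.
have divE (P : pred nat) p : prime p -> (p %| n)%N ->
    (p %| \prod_(q <- primes n | P q) q)%N = P p.
  move=> pp pn; rewrite Euclid_dvd_prod // big_has_cond; apply/hasP/idP => [[q]|Pp].
    rewrite mem_primes => /and3P[pq _ _] /andP[Pq].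
    by rewrite dvdn_prime2 // => /eqP ->.
  by exists p; rewrite ?mem_primes ?pp ?n0 ?pn //=; rewrite Pp dvdnn.
exists r, t; rewrite /coprime; apply: contraT => g1.
set N : int := (_ + _ + _) in g1.
have g0 : (0 < gcdn `|N| n)%N by rewrite gcdn_gt0 n0 orbT.
have pp : prime (pdiv (gcdn `|N| n)) by apply: pdiv_prime; move: g0 g1; lia.
set p := pdiv _ in pp.
have pN : (p %| `|N|)%N by apply: dvdn_trans (pdiv_dvd _) (dvdn_gcdl _ _).
have pn : (p %| n)%N by apply: dvdn_trans (pdiv_dvd _) (dvdn_gcdr _ _).
have pM (x y : int) : (p%:Z %| x * y)%Z = (p%:Z %| x)%Z || (p%:Z %| y)%Z.
  by rewrite !dvdzE abszM Euclid_dvdM.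
have pr : (p%:Z %| r%:Z)%Z = P2 p by rewrite dvdzE divE.
have pt : (p%:Z %| t%:Z)%Z = P1 p by rewrite dvdzE divE.
have {}pN : (p%:Z %| N)%Z by [].
have dA : (p%:Z %| A)%Z = (p %| `|A|)%N by [].
have dE : (p%:Z %| E)%Z = (p %| `|E|)%N by [].
have [pA|pA] := boolP (p %| `|A|)%N; last first.
  have : (p%:Z %| A * r%:Z ^+ 2)%Z.
    have -> : A * r%:Z ^+ 2 = N - (B * r%:Z + E * t%:Z) * t%:Z by rewrite /N; ring.
    by rewrite rpredB // pM pt /P1 pA orbT.
  by rewrite expr2 !pM dA pr /P2 (negPf pA).
have [pE|pE] := boolP (p %| `|E|)%N; last first.
  have : (p%:Z %| E * t%:Z ^+ 2)%Z.
    have -> : E * t%:Z ^+ 2 = N - (A * r%:Z + B * t%:Z) * r%:Z by rewrite /N; ring.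
    by rewrite rpredB // pM pr /P2 pA pE orbT.
  by rewrite expr2 !pM dE pt /P1 pA (negPf pE).
have : (p%:Z %| B * (r%:Z * t%:Z))%Z.
  have -> : B * (r%:Z * t%:Z) = N - A * r%:Z ^+ 2 - E * t%:Z ^+ 2 by rewrite /N; ring.
  by rewrite !rpredB // pM ?dA ?dE ?pA ?pE.
rewrite !pM pr pt /P1 /P2 pA pE /= orbF => pB.
have : (p%:Z %| 1%R)%Z.
  by rewrite -prim !rpredD // pM ?dA ?dE ?pA ?pE ?pB ?orbT.
by rewrite dvdzE absz_nat dvdn1 => /eqP p1; rewrite p1 in pp.
Qed.

Definition value_group (C : fieldType) (K f : set C) (chi : set C -> C) : set C :=
  [set x | exists c a, [/\ K c, c != 0, ideals_prime_to K f a & x = c * chi a]].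

(** The square of the denominator of r is prime to the numerator, so it would divide d. *)
Lemma squarefree_rat_sqr (d : nat) (r : rat) (k : int) :
  squarefree d -> d%:R * r ^+ 2 = k%:~R -> exists n : int, r = n%:~R.
Proof.
move=> sqd; have cop := coprime_num_den r; have den0 := denq_neq0 r.
rewrite -{1}(divq_num_den r) expr_div_n => e.
have {}e : (d * `|numq r| ^ 2 = `|k| * `|denq r| ^ 2)%N.
  have : (d%:Z * numq r ^+ 2)%:~R = (k * denq r ^+ 2)%:~R :> rat.
    by rewrite 2!intrM !rmorphXn /= -e -mulrA mulfVK // expf_neq0 // intr_eq0.
  by move=> /(intr_inj (R := rat))/(congr1 absz); rewrite (abszM d%:Z) (abszM k) !abszX.
have : (`|denq r| ^ 2 %| d)%N.
  have cop2 : coprime (`|denq r| ^ 2) (`|numq r| ^ 2).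
    by apply: coprimeXl; apply: coprimeXr; rewrite coprime_sym.
  by rewrite -(Gauss_dvdl d cop2) e dvdn_mull.
move=> dd; have den1 : denq r = 1.
  apply/eqP; apply: contraT => den1; have dp := denq_gt0 r.
  have d1 : (1 < `|denq r|)%N by lia.
  have := sqd _ (pdiv_prime d1); rewrite (dvdn_trans _ dd) // dvdn_exp2r //.
  exact: pdiv_dvd.
by exists (numq r); rewrite -{1}(divq_num_den r) den1 divr1.
Qed.

Lemma integral_quadratic (C : numClosedFieldType) (b c : int) (w : C) :
  w ^+ 2 = b%:~R * w + c%:~R -> integralOver (intr : int -> C) w.
Proof.
move=> w2; exists ('X^2 - (b *: 'X + c%:P)).
  rewrite monicE lead_coefDl ?lead_coefXn // size_polyXn size_polyN.
  rewrite (leq_ltn_trans (size_polyD _ _)) // gtn_max.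
  rewrite (leq_ltn_trans (size_scale_leq _ _)) ?size_polyX //.
  by rewrite (leq_ltn_trans (size_polyC_leq1 _)).
rewrite /root rmorphB rmorphD /= map_polyXn map_polyZ map_polyX map_polyC /= !hornerE.
by rewrite w2 subrr.
Qed.

(** * Integers, roots of unity and ramification in K *)

Section ImaginaryQuadratic.
Variables (C : numClosedFieldType) (D : nat).
Hypotheses (fD : fundamental_discriminant (- D%:Z)) (D4 : (4 < D)%N).
Local Notation K := (@imag_quadratic C D).
Local Notation O := (ring_of_integers K).
Let s : C := sqrtC (- D%:R).
(** This generator of O over Z serves both types of discriminant: its trace is D and its norm is q,
    where D^2 + D is divisible by 4 in both cases. *)
Let om : C := (D%:R + s) / 2.
Let q : nat := ((D ^ 2 + D) %/ 4)%N.

Let hK : is_subfield K. Proof. exact: subfield_gen_is_subfield. Qed.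

Let s2 : s ^+ 2 = - D%:R. Proof. exact: sqrtCK. Qed.

Let conj_s : s^* = - s.
Proof.
have : s^* ^+ 2 = s ^+ 2 by rewrite -rmorphXn /= s2 rmorphN /= rmorph_nat.
case/sqrf_eq_sign => // rs; have : 0 <= s ^+ 2 by rewrite -realEsqr CrealE rs.
by rewrite s2 oppr_ge0 lern0 gtn_eqF // (ltn_trans _ D4).
Qed.

Let s0 : s != 0.
Proof. by rewrite sqrtC_eq0 oppr_eq0 pnatr_eq0 gtn_eqF // (ltn_trans _ D4). Qed.

Lemma imag_quadraticP x : K x <-> exists a b : rat, x = ratr a + ratr b * s.
Proof.
split.
  apply: (@subfield_gen_min _ _ [set x | exists a b : rat, x = ratr a + ratr b * s])
    => [|_ ->]; last by exists 0, 1; rewrite rmorph0 rmorph1 add0r mul1r.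
  apply: is_subfieldP => [|_ _ [a [b ->]] [c [d ->]]|_ _ [a [b ->]] [c [d ->]] n0].
  - by exists 1, 0; rewrite rmorph0 rmorph1 mul0r addr0.
  - by exists (a - c), (b - d); rewrite !rmorphB /=; ring.
  pose N : rat := c ^+ 2 + D%:R * d ^+ 2.
  have NE : ratr N = (ratr c + ratr d * s) * (ratr c - ratr d * s) :> C.
    rewrite rmorphD rmorphM !rmorphXn rmorph_nat /=.
    have -> : D%:R = - s ^+ 2 by rewrite s2 opprK.
    by ring.
  have N0 : N != 0.
    apply: contraNneq n0 => N0; have : c ^+ 2 = 0 /\ D%:R * d ^+ 2 = 0.
      have c2 := sqr_ge0 c; have d2 : 0 <= D%:R * d ^+ 2 by rewrite mulr_ge0 ?sqr_ge0 ?ler0n.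
      by move: N0; rewrite /N; split; lra.
    move=> [/eqP + /eqP]; rewrite sqrf_eq0 mulf_eq0 sqrf_eq0 => /eqP -> /orP[|/eqP ->].
      by rewrite pnatr_eq0 gtn_eqF // (ltn_trans _ D4).
    by rewrite rmorph0 mul0r addr0.
  exists ((a * c + D%:R * b * d) / N), ((b * c - a * d) / N).
  apply: (mulIf n0); rewrite mulfVK //.
  rewrite !fmorph_div /= NE !rmorphD !rmorphN !rmorphM rmorph_nat /=.
  have m0 : ratr c - ratr d * s != 0.
    by apply: contraNneq N0 => m0; move/eqP: NE; rewrite m0 mulr0 fmorph_eq0.
  have -> : D%:R = - s ^+ 2 by rewrite s2 opprK.
  by field; rewrite n0 m0.
move=> [a [b ->]].
have Kr c : K (ratr c) by rewrite /ratr; apply: (subfield_div hK); exact: subfield_int.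
by apply: (subfieldD hK) => //; apply: (subfieldM hK) => //; exact: sub_subfield_gen.
Qed.

Let q4 : (4 * q = D ^ 2 + D)%N.
Proof.
rewrite mulnC /q divnK //; case: (fundamental_cases fD) => [[D3 _]|[n [-> _ _]]]; last by rewrite /dvdn; lia.
have {D3} [k ->] : exists k, D = (4 * k + 3)%N by exists (D %/ 4)%N; lia.
by apply/dvdnP; exists (4 * k ^ 2 + 7 * k + 3)%N; ring.
Qed.

Let q4C : 4 * q%:R = D%:R ^+ 2 + D%:R :> C.
Proof. by rewrite -natrX -natrD -q4 natrM. Qed.

Let om2 : om ^+ 2 = D%:R * om - q%:R.
Proof.
have e4 : (4 : C) != 0 by rewrite pnatr_eq0.
apply: (mulfI e4); rewrite mulrBr q4C /om.
have -> : D%:R = - s ^+ 2 by rewrite s2 opprK.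
by field.
Qed.

Let conj_om : om^* = D%:R - om.
Proof. by rewrite /om rmorphM rmorphD /= conj_s rmorph_nat fmorphV /= rmorph_nat; field. Qed.

Let conj_int (n : int) : (n%:~R : C)^* = n%:~R. Proof. exact: rmorph_int. Qed.

Let conj_integral (x : C) : integralOver (intr : int -> C) x -> integralOver (intr : int -> C) x^*.
Proof.
move=> [p mp /rootP px]; exists p => //; apply/rootP.
have := congr1 (fun u : C => u^*) px; rewrite rmorph0 => <-.
rewrite -[RHS](horner_map (Num.conj : {rmorphism C -> C})) -map_poly_comp /=.
by congr (_.[_]); apply: eq_map_poly => n /=; rewrite rmorph_int.
Qed.

Let integral_int (n : int) : integralOver (intr : int -> C) n%:~R.
Proof. exact: (integral_id (intr : {rmorphism int -> C})). Qed.

Let K_s : K s. Proof. exact: sub_subfield_gen. Qed.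

Let K_om : K om.
Proof.
apply: (subfield_div hK); last exact: (subfield_nat hK).
by apply: (subfieldD hK) => //; exact: (subfield_nat hK).
Qed.

Let integral_om : integralOver (intr : int -> C) om.
Proof.
apply: (@integral_quadratic _ D%:Z (- q%:Z)); rewrite om2 rmorphN /= -!pmulrn.
by [].
Qed.

(** For x = a + b s, the trace u = 2a and the norm n are integers, and D (2b)^2 = 4n - u^2.
    Squarefreeness bounds the denominator of b, and reduction of this equation modulo 4 gives the
    parities needed to rewrite x in terms of [om]. *)
Lemma ring_of_integersP x : O x <-> exists a b : int, x = a%:~R + b%:~R * om.
Proof.
split; last first.
  move=> [a [b ->]]; split.
    apply: (subfieldD hK); first exact: (subfield_int hK).
    by apply: (subfieldM hK) => //; exact: (subfield_int hK).
  apply: (integral_add (RtoK := intr : {rmorphism int -> C})); first exact: integral_int.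
  by apply: (integral_mul (RtoK := intr : {rmorphism int -> C})).
move=> [/imag_quadraticP [a [b xE]] ix]; have ix' := conj_integral ix.
have conj_rat (r : rat) : (ratr r : C)^* = ratr r by rewrite fmorph_rat.
have xE' : x^* = ratr a - ratr b * s.
  by rewrite xE rmorphD /= conj_rat [(ratr b * s)^*]rmorphM /= conj_rat conj_s mulrN.
have [u ua] : exists u : int, 2 * a = u%:~R.
  apply: (@rational_integral C); have -> : ratr (2 * a) = x + x^* :> C.
    by rewrite xE' xE rmorphM rmorph_nat /=; ring.
  exact: (integral_add (RtoK := intr : {rmorphism int -> C})).
have [n nb] : exists n : int, a ^+ 2 + D%:R * b ^+ 2 = n%:~R.
  apply: (@rational_integral C); have -> : ratr (a ^+ 2 + D%:R * b ^+ 2) = x * x^* :> C.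
    rewrite xE' xE rmorphD rmorphM !rmorphXn rmorph_nat /=.
    have -> : D%:R = - s ^+ 2 by rewrite s2 opprK.
    by ring.
  exact: (integral_mul (RtoK := intr : {rmorphism int -> C})).
have e : D%:R * (2 * b) ^+ 2 = (4 * n - u ^+ 2)%:~R.
  by rewrite rmorphB rmorphM rmorphXn /= -ua -nb; ring.
suff [v [vb [w uv]]] : exists v : int, 2 * b = v%:~R /\ exists w : int, u - v * D%:Z = 2 * w.
  exists w, v; have bE : b = v%:~R / 2 by rewrite -vb mulrC mulKf.
  have aE : a = (2 * w + v * D%:Z)%:~R / 2 by rewrite -uv subrK -ua mulrC mulKf.
  rewrite xE aE bE !fmorph_div /= !rmorph_int rmorph_nat /om rmorphD !rmorphM /=.
  by rewrite rmorph_nat; field.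
case: (fundamental_cases fD) => [[D3 sq]|[d [Dd d4 sq]]].
  have [v vb] := squarefree_rat_sqr sq e; exists v; split=> //.
  have {}e : D%:Z * v ^+ 2 = 4 * n - u ^+ 2.
    by apply: (intr_inj (R := rat)); rewrite -e vb rmorphM rmorphXn /= -pmulrn.
  have [k Dk] : exists k : int, D%:Z = 4 * k + 3 by exists (D %/ 4)%N%:Z; lia.
  have [u' [r [r01 ur]]] : exists u' r : int, (r = 0 \/ r = 1) /\ u = 2 * u' + r.
    by exists (u %/ 2)%Z, (u %% 2)%Z; lia.
  have [v' [t [t01 vt]]] : exists v' t : int, (t = 0 \/ t = 1) /\ v = 2 * v' + t.
    by exists (v %/ 2)%Z, (v %% 2)%Z; lia.
  move: e; rewrite Dk ur vt => e.
  have rt : r = t.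
    by move: e; rewrite !expr2; case: r01 t01 => -> [] -> // e; exfalso; lia.
  exists (u' - (2 * v' + t) * 2 * k - 3 * v' - t); rewrite rt; ring.
have [w wb] : exists w : int, 4 * b = w%:~R.
  apply: (@squarefree_rat_sqr d _ (4 * n - u ^+ 2)) => //; rewrite -e Dd natrM; ring.
have {}e : d%:Z * w ^+ 2 = 4 * n - u ^+ 2.
  apply: (intr_inj (R := rat)); rewrite -e rmorphM rmorphXn /= -wb Dd natrM -pmulrn; ring.
have [k [t [t12 dk]]] : exists k t : int, (t = 1 \/ t = 2) /\ d%:Z = 4 * k + t.
  by exists (d %/ 4)%N%:Z, (d %% 4)%N%:Z; lia.
have [u' [r [r01 ur]]] : exists u' r : int, (r = 0 \/ r = 1) /\ u = 2 * u' + r.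
  by exists (u %/ 2)%Z, (u %% 2)%Z; lia.
have [w' [p [p01 wp]]] : exists w' p : int, (p = 0 \/ p = 1) /\ w = 2 * w' + p.
  by exists (w %/ 2)%Z, (w %% 2)%Z; lia.
move: e; rewrite dk ur wp => e.
have [r0 p0] : r = 0 /\ p = 0.
  move: e; rewrite !expr2; case: r01 p01 t12 => -> [] -> [] -> // e; exfalso; lia.
exists w'; split; last by exists (u' - w' * (2 * d%:Z)); rewrite r0 Dd PoszM; ring.
have -> : 2 * b = (4 * b) / 2 by field.
by rewrite wb wp p0 addr0 intrM mulrC mulKf.
Qed.

Lemma ring_of_integers_int (n : int) : O n%:~R.
Proof. by split; [exact: (subfield_int hK)|exact: integral_int]. Qed.

Lemma ring_of_integers_nat (n : nat) : O n%:R.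
Proof. exact: (ring_of_integers_int n). Qed.

Lemma ring_of_integersD x y : O x -> O y -> O (x + y).
Proof.
move=> [Kx ix] [Ky iy]; split; first exact: (subfieldD hK).
exact: (integral_add (RtoK := intr : {rmorphism int -> C})).
Qed.

Lemma ring_of_integersM x y : O x -> O y -> O (x * y).
Proof.
move=> [Kx ix] [Ky iy]; split; first exact: (subfieldM hK).
exact: (integral_mul (RtoK := intr : {rmorphism int -> C})).
Qed.

Lemma ring_of_integersN x : O x -> O (- x).
Proof. by move=> Ox; rewrite -mulN1r; apply: ring_of_integersM => //; exact: (ring_of_integers_int (-1)). Qed.

Lemma ring_of_integersB x y : O x -> O y -> O (x - y).
Proof. by move=> Ox /ring_of_integersN; exact: ring_of_integersD. Qed.

Let O1 : O 1. Proof. exact: (ring_of_integers_int 1). Qed.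
Let O0 : O 0. Proof. exact: (ring_of_integers_int 0). Qed.
Let O_om : O om. Proof. by split. Qed.

Lemma imag_quadratic_conj x : K x -> K x^*.
Proof.
move=> /imag_quadraticP [a [b ->]]; apply/imag_quadraticP; exists a, (- b).
by rewrite rmorphD /= [(ratr b * s)^*]rmorphM /= !fmorph_rat conj_s rmorphN /= mulrN mulNr.
Qed.

Lemma ring_of_integers_conj x : O x -> O x^*.
Proof. by move=> [Kx ix]; split; [exact: imag_quadratic_conj|exact: conj_integral]. Qed.

Let conj_elt (a b : int) : (a%:~R + b%:~R * om)^* = a%:~R + b%:~R * (D%:R - om).
Proof. by rewrite rmorphD /= [(b%:~R * om)^*]rmorphM /= !conj_int conj_om. Qed.

Let real_elt (a b : int) : (a%:~R + b%:~R * om)^* = a%:~R + b%:~R * om -> b = 0.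
Proof.
rewrite conj_elt => /addrI e; apply: contrapT => /eqP b0.
have b0' : b%:~R != 0 :> C by rewrite intr_eq0.
have : om = D%:R - om by apply: (mulfI b0'); rewrite e.
rewrite /om => /eqP; rewrite -subr_eq0 => /eqP e'.
by case/eqP: s0; rewrite -[RHS]e'; field.
Qed.

Lemma ring_of_integers_real x : O x -> x^* = x -> exists a : int, x = a%:~R.
Proof.
by move=> /ring_of_integersP [a [b ->]] /real_elt ->; exists a; rewrite mul0r addr0.
Qed.

Let elt_inj (a b c d : int) :
  a%:~R + b%:~R * om = c%:~R + d%:~R * om -> a = c /\ b = d.
Proof.
move=> e; have bd : b - d = 0.
  apply: (@real_elt (a - c)); rewrite conj_elt.
  have : (a - c)%:~R + (b - d)%:~R * om = 0.
    by rewrite !intrB mulrBl addrACA -opprD e subrr.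
  move=> e0; rewrite e0; have := congr1 (fun u : C => u^*) e0.
  by rewrite conj_elt rmorph0.
split; last lia.
by move: e; rewrite (_ : b = d) => [/addIr/(intr_inj (R := C))//|]; lia.
Qed.

Let four_q : 4 * q%:Z = D%:Z ^+ 2 + D%:Z.
Proof. by rewrite -PoszM q4 PoszD -!mulnn PoszM. Qed.

Let four_norm (a b : int) : 4 * (a * a + a * b * D%:Z + b * b * q%:Z) =
  (2 * a + b * D%:Z) ^+ 2 + b * b * D%:Z.
Proof. by rewrite !mulrDr [4 * (_ * q%:Z)]mulrCA four_q; ring. Qed.

Let norm_elt (a b : int) : (a%:~R + b%:~R * om) * (a%:~R + b%:~R * om)^* =
  (a * a + a * b * D%:Z + b * b * q%:Z)%:~R.
Proof.
rewrite conj_elt !intrD !intrM -!pmulrn.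
have -> : q%:R = D%:R * om - om ^+ 2 by rewrite om2 opprB addrC subrK.
by ring.
Qed.

Lemma ring_of_integers_norm x : O x -> exists n : nat, x * x^* = n%:R.
Proof.
move=> /ring_of_integersP [a [b ->]]; rewrite norm_elt.
set n := (_ + _); have n0 : 0 <= n.
  have : 0 <= (4 * n).
    by rewrite four_norm addr_ge0 ?sqr_ge0 // mulr_ge0 // -expr2 sqr_ge0.
  by rewrite pmulr_rge0.
by exists `|n|%N; rewrite natr_absz ger0_norm.
Qed.

(** A root of unity has norm 1, so that 4 = (2a + bD)^2 + b^2 D; as D > 4, this leaves b = 0. *)
Lemma imag_quadratic_root_of_unity w i :
  (0 < i)%N -> K w -> w ^+ i = 1 -> w = 1 \/ w = -1.
Proof.
move=> i0 Kw wi; have : O w.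
  split=> //; exists ('X^i - 1); first exact: monicXnsubC.
  by rewrite /root rmorphB rmorph1 /= map_polyXn !hornerE wi subrr.
move=> /ring_of_integersP [a [b e]].
have nw : `|w| = 1.
  by apply/eqP; rewrite -(@pexpr_eq1 _ _ i) // -normrX wi normr1.
have : w * w^* = 1 by rewrite -normCK nw expr1n.
rewrite e norm_elt => /(intr_inj (R := C) (x2 := 1)) n1.
have e4 : (2 * a + b * D%:Z) ^+ 2 + b * b * D%:Z = 4.
  by rewrite -four_norm n1.
have b0 : b = 0.
  apply: contrapT => /eqP b0; have b1 : 1 <= b * b by rewrite -gtz0_ge1 -expr2 exprn_even_gt0.
  have : 5 <= b * b * D%:Z by apply: (le_trans (y := D%:Z)); rewrite ?ler_peMl.
  have := sqr_ge0 (2 * a + b * D%:Z); lia.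
rewrite b0 mul0r addr0 {e}; move: n1; rewrite b0 mulr0 !mul0r !addr0 => n1.
have /eqP : a ^+ 2 = 1 ^+ 2 by rewrite expr1n expr2.
by rewrite eqf_sqr => /orP[] /eqP ->; [left|right]; rewrite ?rmorphN.
Qed.

Lemma imag_quadratic_integral_multiple x : K x -> exists2 n : nat, (0 < n)%N & O (n%:R * x).
Proof.
move=> /imag_quadraticP [a [b xE]].
pose n : int := denq a * denq b; have n0 : 0 < n by rewrite mulr_gt0 ?denq_gt0.
have nE : n%:~R = (denq a)%:~R * (denq b)%:~R :> C by rewrite intrM.
have Os : O s.
  have -> : s = 2%:R * om - D%:R by rewrite /om mulrC mulfVK ?pnatr_eq0 // addrC addKr.
  by apply: ring_of_integersB; [apply: ring_of_integersM|]; rewrite //; exact: ring_of_integers_nat.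
exists `|n|%N; first by rewrite absz_gt0 gt_eqF.
rewrite natr_absz gtr0_norm // xE /ratr nE.
have da : (denq a)%:~R != 0 :> C by rewrite intr_eq0 denq_neq0.
have db : (denq b)%:~R != 0 :> C by rewrite intr_eq0 denq_neq0.
have -> : (denq a)%:~R * (denq b)%:~R * ((numq a)%:~R / (denq a)%:~R + (numq b)%:~R / (denq b)%:~R * s)
   = (denq b * numq a)%:~R + (denq a * numq b)%:~R * s :> C.
  by rewrite !intrM; field; rewrite da db.
apply: ring_of_integersD; first exact: ring_of_integers_int.
by apply: ring_of_integersM => //; exact: ring_of_integers_int.
Qed.

(** Finiteness of O / nO, which makes the image of a character finite. *)
Lemma ring_of_integers_residues (n : nat) x : (0 < n)%N -> O x ->
  exists a b : 'I_n, O ((x - (a%:R + b%:R * om)) / n%:R).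
Proof.
move=> n0 /ring_of_integersP [a [b ->]].
have nz : n%:Z != 0 by rewrite eqz_nat gtn_eqF.
have n0C : n%:R != 0 :> C by rewrite pnatr_eq0 gtn_eqF.
have rep (c : int) : exists2 r : 'I_n, True & c%:~R = (c %/ n)%Z%:~R * n%:R + r%:R :> C.
  have r0 := modz_ge0 c nz; have rn : (`|(c %% n)%Z| < n)%N.
    by have := ltz_pmod c (d := n) n0; lia.
  exists (Ordinal rn) => //=; rewrite natr_absz ger0_norm // {1}(divz_eq c n) intrD intrM.
  by rewrite -pmulrn.
have [r _ ra] := rep a; have [t _ tb] := rep b; exists r, t.
have -> : (a%:~R + b%:~R * om - (r%:R + t%:R * om)) / n%:R =
    (a %/ n)%Z%:~R + (b %/ n)%Z%:~R * om.
  by rewrite ra tb; field.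
by apply/ring_of_integersP; exists (a %/ n)%Z, (b %/ n)%Z.
Qed.

(** O / pO has no nilpotent elements when p does not divide the discriminant. For x = a + b om, p
    divides b (2a + bD), and (2a + bD)(2a - bD) is b^2 D modulo p; hence p divides b, and then a. *)
Lemma unramified_prime (p : nat) x : prime p -> ~~ (p %| D)%N -> O x ->
  O (x ^+ 2 / p%:R) -> O (x / p%:R).
Proof.
move=> pp pD /ring_of_integersP [a [b xE]] /ring_of_integersP [c [d e]].
have p0 : p%:R != 0 :> C by rewrite pnatr_eq0 gtn_eqF // prime_gt0.
have [e1 e2] : a * a - b * b * q%:Z = p%:Z * c /\ 2 * a * b + b * b * D%:Z = p%:Z * d.
  have e' : (p%:Z * c)%:~R + (p%:Z * d)%:~R * om = x ^+ 2.
    by rewrite !intrM -mulrA -mulrDr -e -pmulrn mulrC mulfVK.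
  apply: elt_inj; rewrite e' xE !(intrB, intrD, intrM) -!pmulrn.
  have -> : q%:R = D%:R * om - om ^+ 2 by rewrite om2 opprB addrC subrK.
  by ring.
have pM (u v : int) : (p%:Z %| u * v)%Z -> (p%:Z %| u)%Z || (p%:Z %| v)%Z.
  by rewrite !dvdzE abszM absz_nat Euclid_dvdM.
have pb : (p%:Z %| b)%Z.
  apply: contraT => pb.
  have pt : (p%:Z %| 2 * a + b * D%:Z)%Z.
    have : (p%:Z %| b * (2 * a + b * D%:Z))%Z.
      by apply/dvdzP; exists d; rewrite mulrC [d * _]mulrC -e2; ring.
    by move/pM; rewrite (negPf pb).
  have : (p%:Z %| b * (b * D%:Z))%Z.
    have -> : b * (b * D%:Z) = (2 * a + b * D%:Z) * (2 * a - b * D%:Z) - p%:Z * (4 * c).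
      have -> : p%:Z * (4 * c) = 4 * (a * a) - b * b * (4 * q%:Z).
        by rewrite mulrCA -e1; ring.
      by rewrite four_q; ring.
    by rewrite rpredB ?dvdz_mulr.
  by move=> /pM; rewrite (negPf pb) => /pM; rewrite (negPf pb) !dvdzE !absz_nat (negPf pD).
have pa : (p%:Z %| a)%Z.
  have : (p%:Z %| a * a)%Z.
    have -> : a * a = p%:Z * c + b * (b * q%:Z) by rewrite -e1; ring.
    by rewrite rpredD ?dvdz_mulr.
  by move=> /pM; rewrite orbb.
case/dvdzP: pa => a' ea; case/dvdzP: pb => b' eb.
apply/ring_of_integersP; exists a', b'; rewrite xE ea eb !intrM -!pmulrn.
by field.
Qed.

(** This says that the ideal (p, th) has square pO: [u], [v], [w] certify that p lies in the square.
    For p = 2 and D = 4n, th is 1 + sqrt(-n) if n is odd and sqrt(-n) if n is even; for p = 3, th is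
    sqrt(-D), and the coefficients depend on D / 3 modulo 3. *)
Lemma ramified_prime (p : nat) : (p == 2%N) || (p == 3%N) -> (p %| D)%N ->
  exists th u v w : C, [/\ O th, O u, O v, O w & O (th ^+ 2 / p%:R) /\
    p%:R = u * p%:R ^+ 2 + v * (p%:R * th) + w * th ^+ 2].
Proof.
case/orP => /eqP -> pD.
  have [[D3 _]|[n [Dn n4 _]]] := fundamental_cases fD; first by lia.
  have rE : s / 2 = om - 2 * n%:R by rewrite /om Dn natrM; field.
  have Or : O (s / 2).
    rewrite rE; apply: ring_of_integersB => //; apply: ring_of_integersM.
      exact: (ring_of_integers_nat 2).
    exact: ring_of_integers_nat.
  have r2 : (s / 2) ^+ 2 = - n%:R by rewrite expr_div_n s2 Dn natrM; field.
  case: n4 => n4.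
    have [k nk] : exists k, n = (4 * k + 1)%N by exists (n %/ 4)%N; lia.
    have nE : n%:R = 4 * k%:R + 1 :> C by rewrite nk natrD natrM.
    have t2 : (1 + s / 2) ^+ 2 = 2 * (s / 2 - 2 * k%:R).
      transitivity (1 + 2 * (s / 2) + (s / 2) ^+ 2); first by ring.
      by rewrite r2 nE; ring.
    exists (1 + s / 2), (- k%:R), 1, (-1).
    split; [exact: ring_of_integersD|exact/ring_of_integersN/ring_of_integers_nat|by []|
      exact: ring_of_integersN|].
    split; last by rewrite t2; ring.
    rewrite t2 mulrAC divff ?mul1r ?pnatr_eq0 //; apply: ring_of_integersB => //.
    by apply: ring_of_integersM; [exact: (ring_of_integers_nat 2)|exact: ring_of_integers_nat].
  have [k nk] : exists k, n = (4 * k + 2)%N by exists (n %/ 4)%N; lia.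
  have nE : n%:R = 4 * k%:R + 2 :> C by rewrite nk natrD natrM.
  exists (s / 2), (- k%:R), 0, (-1).
  split; [by []|exact/ring_of_integersN/ring_of_integers_nat|by []|
    exact: ring_of_integersN|].
  split; last by rewrite r2 nE; ring.
  have -> : (s / 2) ^+ 2 / 2 = - (2 * k + 1)%:R.
    by rewrite r2 nE natrD natrM; field.
  exact/ring_of_integersN/ring_of_integers_nat.
have nd9 : ~~ (9 %| D)%N.
  have [[_ sq]|[n [-> _ sq]]] := fundamental_cases fD; first exact: (sq 3%N).
  by rewrite (@Gauss_dvdr 9 4 n) //; exact: (sq 3%N).
have Os : O s.
  have -> : s = 2%:R * om - D%:R by rewrite /om mulrC mulfVK ?pnatr_eq0 // addrC addKr.
  by apply: ring_of_integersB; [apply: ring_of_integersM|]; rewrite //; exact: ring_of_integers_nat.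
have [k [r [r12 DE]]] : exists k r : nat, (r = 1 \/ r = 2)%N /\ D = (3 * (3 * k + r))%N.
  by exists (D %/ 9)%N, (D %/ 3 %% 3)%N; move: pD nd9; rewrite /dvdn; lia.
have DC : D%:R = 3 * (3 * k%:R + r%:R) :> C by rewrite {1}DE natrM natrD natrM.
have O3 : O (s ^+ 2 / 3).
  have -> : s ^+ 2 / 3 = - (3 * k + r)%:R.
    by rewrite s2 DC natrD natrM; field.
  exact/ring_of_integersN/ring_of_integers_nat.
case: r12 => r12.
  exists s, (- k%:R), 0, (-1).
  split; [by []|exact/ring_of_integersN/ring_of_integers_nat|by []|
    exact: ring_of_integersN|split=> //].
  by rewrite s2 DC r12; ring.
exists s, (k + 1)%:R, 0, 1.
split; [by []|exact: ring_of_integers_nat|by []|by []|split=> //].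
by rewrite s2 DC r12 natrD; ring.
Qed.

Lemma ring_of_integers_root x n : (0 < n)%N -> K x -> O (x ^+ n) -> O x.
Proof.
move=> n0 Kx [_ ixn]; split=> //.
have [p mp px] := ixn; exists (p \Po 'X^n).
  by rewrite monicE lead_coef_comp ?size_polyXn // (monicP mp) lead_coefXn expr1n mul1r.
by rewrite map_comp_poly map_polyXn /root horner_comp !hornerE.
Qed.

(* u + 1/u is real and integral over Z, hence an integer of absolute value <= 2. *)
Let sum_inverse_order (u : C) (n : nat) : (0 < n)%N -> u ^+ n = 1 -> K (u + u^-1) ->
  u ^+ 12 = 1.
Proof.
move=> n0 un Kc; have nu : `|u| = 1.
  by apply/eqP; rewrite -(@pexpr_eq1 _ _ n) // -normrX un normr1.
have u0 : u != 0 by rewrite -normr_eq0 nu oner_neq0.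
have cu : u^* = u^-1 by rewrite -[RHS]mul1r -(expr1n _ 2) -nu normCK mulrAC divff ?mul1r.
have iu (w : C) : w ^+ n = 1 -> integralOver (intr : int -> C) w.
  move=> wn; exists ('X^n - 1); first exact: monicXnsubC.
  by rewrite /root rmorphB rmorph1 /= map_polyXn !hornerE wn subrr.
have [||a aE] := @ring_of_integers_real (u + u^-1).
- split=> //; apply: (integral_add (RtoK := intr : {rmorphism int -> C})); first exact: iu.
  by apply: iu; rewrite exprVn un invr1.
- by rewrite rmorphD /= fmorphV /= cu invrK addrC.
have : `|a%:~R| <= 2 :> C.
  by rewrite -aE (le_trans (ler_normD _ _)) // normfV nu invr1.
rewrite -intr_norm -[2]/(2%:~R) ler_int => a2.
have u2 : u ^+ 2 = a%:~R * u - 1 by rewrite -aE; field.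
(* These traces belong to u of order 1, 6, 4, 3 and 2, all divisors of 12. *)
have : a = 2 \/ a = 1 \/ a = 0 \/ a = -1 \/ a = -2 by lia.
have ex k (w : C) : (u ^+ k = w) -> w ^+ (12 %/ k) = 1 -> (k * (12 %/ k) = 12)%N -> u ^+ 12 = 1.
  by move=> uk wk <-; rewrite exprM uk.
case=> [|[|[|[|]]]] ae; rewrite ae in u2.
- have /eqP : (u - 1) ^+ 2 = 0 by rewrite sqrrB1 u2; ring.
  by rewrite sqrf_eq0 subr_eq0 => /eqP ->; rewrite expr1n.
- apply: (ex 3%N (-1)) => //; last by rewrite -signr_odd.
  by rewrite exprS u2 mulrBr mulrCA -expr2 u2; ring.
- apply: (ex 2%N (-1)) => //; last by rewrite -signr_odd.
  by rewrite u2 mul0r sub0r.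
- apply: (ex 3%N 1) => //; last by rewrite expr1n.
  by rewrite exprS u2 mulrBr mulrCA -expr2 u2; ring.
- have /eqP : (u + 1) ^+ 2 = 0 by rewrite sqrrD1 u2; ring.
  by rewrite sqrf_eq0 addr_eq0 => /eqP ->; rewrite -signr_odd.
Qed.

(** If l divides n and every t with t^2 = 1 modulo l satisfies e t = e or e t = -e, then z' of order
    l has z'^(12 e) = 1, so l divides 12 e. This excludes l = 9 and primes l >= 5 with e = 1. For l
    = 16 the square roots of 1 are 1, 7, 9, 15, and e = 2 is needed. *)
Lemma multiquadratic_order (W : set C) (J : finType) (y : J -> C) (n : nat) (z : C) :
  is_subfield W -> (forall j, K (y j ^+ 2)) -> W `<=` spanned K y ->
  n.-primitive_root z -> W z -> (n %| 24)%N.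
Proof.
move=> hW Ky Wy zP Wz; have n0 := prim_order_gt0 zP.
have key l e : (l %| n)%N ->
    (forall t, (t * t = 1 %[mod l] -> e * t = e %[mod l] \/ e * t + e = 0 %[mod l])%N) ->
    (l %| 12 * e)%N.
  move=> ln tP; have := dvdn_prim_root zP ln; set z' := z ^+ _ => z'P.
  have l0 := prim_order_gt0 z'P.
  have Kc := multiquadratic_root hK Ky z'P (Wy _ (subfieldX hW _ Wz)) tP.
  rewrite (prim_order_dvd z'P) mulnC exprM; apply/eqP.
  apply: (@sum_inverse_order _ l l0 _ Kc).
  by rewrite exprAC (prim_expr_order z'P) expr1n.
have no9 : ~~ (9 %| n)%N.
  apply/negP => /(key _ 1%N) h; suff : (9 %| 12 * 1)%N by [].
  apply: h => t; rewrite !mul1n -modnMm => tt.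
  have : (t %% 9 = 1 \/ t %% 9 = 8)%N.
    move: (t %% 9)%N (ltn_pmod t (isT : 0 < 9)%N) tt => r.
    by do 9?[case: r => [|r] //]; [left|right].
  by lia.
have no16 : ~~ (16 %| n)%N.
  apply/negP => /(key _ 2%N) h; suff : (16 %| 12 * 2)%N by [].
  apply: h => t; rewrite -modnMm => tt.
  have : (t %% 16 = 1 \/ t %% 16 = 7 \/ t %% 16 = 9 \/ t %% 16 = 15)%N.
    move: (t %% 16)%N (ltn_pmod t (isT : 0 < 16)%N) tt => r.
    by do 16?[case: r => [|r] //]; tauto.
  by lia.
apply/dvdn_partP => // p; rewrite mem_primes => /and3P [pp _ pn].
rewrite p_part.
have [p5|] := leqP 5 p.
  exfalso; have : (p %| 12 * 1)%N.
    apply: key => // t; rewrite !mul1n => /eqP; case: t => [|t].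
      by rewrite mul0n eq_sym mod0n modn_small // prime_gt1.
    rewrite eqn_mod_dvd ?muln_gt0 // (_ : t.+1 * t.+1 - 1 = t * (t + 2))%N; last by lia.
    rewrite Euclid_dvdM // => /orP[] /dvdnP [k e]; [left|right].
      by rewrite e -addn1 modnMDl.
    by rewrite (_ : t.+1 + 1 = t + 2)%N ?e ?modnMl ?mod0n //; lia.
  rewrite (_ : 12 * 1 = 2 * (2 * 3))%N // !Euclid_dvdM // => /or3P[] /dvdn_leq;
    by move=> /(_ isT); rewrite leqNgt (leq_trans _ p5).
case: p pp pn => [|[|[|[|[|]]]]] // _ _ _.
- have l3 : (logn 2 n <= 3)%N by rewrite leqNgt; rewrite -(@pfactor_dvdn 2 4 n).
  by apply: (@dvdn_trans (2 ^ 3)) => //; exact: dvdn_exp2l.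
- have l1 : (logn 3 n <= 1)%N by rewrite leqNgt; rewrite -(@pfactor_dvdn 3 2 n).
  by apply: (@dvdn_trans (3 ^ 1)) => //; exact: dvdn_exp2l.
Qed.

(** * Fractional ideals *)

Local Notation fractional := (fractional_ideal K).

Let fracK a x : fractional a -> a x -> K x.
Proof. by case=> aK _ _ _ _; exact: aK. Qed.

Let fracD a x y : fractional a -> a x -> a y -> a (x + y).
Proof. by case=> _ _ aD _ _; exact: aD. Qed.

Let fracM a r x : fractional a -> O r -> a x -> a (r * x).
Proof. by case=> _ _ _ aM _; exact: aM. Qed.

Let frac0 a : fractional a -> a 0.
Proof. by move=> fa; have [_ [x ax _] _ _ _] := fa; rewrite -(mul0r x); exact: fracM. Qed.

Lemma fractional_scale a d : fractional a -> K d -> d != 0 -> fractional [set d * x | x in a].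
Proof.
move=> fa Kd d0; have [aK [x ax x0] aD aM [e [Oe e0 ae]]] := fa; split.
- by move=> _ [y ay <-]; apply: (subfieldM hK) => //; exact: aK.
- by exists (d * x); rewrite ?mulf_neq0 //; exists x.
- by move=> _ _ [y ay <-] [z az <-]; exists (y + z); [exact: aD|rewrite mulrDr].
- by move=> r _ Or [y ay <-]; exists (r * y); [exact: aM|rewrite mulrCA].
have [n n0 On] := imag_quadratic_integral_multiple (subfieldV hK Kd).
have n0C : n%:R != 0 :> C by rewrite pnatr_eq0 gtn_eqF.
have [n' n0' On'] := imag_quadratic_integral_multiple Kd.
have n0C' : n'%:R != 0 :> C by rewrite pnatr_eq0 gtn_eqF.
exists (n'%:R * e); split; [|by rewrite mulf_neq0|].
  by apply: ring_of_integersM => //; exact: ring_of_integers_nat.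
move=> _ [y ay <-]; rewrite mulrACA; apply: ring_of_integersM => //.
exact: ae.
Qed.

Lemma fractional_O : fractional (principal K 1).
Proof.
split.
- by move=> _ [r [Kr _] <-]; rewrite mul1r.
- by exists 1; rewrite ?oner_neq0 //; exists 1; rewrite ?mulr1.
- by move=> _ _ [r Or <-] [t Ot <-]; exists (r + t); [exact: ring_of_integersD|rewrite mulrDr].
- by move=> r _ Or [t Ot <-]; exists (r * t); [exact: ring_of_integersM|rewrite mulrCA].
by exists 1; split; rewrite ?oner_neq0 // => _ [r Or <-]; rewrite !mul1r.
Qed.

Lemma principal_scale d : principal K d = [set d * x | x in principal K 1].
Proof.
apply/seteqP; split=> [_ [r Or <-]|_ [_ [r Or <-] <-]].
  by exists r => //; exists r; rewrite ?mul1r.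
by exists r; rewrite ?mul1r.
Qed.

Lemma fractional_principal d : K d -> d != 0 -> fractional (principal K d).
Proof. by rewrite principal_scale; exact: fractional_scale fractional_O. Qed.

Lemma fractional_mul a b : fractional a -> fractional b -> fractional (ideal_mul a b).
Proof.
move=> fa fb; have [aK [x ax x0] aD aM [e [Oe e0 ae]]] := fa.
have [bK [y bY y0] bD bM [e' [Oe' e0' be]]] := fb; split.
- apply: ideal_mul_min; [|exact: (subfield0 hK)|exact: (subfieldD hK)].
  by move=> u v /aK Ku /bK Kv; exact: (subfieldM hK).
- by exists (x * y); [exact: mem_ideal_mul|rewrite mulf_neq0].
- exact: ideal_mulD.
- move=> r z Or; move: z; apply: ideal_mul_min.
  + by move=> u v au bv; rewrite mulrA; apply: mem_ideal_mul => //; exact: aM.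
  + by rewrite mulr0; exact: ideal_mul0.
  + by move=> u v; rewrite mulrDr; exact: ideal_mulD.
exists (e * e'); split; [exact: ring_of_integersM|exact: mulf_neq0|].
apply: ideal_mul_min => [u v au bv||u v].
- by rewrite mulrACA; apply: ring_of_integersM; [exact: ae|exact: be].
- by rewrite mulr0.
- by rewrite mulrDr; exact: ring_of_integersD.
Qed.

Lemma ideal_mul_scale d a : fractional a -> ideal_mul (principal K d) a = [set d * x | x in a].
Proof.
move=> fa; apply/seteqP; split.
  apply: ideal_mul_min => [_ x [r Or <-] ax||_ _ [x ax <-] [y ay <-]].
  - by exists (r * x); [exact: fracM|rewrite mulrA].
  - by exists 0; [exact: frac0|rewrite mulr0].
  - by exists (x + y); [exact: fracD|rewrite mulrDr].
by move=> _ [x ax <-]; apply: mem_ideal_mul => //; exists 1; rewrite ?mulr1.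
Qed.

Lemma ideal_mul1 a : fractional a -> ideal_mul (principal K 1) a = a.
Proof.
move=> fa; rewrite ideal_mul_scale //; apply/seteqP; split=> [_ [x ax <-]|x ax].
  by rewrite mul1r.
by exists x; rewrite ?mul1r.
Qed.

Lemma ideal_mul_principal d e : K e -> e != 0 ->
  ideal_mul (principal K d) (principal K e) = principal K (d * e).
Proof.
move=> Ke e0; rewrite ideal_mul_scale; last exact: fractional_principal.
apply/seteqP; split=> [_ [_ [r Or <-] <-]|_ [r Or <-]].
  by exists r; rewrite ?mulrA.
by exists (e * r); rewrite ?mulrA //; exists r.
Qed.

Let frac_int a : fractional a -> a `<=` O -> exists2 n : nat, (0 < n)%N & a n%:R.
Proof.
move=> fa aO; have [_ [x ax x0] _ _ _] := fa; have [n nE] := ring_of_integers_norm (aO _ ax).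
exists n; last by rewrite -nE mulrC; apply: fracM => //; exact/ring_of_integers_conj/aO.
rewrite lt0n; apply: contraNneq x0 => n0; move/eqP: nE; rewrite n0 mulf_eq0.
by rewrite fmorph_eq0 orbb.
Qed.

Let frac_int_mul a (x : C) (k : int) : fractional a -> a x -> a (k%:~R * x).
Proof. by move=> fa ax; apply: fracM => //; exact: ring_of_integers_int. Qed.

(** Hermite normal form: take the least positive integer in a, and an element of a whose coefficient
    on [om] is positive and least. *)
Let two_generators a : fractional a -> a `<=` O -> exists x y,
  [/\ a x, a y, x != 0 & forall z, a z -> exists r t : int, z = r%:~R * x + t%:~R * y].
Proof.
move=> fa aO; have [n1 n1_gt0 an1] := frac_int fa aO.
have ex1 : exists n : nat, (0 < n)%N && `[< a n%:R >] by exists n1; rewrite n1_gt0; apply/asboolP.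
case: (ex_minnP ex1) => n /andP[n0 /asboolP an] minn.
have ex2 : exists d : nat, (0 < d)%N && `[< exists u : int, a (u%:~R + d%:R * om) >].
  exists n; rewrite n0; apply/asboolP; exists 0; rewrite add0r mulrC.
  exact: fracM.
case: (ex_minnP ex2) => d /andP[d0 /asboolP [u ay]] mind.
exists n%:R, (u%:~R + d%:R * om); split=> //; first by rewrite pnatr_eq0 gtn_eqF.
move=> z az; have /ring_of_integersP [v [w zE]] := aO _ az.
have dz : d%:Z != 0 by rewrite eqz_nat gtn_eqF.
have nz : n%:Z != 0 by rewrite eqz_nat gtn_eqF.
pose k := (w %/ d)%Z.
have az1 : a ((v - k * u)%:~R + (w %% d)%Z%:~R * om).
  have -> : (v - k * u)%:~R + (w %% d)%Z%:~R * om = z + (- k)%:~R * (u%:~R + d%:R * om).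
    by rewrite zE {2}(divz_eq w d) -/k !(intrD, intrB, intrM) rmorphN /= -pmulrn; ring.
  by apply: fracD => //; exact: frac_int_mul.
have wge := modz_ge0 w dz; have wlt := ltz_pmod w (d := d) d0.
have [r [rE rd]] : exists r : nat, (w %% d)%Z = r /\ (r < d)%N.
  by exists `|(w %% d)%Z|%N; split; lia.
have r0 : r = 0%N.
  case: (posnP r) => // r0; suff : (d <= r)%N by rewrite leqNgt rd.
  by apply: mind; rewrite r0; apply/asboolP; exists (v - k * u); rewrite pmulrn -rE.
move: az1; rewrite rE r0 mul0r addr0 => az1.
pose v' := v - k * u; have vge := modz_ge0 v' nz; have vlt := ltz_pmod v' (d := n) n0.
have [t [tE tn]] : exists t : nat, (v' %% n)%Z = t /\ (t < n)%N.
  by exists `|(v' %% n)%Z|%N; split; lia.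
have at0 : a t%:R.
  have -> : t%:R = v'%:~R + (- (v' %/ n)%Z)%:~R * n%:R :> C.
    by rewrite {1}(divz_eq v' n) tE !(intrD, intrM) rmorphN /= -!pmulrn; ring.
  by apply: fracD => //; exact: frac_int_mul.
have t0 : t = 0%N.
  case: (posnP t) => // t0; suff : (n <= t)%N by rewrite leqNgt tn.
  by apply: minn; rewrite t0; apply/asboolP.
exists (v' %/ n)%Z, k; rewrite zE (divz_eq w d) -/k rE r0 addr0 !intrM -pmulrn.
have -> : v = v' + k * u by rewrite subrK.
by rewrite {1}(divz_eq v' n) tE t0 addr0 intrD !intrM -!pmulrn; ring.
Qed.

(* The gcd g of the coefficients of the norm form N(r x + t y) generates
   a * conj a, since x * conj y / g has integral trace and norm. *)
Let norm_form a : fractional a -> a `<=` O ->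
  exists x y : C, exists g A B E u v w : int,
  [/\ a x /\ a y, g != 0, forall z z', a z -> a z' -> O (z * z'^* / g%:~R),
      u * A + v * B + w * E = 1 &
      [/\ x * x^* = (g * A)%:~R, x * y^* + x^* * y = (g * B)%:~R & y * y^* = (g * E)%:~R]].
Proof.
move=> fa aO; have [x [y [ax ay x0 gen]]] := two_generators fa aO.
have [Ox Oy] := (aO _ ax, aO _ ay); have Ox' := ring_of_integers_conj Ox.
have Oy' := ring_of_integers_conj Oy.
have [A0 xx] := ring_of_integers_norm Ox; have [E0 yy] := ring_of_integers_norm Oy.
have [B0 xy] : exists B0 : int, x * y^* + x^* * y = B0%:~R.
  apply: ring_of_integers_real; first by apply: ring_of_integersD; exact: ring_of_integersM.
  by rewrite rmorphD !rmorphM /= !conjCK addrC.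
pose g := gcdz A0%:Z (gcdz B0 E0%:Z).
have A00 : A0 != 0%N.
  by apply: contraNneq x0 => A00; move/eqP: xx; rewrite A00 mulf_eq0 fmorph_eq0 orbb.
have g0 : g != 0 by rewrite gcdz_eq0 eqz_nat (negPf A00).
have /dvdzP [A AE] : (g %| A0%:Z)%Z by exact: dvdz_gcdl.
have /dvdzP [B BE] : (g %| B0)%Z by apply: dvdz_trans (dvdz_gcdr _ _) (dvdz_gcdl _ _).
have /dvdzP [E EE] : (g %| E0%:Z)%Z by apply: dvdz_trans (dvdz_gcdr _ _) (dvdz_gcdr _ _).
have [u [u' /esym uu]] := Bezoutz A0%:Z (gcdz B0 E0%:Z).
have [v [v' /esym vv]] := Bezoutz B0 E0%:Z.
have prim : u * A + (u' * v) * B + (u' * v') * E = 1.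
  have gE : u * (A * g) + u' * (v * (B * g) + v' * (E * g)) = g.
    by rewrite -AE -BE -EE -vv -uu.
  by apply: (mulIf g0); rewrite mul1r -[RHS]gE; ring.
have gC : g%:~R != 0 :> C by rewrite intr_eq0.
have xx' : x * x^* = (g * A)%:~R by rewrite xx mulrC -AE -pmulrn.
have yy' : y * y^* = (g * E)%:~R by rewrite yy mulrC -EE -pmulrn.
have xy' : x * y^* + x^* * y = (g * B)%:~R by rewrite xy mulrC -BE.
have Og : O (x * y^* / g%:~R).
  split.
    by apply: (subfield_div hK); [case: (ring_of_integersM Ox Oy')|exact: subfield_int].
  apply: (@integral_quadratic _ B (- (A * E))).
  have -> : B%:~R = (x * y^* + x^* * y) / g%:~R :> C by rewrite xy' intrM mulrAC divff ?mul1r.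
  rewrite rmorphN /= intrM.
  have -> : A%:~R = (x * x^*) / g%:~R :> C by rewrite xx' intrM mulrAC divff ?mul1r.
  have -> : E%:~R = (y * y^*) / g%:~R :> C by rewrite yy' intrM mulrAC divff ?mul1r.
  by field.
exists x, y, g, A, B, E, u, (u' * v), (u' * v'); split=> // z z' az az'.
have [r [t ->]] := gen _ az; have [r' [t' ->]] := gen _ az'.
have Og' : O (x^* * y / g%:~R).
  have -> : x^* * y / g%:~R = (x * y^* / g%:~R)^*.
    by rewrite !rmorphM /= fmorphV /= conjCK rmorph_int.
  exact: ring_of_integers_conj.
have -> : (r%:~R * x + t%:~R * y) * (r'%:~R * x + t'%:~R * y)^* / g%:~R =
    (r * r' * A)%:~R + (r * t')%:~R * (x * y^* / g%:~R) + (t * r')%:~R * (x^* * y / g%:~R)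
    + (t * t' * E)%:~R.
  rewrite rmorphD !rmorphM /= !conj_int ?intrM.
  have -> : A%:~R = (x * x^*) / g%:~R :> C by rewrite xx' intrM mulrAC divff ?mul1r.
  have -> : E%:~R = (y * y^*) / g%:~R :> C by rewrite yy' intrM mulrAC divff ?mul1r.
  by field.
have Oi := ring_of_integers_int.
by do !apply: ring_of_integersD; rewrite //; apply: ring_of_integersM.
Qed.

Let integral_scale a : fractional a -> exists d, [/\ K d, d != 0,
  fractional [set d * x | x in a] & [set d * x | x in a] `<=` O].
Proof.
move=> fa; have [_ _ _ _ [d [[Kd id] d0 da]]] := fa; exists d; split=> //.
  exact: fractional_scale.
by move=> _ [x ax <-]; exact: da.
Qed.

(** For da integral, the product of da and its conjugate is gO, so the inverse of a is d / g times
    the conjugate of da. The Bezout relation of [norm_form] shows that 1 is in the product. *)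
Lemma fractional_inverse a : fractional a ->
  exists2 b, fractional b & ideal_mul a b = principal K 1.
Proof.
move=> fa; have [d [Kd d0 fda daO]] := integral_scale fa.
have [x [y [g [A [B [E [u [v [w [[ax ay] g0 aa prim [xx xy yy]]]]]]]]]]] := norm_form fda daO.
have gC : g%:~R != 0 :> C by rewrite intr_eq0.
pose b := [set d / g%:~R * (z^*) | z in [set d * x | x in a]].
have fb : fractional b.
  have Kg : K (d / g%:~R) by apply: (subfield_div hK) => //; exact: subfield_int.
  have -> : b = [set d / g%:~R * z | z in [set z^* | z in [set d * x | x in a]]].
    apply/seteqP; split=> [_ [z az <-]|_ [_ [z az <-] <-]]; last by exists z.
    by exists (z^*) => //; exists z.
  apply: fractional_scale => //; last by rewrite mulf_neq0 // invr_eq0.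
  have [daK [z az z0] aD aM [e [Oe e0 ae]]] := fda; split.
  - by move=> _ [t at_ <-]; exact: (imag_quadratic_conj (daK _ at_)).
  - by exists (z^*); [exists z|rewrite fmorph_eq0].
  - by move=> _ _ [s1 a1 <-] [s2' a2 <-]; exists (s1 + s2'); [exact: aD|rewrite rmorphD].
  - move=> r _ Or [t at_ <-]; exists (r^* * t); last by rewrite rmorphM /= conjCK.
    by apply: aM => //; exact: ring_of_integers_conj.
  exists (e^*); split; [exact: ring_of_integers_conj|by rewrite fmorph_eq0|].
  by move=> _ [t at_ <-]; rewrite -rmorphM; apply/ring_of_integers_conj/ae.
exists b => //; apply/seteqP; split.
  apply: ideal_mul_min => [z _ az [t at_ <-]||].
  - exists (d * z * t^* / g%:~R); last by rewrite mul1r; field.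
    by apply: aa => //; exists z.
  - by exists 0; rewrite ?mulr0.
  - by move=> _ _ [r Or <-] [t Ot <-]; exists (r + t); [exact: ring_of_integersD|rewrite mulrDr].
have fab : fractional (ideal_mul a b) by exact: fractional_mul.
move=> _ [r Or <-]; rewrite mulrC; apply: fracM => //.
have mem z t : a z -> a t -> ideal_mul a b (d * z * (d * t)^* / g%:~R).
  move=> az at_; have -> : d * z * (d * t)^* / g%:~R = z * (d / g%:~R * (d * t)^*) by field.
  by apply: mem_ideal_mul => //; exists (d * t) => //; exists t.
have [[x' ax' xE] [y' ay' yE]] := (ax, ay).
have mi (k : int) z : ideal_mul a b z -> ideal_mul a b (k%:~R * z).
  by move=> abz; apply: fracM => //; exact: ring_of_integers_int.
have -> : 1 = u%:~R * (x * x^* / g%:~R) + v%:~R * (x * y^* / g%:~R + y * x^* / g%:~R)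
   + w%:~R * (y * y^* / g%:~R) :> C.
  have -> : x * y^* / g%:~R + y * x^* / g%:~R = B%:~R.
    by rewrite -mulrDl [y * _]mulrC xy intrM mulrAC divff ?mul1r.
  by rewrite xx yy !intrM ![g%:~R * _ / _]mulrAC divff // !mul1r -!intrM -!intrD prim.
rewrite -xE -yE.
by do !apply: fracD; rewrite //; apply: mi; rewrite //; (try apply: fracD => //); exact: mem.
Qed.

(** The normalised norm form of da is primitive, so some z in da has norm g M with M prime to n, an
    integer of f. Scaling a by c = d conj(z) / g gives an integral ideal that contains M. *)
Lemma fractional_prime_to a f : fractional a -> integral_ideal K f ->
  exists c, [/\ K c, c != 0, integral_ideal K [set c * x | x in a] &
    comaximal [set c * x | x in a] f].
Proof.
move=> fa [ff fO]; have [d [Kd d0 fda daO]] := integral_scale fa.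
have [x [y [g [A [B [E [u [v [w [[ax ay] g0 aa prim [xx xy yy]]]]]]]]]]] := norm_form fda daO.
have gC : g%:~R != 0 :> C by rewrite intr_eq0.
have [n n0 fn] := frac_int ff fO.
(* Coprimality with 2n, rather than with n, excludes M = 0 also when n = 1. *)
have n2 : (0 < 2 * n)%N by rewrite muln_gt0.
have [r [t cop]] := primitive_form_coprime n2 prim.
set M := (_ + _ + _) in cop.
pose z := r%:R * x + t%:R * y.
have az : [set d * x | x in a] z.
  by apply: fracD => //; apply: fracM => //; exact: ring_of_integers_nat.
have zM : z * z^* / g%:~R = M%:~R.
  have -> : z * z^* = r%:R ^+ 2 * (x * x^*) + r%:R * t%:R * (x * y^* + x^* * y) + t%:R ^+ 2 * (y * y^*).
    by rewrite /z rmorphD !rmorphM /= !rmorph_nat; ring.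
  by rewrite xx xy yy /M !expr2 !(intrD, intrM) -!pmulrn; field.
have M0 : M != 0.
  apply: contraTneq cop => ->; rewrite absz0 /coprime gcd0n; lia.
have z0 : z != 0.
  by apply: contraNneq M0 => z0; rewrite -(intr_eq0 C) -zM z0 !mul0r.
pose c := z^* / g%:~R * d.
have Kz : K z^* by apply: imag_quadratic_conj; exact: fracK az.
have Kc : K c.
  by apply: (subfieldM hK) => //; apply: (subfield_div hK) => //; exact: (subfield_int hK).
have c0 : c != 0 by rewrite !mulf_neq0 ?invr_eq0 ?fmorph_eq0.
exists c; split=> //.
  split; first exact: fractional_scale.
  move=> _ [s1 as1 <-]; rewrite /c.
  have -> : z^* / g%:~R * d * s1 = d * s1 * z^* / g%:~R by ring.
  by apply: aa => //; exists s1.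
have [k [l kl]] : exists k l : int, k * M + l * n%:Z = 1.
  have := Bezoutz M (2 * n%:Z); case=> k [l e]; exists k, (l * 2).
  rewrite -mulrA e -PoszM /gcdz absz_nat; congr Posz; exact/eqP.
exists (k * M)%:~R, (l * n%:Z)%:~R; split; last by rewrite -intrD kl.
- have [z' az' zE] := az; rewrite intrM -zM -zE.
  exists (k%:~R * z'); last by rewrite /c -zE; field.
  exact: frac_int_mul.
- by rewrite intrM -pmulrn; exact: frac_int_mul.
Qed.

(** * Ideal classes and powers of ideals *)

Lemma ideal_class_eq a b : ideal_class K a = ideal_class K b <->
  exists c, [/\ K c, c != 0 & a = [set c * x | x in b]].
Proof.
split=> [e|[c [Kc c0 ->]]].
  have : ideal_class K a a.
    exists 1; split; [exact: (subfield1 hK)|exact: oner_neq0|].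
    by apply/seteqP; split=> [x ax|_ [x ax <-]]; [exists x; rewrite ?mul1r|rewrite mul1r].
  by rewrite e => -[c [Kc c0 ->]]; exists c.
apply/seteqP; split=> _ [d [Kd d0 ->]].
  exists (d * c); split; [exact: (subfieldM hK)|exact: mulf_neq0|].
  apply/seteqP; split=> [_ [_ [x bx <-] <-]|_ [x bx <-]].
    by exists x; rewrite ?mulrA.
  by exists (c * x); [exists x|rewrite mulrA].
exists (d / c); split; [exact: (subfield_div hK)|by rewrite mulf_neq0 ?invr_eq0|].
apply/seteqP; split=> [_ [x bx <-]|_ [_ [x bx <-] <-]].
  by exists (c * x); [exists x|rewrite mulrA mulfVK].
by exists x; rewrite // mulrA mulfVK.
Qed.

Lemma class_representatives h : is_class_number K h -> exists b : 'I_h -> set C,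
  [/\ forall i, fractional (b i), forall i j, ideal_class K (b i) = ideal_class K (b j) -> i = j &
      forall a, fractional a -> exists i, ideal_class K a = ideal_class K (b i)].
Proof.
move=> /card_set_bijP [F [Fh Finj Fsurj]].
have /choice [b bP] (i : 'I_h) : exists a, fractional a /\ F (ideal_class K a) = i.
  by have [_ [a fa <-] Fa] := Fsurj i (ltn_ord i); exists a.
have cls a : fractional a -> class_group K (ideal_class K a) by move=> fa; exists a.
exists b; split=> [i|i j e|a fa].
- by case: (bP i).
- by have [[_ Fi] [_ Fj]] := (bP i, bP j); apply: val_inj; rewrite /= -Fi -Fj e.
have lt : (F (ideal_class K a) < h)%N by exact: Fh (cls _ fa).
exists (Ordinal lt); have [fb Fb] := bP (Ordinal lt).
by apply: Finj; rewrite ?inE ?Fb //; exact: cls.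
Qed.

Lemma ideal_exp_fractional a n : fractional a -> fractional (ideal_exp K a n).
Proof. by move=> fa; elim: n => [|n IHn]; [exact: fractional_O|exact: fractional_mul]. Qed.

Lemma ideal_expD a i j : fractional a ->
  ideal_exp K a (i + j) = ideal_mul (ideal_exp K a i) (ideal_exp K a j).
Proof.
move=> fa; elim: i => [|i IHi]; first by rewrite ideal_mul1 //; exact: ideal_exp_fractional.
by rewrite addSn /= IHi ideal_mulA.
Qed.

Lemma ideal_expM a b n : fractional a -> fractional b ->
  ideal_exp K (ideal_mul a b) n = ideal_mul (ideal_exp K a n) (ideal_exp K b n).
Proof.
move=> fa fb; elim: n => [|n IHn] /=; first by rewrite ideal_mul1 //; exact: fractional_O.
rewrite IHn -!ideal_mulA; congr (ideal_mul _ _).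
by rewrite [RHS]ideal_mulC -ideal_mulA; congr (ideal_mul _ _); exact: ideal_mulC.
Qed.

Lemma ideal_exp_principal c n : K c -> c != 0 ->
  ideal_exp K (principal K c) n = principal K (c ^+ n).
Proof.
move=> Kc c0; elim: n => [|n IHn]; first by rewrite expr0.
by rewrite /= IHn ideal_mul_principal ?exprS ?expf_neq0 //; exact: (subfieldX hK).
Qed.

Lemma class_finite_order h a : is_class_number K h -> fractional a ->
  exists n c, [/\ (0 < n)%N, K c, c != 0 & ideal_exp K a n = principal K c].
Proof.
move=> /class_representatives [b [fb binj bsurj]] fa.
have /choice [ix ixP] (i : 'I_h.+1) := bsurj _ (ideal_exp_fractional i fa).
suff [i [j [ij e]]] : exists i j : 'I_h.+1, (i < j)%N /\ ix i = ix j.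
  have /ideal_class_eq [c [Kc c0 ec]] :
      ideal_class K (ideal_exp K a j) = ideal_class K (ideal_exp K a i) by rewrite !ixP e.
  exists (j - i)%N, c; split=> //; first by rewrite subn_gt0.
  have [a' fa' aa'] := fractional_inverse (ideal_exp_fractional i fa).
  have fji := ideal_exp_fractional (j - i) fa.
  rewrite -[LHS]ideal_mul1 // -aa' [X in ideal_mul X _]ideal_mulC -ideal_mulA -ideal_expD //.
  rewrite subnKC ?(ltnW ij) // ec -ideal_mul_scale; last exact: ideal_exp_fractional.
  rewrite ideal_mulA [ideal_mul a' _]ideal_mulC -ideal_mulA [ideal_mul a' _]ideal_mulC aa'.
  by rewrite ideal_mul_principal ?mulr1 ?oner_neq0 //; exact: (subfield1 hK).
have /injectivePn [i [j ij e]] : ~~ injectiveb ix.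
  by apply/negP => /injectiveP/leq_card; rewrite !card_ord ltnn.
case: (ltngtP i j) => [lij|lij|/val_inj eij]; first by exists i, j.
  by exists j, i.
by rewrite eij eqxx in ij.
Qed.

(** O is integrally closed: x in a has x^n in a^n = O, so x is in O. The same applied to the inverse
    of a gives equality. *)
Lemma ideal_exp_torsion_free a n : (0 < n)%N -> fractional a ->
  ideal_exp K a n = principal K 1 -> a = principal K 1.
Proof.
move=> n0; suff H b : fractional b -> ideal_exp K b n = principal K 1 -> b `<=` principal K 1.
  move=> fa an; apply/seteqP; split; first exact: H.
  have [a' fa' aa'] := fractional_inverse fa; rewrite -[X in _ `<=` X]ideal_mul1 // -[X in X `<=` _]aa'.
  rewrite ideal_mulC; apply: ideal_mulS => //; apply: H => //.
  rewrite -[LHS]ideal_mul1; last exact: ideal_exp_fractional.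
  rewrite -{1}an -ideal_expM // aa' ideal_exp_principal ?expr1n ?oner_neq0 //.
  exact: (subfield1 hK).
move=> fb bn x bx; exists x; rewrite ?mul1r //.
apply: (ring_of_integers_root n0 (fracK fb bx)).
suff : ideal_exp K b n (x ^+ n) by rewrite bn => -[r Or <-]; rewrite mul1r.
elim: {bn n0} n => [|k IHk] /=; first by exists 1; rewrite ?mulr1.
by rewrite exprS; exact: mem_ideal_mul.
Qed.

(** * Ideals prime to the modulus, and the image of eps *)

Section PrimeToModulus.
Variable f : set C.
Hypothesis hf : integral_ideal K f.
Local Notation If := (ideals_prime_to K f).
Local Notation Pf := (integers_prime_to K f).

Let ff : fractional f. Proof. by case: hf. Qed.

Lemma comaximal_mul a b : a `<=` O -> b `<=` O -> comaximal a f -> comaximal b f ->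
  comaximal (ideal_mul a b) f.
Proof.
move=> aO bO [x [y [ax fy xy]]] [x' [y' [bx fy' xy']]].
exists (x * x'), (x * y' + (y * x' + y * y')); split; first exact: mem_ideal_mul.
  apply: fracD => //; first by apply: fracM => //; exact: aO.
  rewrite -mulrDr mulrC; apply: fracM => //; rewrite addrC addrC.
  by rewrite xy'.
by rewrite -mulrDr addrA -mulrDr xy' !mulr1.
Qed.

Lemma integral_mul_integral a b : integral_ideal K a -> integral_ideal K b ->
  integral_ideal K (ideal_mul a b).
Proof.
move=> [fa aO] [fb bO]; split; first exact: fractional_mul.
apply: ideal_mul_min => // [x y /aO Ox /bO Oy|x y]; first exact: ring_of_integersM.
exact: ring_of_integersD.
Qed.

Let integral_O : integral_ideal K (principal K 1).
Proof. by split; [exact: fractional_O|move=> _ [r Or <-]; rewrite mul1r]. Qed.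

Let comaximal_O : comaximal (principal K 1) f.
Proof. by exists 1, 0; split; [exists 1; rewrite ?mulr1|exact: frac0|rewrite addr0]. Qed.

Lemma ideals_prime_to_integral a : integral_ideal K a -> comaximal a f -> If a.
Proof.
move=> ia af; split; first by case: ia.
exists a, (principal K 1); split=> //.
by rewrite ideal_mulC ideal_mul1 //; case: ia.
Qed.

Lemma ideals_prime_to_O : If (principal K 1).
Proof. exact: ideals_prime_to_integral. Qed.

Lemma ideals_prime_to_mul a b : If a -> If b -> If (ideal_mul a b).
Proof.
move=> [fa [u [v [iu iv uf vf auv]]]] [fb [u' [v' [iu' iv' uf' vf' buv]]]].
split; first exact: fractional_mul.
exists (ideal_mul u u'), (ideal_mul v v'); split.
- exact: integral_mul_integral.
- exact: integral_mul_integral.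
- by apply: comaximal_mul => //; [case: iu|case: iu'].
- by apply: comaximal_mul => //; [case: iv|case: iv'].
rewrite -auv -buv -!ideal_mulA; congr (ideal_mul _ _).
by rewrite ideal_mulA [RHS]ideal_mulA; congr (ideal_mul _ _); exact: ideal_mulC.
Qed.

Lemma ideals_prime_to_inverse a : If a -> exists2 b, If b & ideal_mul a b = principal K 1.
Proof.
move=> [fa [u [v [iu iv uf vf auv]]]]; have [b fb ab] := fractional_inverse fa.
exists b => //; split=> //; exists v, u; split=> //.
by rewrite -auv ideal_mulA [ideal_mul b a]ideal_mulC ab ideal_mul1 //; case: iv.
Qed.

Lemma ideals_prime_to_exp a n : If a -> If (ideal_exp K a n).
Proof.
by move=> Ia; elim: n => [|n IHn]; [exact: ideals_prime_to_O|exact: ideals_prime_to_mul].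
Qed.

Lemma integers_prime_to1 : Pf 1.
Proof. by split. Qed.

Lemma integers_prime_toM x y : Pf x -> Pf y -> Pf (x * y).
Proof.
move=> [Ox [_ [y1 [[r Or <-] fy1 e1]]]] [Oy [_ [y2 [[t Ot <-] fy2 e2]]]].
split; first exact: ring_of_integersM.
exists (x * y * (r * t)), (y1 * (y * t) + y2); split=> //.
- by exists (r * t) => //; exact: ring_of_integersM.
- apply: fracD => //; rewrite mulrC; apply: fracM => //; exact: ring_of_integersM.
by rewrite addrA mulrACA -mulrDl e1 mul1r.
Qed.

Lemma integers_prime_toN1 : Pf (-1).
Proof.
split; first exact: ring_of_integersN.
by exists 1, 0; split; [exists (-1); rewrite ?mulrNN ?mulr1 //; exact: ring_of_integersN|exact: frac0|rewrite addr0].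
Qed.

(** With cO = u / v, take g in v congruent to 1 modulo f. Then c g is in u and is again prime to f:
    if x = c t in u is congruent to 1, then so is c g t = x g. As f is proper, g is not 0. *)
Lemma ideals_prime_to_principal c : ~ f 1 -> K c -> c != 0 -> If (principal K c) ->
  exists b g, [/\ Pf b, Pf g & c = b / g].
Proof.
move=> nf Kc c0 [_ [u [v [[fu uO] [fv vO] [x [y [ux fy xy]]] [g [y' [vg fy' gy']]] cvu]]]].
have g0 : g != 0.
  by apply/eqP => g0; apply: nf; rewrite -gy' g0 add0r.
have [Oc Og] : O (c * g) /\ O g.
  split; last exact: vO.
  by apply: uO; rewrite -cvu; apply: mem_ideal_mul => //; exists 1; rewrite ?mulr1.
exists (c * g), g; split; [split=> //|split=> //|by rewrite mulfK].
- have : ideal_mul (principal K c) v x by rewrite cvu.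
  rewrite ideal_mul_scale // => -[t vt xE].
  exists (c * g * t), (1 - c * g * t); split; last by rewrite addrC subrK.
    by exists t => //; exact: vO.
  have -> : 1 - c * g * t = y + x * y'.
    have -> : y = 1 - x by rewrite -xy addrC addKr.
    have -> : y' = 1 - g by rewrite -gy' addrC addKr.
    by rewrite -xE; ring.
  by apply: fracD => //; apply: fracM => //; exact: uO.
- by exists g, y'; split=> //; exists 1; rewrite ?mulr1.
Qed.

Section CharacterImage.
Variable eps : C -> C.
Hypotheses (heps : is_character_mod K f eps) (epsN1 : eps (-1) = -1).

Lemma character_mod1 : eps 1 = 1.
Proof.
have [e0 _ eM] := heps; apply: (mulfI (e0 _ integers_prime_to1)).
by rewrite -eM ?mulr1 //; exact: integers_prime_to1.
Qed.

Lemma modulus_proper : ~ f 1.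
Proof.
move=> f1; have [_ ef _] := heps; have : eps (-1) = eps 1.
  apply: ef; [exact: integers_prime_toN1|exact: integers_prime_to1|].
  by rewrite -[_ - _]mulr1; apply: fracM => //; apply: ring_of_integersB => //; exact: ring_of_integersN.
rewrite epsN1 character_mod1 => /eqP; rewrite eq_sym -subr_eq0 opprK.
by rewrite (_ : 1 + 1 = 2%:R) // pnatr_eq0.
Qed.

(** A finite subgroup of C^* is some mu_m. There are finitely many values because f contains a
    positive integer n, and m is even because -1 is a value. *)
Lemma character_image : exists m, [/\ (0 < m)%N, (2 %| m)%N &
  forall z, image_eps K f eps z <-> z ^+ m = 1].
Proof.
have [e0 ef eM] := heps; have [ff' fO] := hf; have [n n0 fn] := frac_int ff' fO.
pose img z := `[< image_eps K f eps z >].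
pose L := undup [seq z <- [seq eps (p.1%:R + p.2%:R * om) | p : 'I_n * 'I_n] | img z].
have LP z : (z \in L) = img z.
  rewrite mem_undup mem_filter; apply: andb_idr => /asboolP [x [Ox xf] <-].
  have [a [b Oab]] := ring_of_integers_residues n0 Ox; apply/mapP.
  have fx : f (x - (a%:R + b%:R * om)).
    rewrite -[X in f X](mulfVK (_ : n%:R != 0)) ?pnatr_eq0 ?gtn_eqF //.
    exact: fracM.
  exists (a, b); first by rewrite mem_enum.
  apply: ef => //=; split.
    apply: ring_of_integersD; first exact: ring_of_integers_nat.
    by apply: ring_of_integersM => //; exact: ring_of_integers_nat.
  have [_ [y [[r Or <-] fy e]]] := xf.
  exists ((a%:R + b%:R * om) * r), (y + r * (x - (a%:R + b%:R * om))); split.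
  - by exists r.
  - by apply: fracD => //; exact: fracM.
  - by rewrite -e; ring.
have img1 : img 1 by apply/asboolP; exists 1; [exact: integers_prime_to1|exact: character_mod1].
have imgM z w : img z -> img w -> img (z * w).
  move=> /asboolP [x xf <-] /asboolP [y yf <-]; apply/asboolP; exists (x * y).
    exact: integers_prime_toM.
  exact: eM.
have img0 z : img z -> z != 0 by move=> /asboolP [x xf <-]; exact: e0.
have m0 : (0 < size L)%N.
  by have := img1; rewrite -LP; case: (L).
have rootL z : img z -> z ^+ size L = 1.
  (* Multiplication by z permutes the values; comparing the products of all of them gives z^m =
     1. *)
  move=> iz; have pe : perm_eq [seq z * w | w <- L] L.
    have uL : uniq L := undup_uniq _.
    have uzL : uniq [seq z * w | w <- L] by rewrite map_inj_uniq //; exact: mulfI (img0 _ iz).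
    have sub : {subset [seq z * w | w <- L] <= L}.
      by move=> _ /mapP [w wL ->]; rewrite LP; apply: imgM => //; rewrite -LP.
    have [|_ eL] := uniq_min_size uzL sub; first by rewrite size_map.
    exact: uniq_perm.
  have : \prod_(w <- L) w = z ^+ size L * \prod_(w <- L) w.
    by rewrite -{1}(perm_big _ pe) big_map big_split /= big_const_seq count_predT iter_mulr_1.
  have P0 : \prod_(w <- L) w != 0.
    by rewrite prodf_seq_neq0; apply/allP => w; rewrite LP => /img0.
  by move=> e; apply: (mulIf P0); rewrite -e mul1r.
have imgP z : img z <-> z ^+ size L = 1.
  split; first exact: rootL.
  have /hasP [w wL wP] : has (size L).-primitive_root L.
    apply: cyclic.has_prim_root; rewrite ?undup_uniq //.
    by apply/allP => w; rewrite LP => /rootL e; apply/unity_rootP.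
  move=> /(prim_rootP wP) [i ->]; elim: (val i) => [|k IHk] //=.
  by rewrite exprS; apply: imgM => //; rewrite -LP.
exists (size L); split=> //; last first.
  by move=> z; rewrite -imgP; split=> [|/asboolP//]; move/asboolP.
have : (-1 : C) ^+ size L = 1.
  by apply/imgP/asboolP; exists (-1); [exact: integers_prime_toN1|].
rewrite -signr_odd dvdn2; case: odd => //= /eqP.
by rewrite expr1 eq_sym -subr_eq0 opprK (_ : 1 + 1 = 2%:R) // pnatr_eq0.
Qed.

End CharacterImage.

(** * The group of values of a Hecke character *)

Section HeckeCharacter.
Variables (eps : C -> C) (chi : set C -> C) (m h : nat).
Hypotheses (heps : is_character_mod K f eps) (epsN1 : eps (-1) = -1)
  (hchi : is_hecke_character K f eps chi) (hcl : is_class_number K h)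
  (m0 : (0 < m)%N) (m2 : (2 %| m)%N)
  (imgP : forall z, image_eps K f eps z <-> z ^+ m = 1).
Local Notation G := (value_group K f chi).
Local Notation muK := (root_multiples K m).

Let nf : ~ f 1. Proof. exact: modulus_proper heps epsN1. Qed.

Let P0 x : Pf x -> x != 0.
Proof.
move=> [Ox [_ [y [[r Or <-] fy e]]]]; apply/eqP => x0; apply: nf.
by rewrite -e x0 mul0r add0r.
Qed.

Let chi0 a : If a -> chi a != 0. Proof. by case: hchi => + _ _; apply. Qed.

Let chiM a b : If a -> If b -> chi (ideal_mul a b) = chi a * chi b.
Proof. by case: hchi => _ + _; apply. Qed.

Let eps_mu x : Pf x -> eps x ^+ m = 1.
Proof. by move=> Px; apply/imgP; exists x. Qed.

Lemma hecke_at_principal c : K c -> c != 0 -> If (principal K c) ->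
  exists2 z, z ^+ m = 1 & chi (principal K c) = z * c.
Proof.
move=> Kc c0 Ic; have [b [g [Pb Pg cE]]] := ideals_prime_to_principal nf Kc c0 Ic.
have [_ _ chiP] := hchi; exists (eps b / eps g); last exact: chiP cE.
by rewrite expr_div_n !eps_mu // divr1.
Qed.

Let chiO : chi (principal K 1) = 1.
Proof.
have I1 := ideals_prime_to_O; apply: (mulfI (chi0 I1)).
by rewrite -chiM // ideal_mul1 ?mulr1 //; exact: fractional_O.
Qed.

Let chi_exp a n : If a -> chi (ideal_exp K a n) = chi a ^+ n.
Proof.
move=> Ia; elim: n => [|n IHn]; first by rewrite expr0.
by rewrite /= chiM ?IHn ?exprS //; exact: ideals_prime_to_exp.
Qed.

Let principalN c : principal K (- c) = principal K c.
Proof.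
suff H d : principal K (- d) `<=` principal K d.
  by apply/seteqP; split=> //; rewrite -{1}[c]opprK.
by move=> _ [r Or <-]; exists (- r); rewrite ?mulrN ?mulNr //; exact: ring_of_integersN.
Qed.

(* Some power a^N = c O, and then c / k^N is a root of unity of K. *)
Lemma principal_of_hecke_value a w k n : If a -> (0 < n)%N -> w ^+ n = 1 -> K k ->
  chi a = w * k -> a = principal K k.
Proof.
move=> Ia n0 wn Kk aE; have fa : fractional a by case: Ia.
have k0 : k != 0 by apply: contraNneq (chi0 Ia) => k0; rewrite aE k0 mulr0.
have [N [c [N0 Kc c0 aN]]] := class_finite_order hcl fa.
have IaN := ideals_prime_to_exp N Ia; have [|z zm cE] := hecke_at_principal Kc c0.
  by rewrite -aN.
move: cE; rewrite -aN chi_exp // aE exprMn => e.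
have z0 : z != 0.
  by apply: contra_eq_neq zm => ->; rewrite expr0n gtn_eqF // eq_sym oner_neq0.
have kN0 := expf_neq0 N k0.
have q1 : c / k ^+ N = 1 \/ c / k ^+ N = -1.
  apply: (@imag_quadratic_root_of_unity _ (n * m)); rewrite ?muln_gt0 ?n0 //.
    by apply: (subfield_div hK) => //; exact: (subfieldX hK).
  have -> : c / k ^+ N = w ^+ N / z.
    by apply/eqP; rewrite eqr_div // e mulrC.
  rewrite expr_div_n [X in _ / X]exprM exprAC zm !expr1n divr1 -exprM mulnCA exprM wn.
  by rewrite expr1n.
have {q1} aN' : ideal_exp K a N = principal K (k ^+ N).
  rewrite aN -[c](mulfVK kN0); case: q1 => ->; rewrite ?mul1r //.
  by rewrite mulN1r principalN.
have Kk' := subfieldV hK Kk; have k0' : k^-1 != 0 by rewrite invr_eq0.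
have fk := fractional_principal Kk k0; have fk' := fractional_principal Kk' k0'.
have : ideal_mul a (principal K k^-1) = principal K 1.
  apply: (ideal_exp_torsion_free N0); first exact: fractional_mul.
  rewrite ideal_expM // aN' ideal_exp_principal // ideal_mul_principal ?expf_neq0 //.
    by rewrite exprVn divff.
  exact: (subfieldX hK).
move=> /(congr1 (ideal_mul (principal K k))).
rewrite [ideal_mul a _]ideal_mulC ideal_mulA ideal_mul_principal // divff // ideal_mul1 //.
by rewrite ideal_mul_principal ?oner_neq0 ?mulr1 //; exact: (subfield1 hK).
Qed.

Lemma value_group_neq0 x : G x -> x != 0.
Proof. by move=> [c [a [_ c0 Ia ->]]]; rewrite mulf_neq0 // chi0. Qed.

Lemma value_groupM x y : G x -> G y -> G (x * y).
Proof.
move=> [c [a [Kc c0 Ia ->]]] [d [b [Kd d0 Ib ->]]]; exists (c * d), (ideal_mul a b).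
split; [exact: (subfieldM hK)|exact: mulf_neq0|exact: ideals_prime_to_mul|].
by rewrite chiM // mulrACA.
Qed.

Lemma value_groupV x : G x -> G x^-1.
Proof.
move=> [c [a [Kc c0 Ia ->]]]; have [b Ib ab] := ideals_prime_to_inverse Ia.
exists c^-1, b; split; [exact: (subfieldV hK)|by rewrite invr_eq0|by []|].
rewrite invfM; congr (_ * _); apply: (mulfI (chi0 Ia)); rewrite divff ?chi0 //.
by rewrite -chiM // ab chiO.
Qed.

Lemma value_group_base x : K x -> x != 0 -> G x.
Proof.
by move=> Kx x0; exists x, (principal K 1); rewrite chiO mulr1; split=> //; exact: ideals_prime_to_O.
Qed.

(** For x prime to f, eps(x) = chi(xO) / x. *)
Lemma value_group_mu z : z ^+ m = 1 -> G z.
Proof.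
move=> /imgP [x Px <-]; have x0 := P0 Px; have [[Kx ix] xf] := Px.
have Ix : If (principal K x).
  apply: ideals_prime_to_integral => //; split; first exact: fractional_principal.
  by move=> _ [r Or <-]; exact: ring_of_integersM.
exists x^-1, (principal K x); split; [exact: (subfieldV hK)|by rewrite invr_eq0|by []|].
have [_ _ chiP] := hchi; rewrite (chiP x x 1) ?divr1 //.
by rewrite (character_mod1 heps) divr1 mulrCA mulVf ?mulr1.
Qed.

(** If c chi(a) is in mu_n K^*, then a is principal, so chi(a) is given by eps and its root of unity
    lies in mu_m. This is the hypothesis [GH] of the degree computation. *)
Lemma value_group_root_multiples x n : (0 < n)%N -> G x -> root_multiples K n x -> muK x.
Proof.
move=> n0 [c [a [Kc c0 Ia ->]]] [w [k [wn Kk k0 e]]].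
have Kkc : K (k / c) by exact: (subfield_div hK).
have kc0 : k / c != 0 by rewrite mulf_neq0 ?invr_eq0.
have aE : a = principal K (k / c).
  apply: (principal_of_hecke_value Ia n0 wn Kkc).
  by apply: (mulfI c0); rewrite e mulrCA [c * _]mulrC mulfVK.
have [|z zm zE] := hecke_at_principal Kkc kc0; first by rewrite -aE.
exists z, k; split=> //; rewrite aE zE mulrCA [c * _]mulrC mulfVK //.
Qed.

(** chi identifies the class group with G / mu_m K^*, once each class is represented by an ideal
    prime to f. *)
Lemma value_group_representatives : exists d : 'I_h -> C,
  [/\ forall i, G (d i), forall i j, muK (d i / d j) -> i = j &
      forall x, G x -> exists i, muK (x / d i)].
Proof.
have [b [fb binj bsurj]] := class_representatives hcl.
have /choice [c cP] i := fractional_prime_to (fb i) hf.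
pose b' i := [set c i * x | x in b i].
have Ib i : If (b' i) by case: (cP i) => _ _ ib cb; exact: ideals_prime_to_integral.
have cls i : ideal_class K (b' i) = ideal_class K (b i).
  by apply/ideal_class_eq; exists (c i); case: (cP i).
exists (fun i => chi (b' i)); split.
- move=> i; exists 1, (b' i); rewrite mul1r oner_neq0; split=> //.
  exact: (subfield1 hK).
- move=> i j [w [k [wm Kk k0 e]]]; apply: binj; rewrite -!cls; apply/ideal_class_eq.
  have [bj Ij bb] := ideals_prime_to_inverse (Ib j).
  have fi : fractional (b' i) by case: (Ib i).
  have fj : fractional (b' j) by case: (Ib j).
  have kE : ideal_mul (b' i) bj = principal K k.
    apply: (principal_of_hecke_value _ m0 wm Kk); first exact: ideals_prime_to_mul.
    rewrite chiM // -e; congr (_ * _); apply: (mulfI (chi0 (Ib j))).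
    by rewrite divff ?chi0 // -chiM // bb chiO.
  exists k; split=> //; rewrite -ideal_mul_scale // -kE -ideal_mulA [ideal_mul bj _]ideal_mulC bb.
  by rewrite ideal_mulC ideal_mul1.
move=> _ [t [a [Kt t0 Ia ->]]]; have fa : fractional a by case: Ia.
have [i ai] := bsurj a fa; exists i; move: ai.
rewrite -cls => /ideal_class_eq [k [Kk k0 aE]].
have fi : fractional (b' i) by case: (Ib i).
have [bi Ibi bb] := ideals_prime_to_inverse (Ib i).
have Ik : If (principal K k).
  have -> : principal K k = ideal_mul a bi.
    rewrite aE -ideal_mul_scale // -ideal_mulA bb ideal_mul_principal ?oner_neq0 ?mulr1 //.
    exact: (subfield1 hK).
  exact: ideals_prime_to_mul.
have [z zm zE] := hecke_at_principal Kk k0 Ik.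
have -> : chi a = z * k * chi (b' i) by rewrite -zE -chiM // ideal_mul_scale // -aE.
exists z, (t * k); split=> //; [exact: (subfieldM hK)|exact: mulf_neq0|].
by have c0 := chi0 (Ib i); field.
Qed.

Lemma field_of_valuesE : field_of_values K f chi = subfield_gen (K `|` G).
Proof.
apply/seteqP; split; apply: subfield_gen_min; try exact: subfield_gen_is_subfield.
  move=> x [Kx|[a Ia <-]]; first exact: field_gen_base.
  apply: field_gen_gen; exists 1, a; rewrite mul1r oner_neq0; split=> //.
  exact: (subfield1 hK).
have hT : is_subfield (field_of_values K f chi) := subfield_gen_is_subfield _.
move=> x [Kx|[c [a [Kc c0 Ia ->]]]]; first exact: field_gen_base.
apply: (subfieldM hT); first exact: field_gen_base.
by apply: field_gen_gen; exists a.
Qed.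

Let square_root_multiple a c : If a -> K c -> c != 0 -> ideal_mul a a = principal K c ->
  exists2 z, z ^+ m = 1 & chi a ^+ 2 = z * c.
Proof.
move=> Ia Kc c0 aa; have [|z zm zE] := hecke_at_principal Kc c0.
  by rewrite -aa; exact: ideals_prime_to_mul.
by exists z => //; rewrite expr2 -chiM // aa.
Qed.

(** For a in I(f), chi(a)^2 lies in mu_m K^* exactly when a^2 is principal; scaling by K^* does not
    change the field generated. *)
Lemma genus_field_of_valuesE :
  genus_field_of_values K f chi = subfield_gen (K `|` half_group K G m).
Proof.
apply/seteqP; split; apply: subfield_gen_min; try exact: subfield_gen_is_subfield.
  move=> x [Kx|[a [Ia [c [Kc c0 aa]]] <-]]; first exact: field_gen_base.
  apply: field_gen_gen; split.
    by exists 1, a; rewrite mul1r oner_neq0; split=> //; exact: (subfield1 hK).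
  by have [z zm zE] := square_root_multiple Ia Kc c0 aa; exists z, c.
have hT : is_subfield (genus_field_of_values K f chi) := subfield_gen_is_subfield _.
move=> x [Kx|[[c [a [Kc c0 Ia ->]]] [w [k [wm Kk k0 e]]]]]; first exact: field_gen_base.
apply: (subfieldM hT); first exact: field_gen_base.
apply: field_gen_gen; exists a => //; split=> //.
have Kkc : K (k / c ^+ 2) by apply: (subfield_div hK) => //; exact: (subfieldX hK).
exists (k / c ^+ 2); split=> //; first by rewrite mulf_neq0 ?invr_eq0 ?expf_neq0.
apply: (principal_of_hecke_value _ m0 wm Kkc); first exact: ideals_prime_to_mul.
by rewrite chiM // mulrA -e exprMn [c ^+ 2 * _]mulrC mulfK ?expf_neq0 // expr2.
Qed.

(** * Roots of unity in W and ramified primes *)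

Local Notation R := (square_classes K G m).
Local Notation W := (sqrt_field K G m).

(** Membership of k in R gives pO = (ca)^2 for a fractional ideal ca. If p did not divide D, each
    element of ca, having its square in pO, would be divisible by p; then p would lie in p^2 O. *)
Lemma square_class_ramified (p : nat) k : prime p -> (k = p%:R \/ k = - p%:R) -> R k -> (p %| D)%N.
Proof.
move=> pp kp [Kk k0 [_ [z [[c [a [Kc c0 Ia ->]]] zm e]]]].
have p0 : p%:R != 0 :> C by rewrite pnatr_eq0 gtn_eqF // prime_gt0.
have fa : fractional a by case: Ia.
have Kkc : K (k / c ^+ 2) by apply: (subfield_div hK) => //; exact: (subfieldX hK).
have aa : ideal_mul a a = principal K (k / c ^+ 2).
  apply: (principal_of_hecke_value _ m0 zm Kkc); first exact: ideals_prime_to_mul.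
  by rewrite chiM // mulrA -e exprMn [c ^+ 2 * _]mulrC mulfK ?expf_neq0 // expr2.
apply: contraT => pD.
have Okp r : O r -> O (k * r / p%:R).
  move=> Or; case: kp => ->; first by rewrite mulrAC divff ?mul1r.
  by rewrite mulNr mulNr mulrAC divff // mul1r; exact: ring_of_integersN.
have sub x y : a x -> a y -> exists2 r, O r & (c * x) * (c * y) = k * r.
  move=> ax ay; have : ideal_mul a a (x * y) by exact: mem_ideal_mul.
  by rewrite aa => -[r Or rE]; exists r => //; rewrite mulrACA -rE; field.
have div x : a x -> O (c * x / p%:R).
  move=> ax; have [r Or rE] := sub x x ax ax.
  have Kcx : K (c * x) by apply: (subfieldM hK) => //; exact: fracK ax.
  apply: unramified_prime => //; last by rewrite expr2 rE; exact: Okp.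
  apply: (@ring_of_integers_root _ 2) => //; rewrite expr2 rE.
  rewrite -[k * r](mulfVK p0); apply: ring_of_integersM; last exact: ring_of_integers_nat.
  exact: Okp.
have : ideal_mul a a (k / c ^+ 2) by rewrite aa; exists 1; rewrite ?mulr1.
have : ideal_mul a a `<=` [set x | O (c ^+ 2 * x / p%:R ^+ 2)].
  apply: ideal_mul_min => [x y ax ay||x y] /=.
  - have -> : c ^+ 2 * (x * y) / p%:R ^+ 2 = (c * x / p%:R) * (c * y / p%:R) by field.
    by apply: ring_of_integersM; exact: div.
  - by rewrite mulr0 mul0r.
  - by rewrite mulrDr mulrDl; exact: ring_of_integersD.
move=> /[apply] /=; rewrite mulrCA divff ?expf_neq0 // mulr1 => Okp2.
have : O (p%:R^-1).
  case: kp Okp2 => ->; first by rewrite expr2 invfM mulrA divff ?mul1r.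
  move=> /ring_of_integersN; rewrite mulNr opprK.
  by rewrite expr2 invfM mulrA divff ?mul1r.
move=> /ring_of_integers_norm [n]; rewrite fmorphV /= rmorph_nat -invfM => e'.
have : (n * (p * p) = 1)%N.
  apply/eqP; rewrite -(eqr_nat C) !natrM -e' mulVf ?mulf_neq0 //.
by have := prime_gt1 pp; move=> p1 /eqP; rewrite !muln_eq1 => /andP[_ /andP[/eqP pe _]]; rewrite pe in p1.
Qed.

(** The ideal b = (p, th) has b^2 = pO. After scaling b by c to make it prime to f, the element
    chi(cb) / c of G has square p up to mu_m. *)
Lemma square_class_of_ramified (p : nat) : (p == 2%N) || (p == 3%N) -> (p %| D)%N -> R p%:R.
Proof.
move=> p23 pD; have p0 : p%:R != 0 :> C by case/orP: p23 => /eqP ->; rewrite pnatr_eq0.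
have [th [u [v [w [Oth Ou Ov Ow [Oth2 pE]]]]]] := ramified_prime p23 pD.
have Op := ring_of_integers_nat p.
pose b : set C := [set x | exists r t, [/\ O r, O t & x = r * p%:R + t * th]].
have Ob : b `<=` O.
  by move=> _ [r [t [Or Ot ->]]]; apply: ring_of_integersD; exact: ring_of_integersM.
have bp : b p%:R by exists 1, 0; rewrite mul1r mul0r addr0.
have bth : b th by exists 0, 1; rewrite mul1r mul0r add0r.
have fb : fractional b.
  split.
  - by move=> x /Ob [].
  - by exists p%:R.
  - move=> _ _ [r [t [Or Ot ->]]] [r' [t' [Or' Ot' ->]]]; exists (r + r'), (t + t').
    by split; [exact: ring_of_integersD|exact: ring_of_integersD|ring].
  - move=> e _ Oe [r [t [Or Ot ->]]]; exists (e * r), (e * t).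
    by split; [exact: ring_of_integersM|exact: ring_of_integersM|ring].
  by exists 1; rewrite oner_neq0; split=> // x /Ob; rewrite mul1r.
have bb : ideal_mul b b = principal K p%:R.
  have fbb := fractional_mul fb fb.
  apply/seteqP; split.
    have fp := fractional_principal (subfield_nat hK p) p0.
    apply: ideal_mul_min => [_ _ [r [t [Or Ot ->]]] [r' [t' [Or' Ot' ->]]]||]; last 2 first.
    - exact: frac0.
    - by move=> x y; exact: fracD.
    exists (r * r' * p%:R + (r * t' + r' * t) * th + t * t' * (th ^+ 2 / p%:R)); last by field.
    have [OD OM] := (ring_of_integersD, ring_of_integersM).
    by apply: (OD _ _ (OD _ _ (OM _ _ (OM _ _ Or Or') Op) (OM _ _ _ Oth)) (OM _ _ (OM _ _ Ot Ot') Oth2));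
      apply: (OD _ _ (OM _ _ Or Ot') (OM _ _ Or' Ot)).
  move=> _ [r Or <-]; rewrite mulrC; apply: fracM => //; rewrite pE.
  apply: fracD => //; first apply: fracD => //.
  - by apply: fracM => //; rewrite expr2; exact: mem_ideal_mul.
  - by apply: fracM => //; exact: mem_ideal_mul.
  - by apply: fracM => //; rewrite expr2; exact: mem_ideal_mul.
have [c [Kc c0 ib cb]] := fractional_prime_to fb hf.
have Ia := ideals_prime_to_integral ib cb; set a := [set _ | _ in _] in Ia.
have c20 := expf_neq0 2 c0.
have Kcp : K (c ^+ 2 * p%:R).
  by apply: (subfieldM hK); [exact: (subfieldX hK)|exact: (subfield_nat hK)].
have aa : ideal_mul a a = principal K (c ^+ 2 * p%:R).
  have aE : a = ideal_mul (principal K c) b by rewrite ideal_mul_scale.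
  rewrite aE -ideal_mulA [ideal_mul b _]ideal_mulC -ideal_mulA bb ideal_mulA.
  rewrite !ideal_mul_principal ?expr2 //; exact: (subfield_nat hK).
have [|z zm zE] := square_root_multiple Ia Kcp _ aa; first exact: mulf_neq0.
split=> //; first exact: (subfield_nat hK).
exists (c^-1 * chi a), z; split=> //.
  by exists c^-1, a; split; [exact: (subfieldV hK)|rewrite invr_eq0| |].
by rewrite exprMn zE; field.
Qed.

Let hW : is_subfield W. Proof. exact: subfield_gen_is_subfield. Qed.

Let W_sqrt y : R (y ^+ 2) -> W y.
Proof. by move=> Ry; apply: (@field_gen_gen _ K [set y | R (y ^+ 2)]). Qed.

Let RN k : R k -> R (- k).
Proof. exact: (square_classesN hK m2). Qed.

Let R1 : R 1.
Proof.
split; [exact: (subfield1 hK)|exact: oner_neq0|exists 1, 1].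
split; rewrite ?expr1n ?mulr1 //.
by apply: value_group_base; [exact: (subfield1 hK)|exact: oner_neq0].
Qed.

Let W4 z : z ^+ 4 = 1 -> W z.
Proof.
rewrite (exprM z 2 2) => z4; apply: W_sqrt; move: z4.
by rewrite -(expr1n _ 2) => /sqrf_eq_sign [] ->; rewrite ?expr1n //; exact: RN.
Qed.

(** For z of order 8, z + 1/z and z - 1/z are square roots of 2 and -2. *)
Let W8 z : (2 %| D)%N -> z ^+ 8 = 1 -> W z.
Proof.
move=> D2; rewrite (exprM z 4 2) -(expr1n _ 2) => /sqrf_eq_sign [/W4 //|z4].
have R2 : R 2 by exact: square_class_of_ramified.
have z0 : z != 0.
  by apply: contra_eq_neq z4 => ->; rewrite expr0n eq_sym oppr_eq0 oner_neq0.
have i2 : z ^+ 2 + z ^- 2 = 0.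
  have z20 := expf_neq0 2 z0; apply: (mulfI z20); rewrite mulrDr divff // mulr0.
  by rewrite -exprD z4 addNr.
have w1 : W (z + z^-1).
  apply: W_sqrt; rewrite sqrrD divff // exprVn.
  by rewrite addrAC i2 add0r.
have w2 : W (z - z^-1).
  apply: W_sqrt; rewrite sqrrB divff // exprVn addrAC i2 add0r; exact: RN.
have -> : z = (z + z^-1 + (z - z^-1)) / 2 by field.
by apply: (subfield_div hW); [exact: (subfieldD hW)|exact: (subfield_nat hW)].
Qed.

(** For z of order 3, 2z + 1 is a square root of -3. *)
Let W3 z : (3 %| D)%N -> z ^+ 3 = 1 -> W z.
Proof.
move=> D3 z3; have R3 : R 3 by exact: square_class_of_ramified.
have [->|z1] := eqVneq z 1; first exact: (subfield1 hW).
have e : z ^+ 2 + z + 1 = 0.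
  have z10 : z - 1 != 0 by rewrite subr_eq0.
  apply: (mulfI z10); rewrite mulr0; transitivity (z ^+ 3 - 1); first by ring.
  by rewrite z3 subrr.
have w : W (2 * z + 1).
  apply: W_sqrt; have -> : (2 * z + 1) ^+ 2 = - 3 + 4 * (z ^+ 2 + z + 1) by ring.
  by rewrite e mulr0 addr0; exact: RN.
have -> : z = (2 * z + 1 - 1) / 2 by field.
by apply: (subfield_div hW); [apply: (subfieldB hW) => //; exact: (subfield1 hW)|exact: (subfield_nat hW)].
Qed.

(** Split z = z^9 / z^8 into a root of unity of order dividing 8 and one of order dividing 3. *)
Let W24 z : (3 %| D)%N -> z ^+ 24 = 1 -> W (z ^+ 9) -> W z.
Proof.
move=> D3 z24 w9; have z0 : z != 0.
  by apply: contra_eq_neq z24 => ->; rewrite expr0n eq_sym oner_neq0.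
have -> : z = z ^+ 9 / z ^+ 8 by rewrite exprSr mulrAC divff ?mul1r // expf_neq0.
by apply: (subfield_div hW) => //; apply: W3; rewrite // -exprM.
Qed.

Let gcd6 : (gcdn 6 D == 1)%N = ~~ (2 %| D)%N && ~~ (3 %| D)%N.
Proof. by rewrite -[_ == _]/(coprime (2 * 3) D) coprimeMl !prime_coprime. Qed.

(** As the image of eps is mu_m, the condition reads m | n0, where 2 n0 is 4, times 2 if 2 | D,
    times 3 if 3 | D. These are the roots of unity that i, sqrt 2 and sqrt(-3) put in W. Conversely
    2m | 24, while 3 | m puts sqrt(-3) in W and 4 | m puts sqrt 2 there, so that 3, respectively 2,
    is ramified. *)
Lemma condition_starP : condition_star D K f eps <-> (forall z, z ^+ (2 * m) = 1 -> W z).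
Proof.
have [w wP] := primitive_root_exists C m0.
have starE : condition_star D K f eps <->
    (m %| (if gcdn 6 D == 1%N then 2 else if ~~ (3 %| D) then 4 else if ~~ (2 %| D) then 6 else 12))%N.
  rewrite /condition_star; set n0 := (if _ then _ else _).
  split=> [st|mn z /imgP zm]; last first.
    by case/dvdnP: mn => l lE; apply/unity_rootP; rewrite lE mulnC exprM zm expr1n.
  have /st/unity_rootP : image_eps K f eps w by apply/imgP; exact: prim_expr_order wP.
  by move/eqP; rewrite -(prim_order_dvd wP).
rewrite starE gcd6; split.
  move=> mn z z2m.
  have zn l : (m %| l)%N -> z ^+ (2 * l) = 1.
    by case/dvdnP => j ->; rewrite mulnCA mulnC exprM z2m expr1n.
  move: mn; case: (boolP (2 %| D)%N) => D2; case: (boolP (3 %| D)%N) => D3 /= /zn zE.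
  - apply: W24 => //; apply: W8 => //.
    by rewrite -exprM (exprM z 24 3) zE expr1n.
  - exact: W8.
  - apply: W24 => //; first by rewrite (exprM z 12 2) zE expr1n.
    by apply: W4; rewrite -exprM (exprM z 12 3) zE expr1n.
  - exact: W4.
move=> Wz.
have [d [Gd dinj dsurj]] := value_group_representatives.
have K1 := imag_quadratic_root_of_unity.
have [y [Ry fy Wy]] := sqrt_field_basis hK K1 m0 m2 value_group_neq0 value_groupM value_groupV
  value_group_mu value_group_root_multiples Gd dinj dsurj.
have Rsq := square_classes_of_sqrt_field hK K1 m0 m2 value_group_neq0 value_groupM value_groupV
  value_group_base value_group_mu value_group_root_multiples Gd dinj dsurj.
have m20 : (0 < 2 * m)%N by rewrite muln_gt0.
have [z zP] := primitive_root_exists C m20.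
have m24 : (2 * m %| 24)%N.
  apply: (multiquadratic_order hW _ Wy zP) => [j|]; first by case: (Ry j).
  by apply: Wz; exact: prim_expr_order zP.
have sub l u : (l %| 2 * m)%N -> l.-primitive_root u -> W u.
  move=> /dvdnP [j e] uP; apply: Wz; rewrite e mulnC exprM (prim_expr_order uP) expr1n //.
have m3 : (3 %| m)%N -> (3 %| D)%N.
  move=> m3; have [u uP] := primitive_root_exists C (isT : 0 < 3)%N.
  have Wu : W u by apply: sub uP; exact: dvdn_mull.
  have e : u ^+ 2 + u + 1 = 0.
    have u1 : u - 1 != 0.
      rewrite subr_eq0; apply/eqP => u1; have := prim_order_dvd uP 1.
      by rewrite u1 expr1n eqxx.
    apply: (mulfI u1); rewrite mulr0; transitivity (u ^+ 3 - 1); first by ring.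
    by rewrite (prim_expr_order uP) subrr.
  have e2 : (2 * u + 1) ^+ 2 = - 3%:R :> C.
    transitivity (- 3%:R + 4 * (u ^+ 2 + u + 1) : C); first by ring.
    by rewrite e mulr0 addr0.
  apply: (@square_class_ramified 3 (- 3%:R)) => //; first by right.
  rewrite -e2; apply: Rsq.
  - apply: (subfieldD hW); last exact: (subfield1 hW).
    by apply: (subfieldM hW) => //; exact: (subfield_nat hW).
  - by rewrite e2; apply: (subfieldN hK); exact: (subfield_nat hK).
  - by rewrite -sqrf_eq0 e2 oppr_eq0 pnatr_eq0.
have m4 : (4 %| m)%N -> (2 %| D)%N.
  move=> m4; have [u uP] := primitive_root_exists C (isT : 0 < 8)%N.
  have Wu : W u by apply: sub uP; rewrite (_ : 8 = 2 * 4)%N // dvdn_pmul2l.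
  have u0 : u != 0.
    by apply: contra_eq_neq (prim_expr_order uP) => ->; rewrite expr0n eq_sym oner_neq0.
  have u4 : u ^+ 4 = -1.
    have : (u ^+ 4) ^+ 2 = 1 ^+ 2 by rewrite -exprM (prim_expr_order uP) expr1n.
    case/sqrf_eq_sign => // u4; have := prim_order_dvd uP 4.
    by rewrite u4 eqxx.
  have e2 : (u + u^-1) ^+ 2 = 2%:R :> C.
    have u20 := expf_neq0 2 u0; apply: (mulfI u20).
    transitivity (u ^+ 4 + 2 * u ^+ 2 + 1); first by field.
    by rewrite u4; ring.
  apply: (@square_class_ramified 2 2%:R) => //; first by left.
  rewrite -e2; apply: Rsq.
  - by apply: (subfieldD hW) => //; exact: (subfieldV hW).
  - by rewrite e2; exact: (subfield_nat hK).
  - by rewrite -sqrf_eq0 e2 pnatr_eq0.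
have m12 : (m %| 12)%N by rewrite -(@dvdn_pmul2l 2).
have : (m <= 12)%N by exact: dvdn_leq m12.
(* m is an even divisor of 12, divisible by 3 or by 4 only if D allows it: a finite check
   remains. *)
move: m0 m2 m12 m3 m4 => {Wz sub starE}; move: (2 %| D)%N (3 %| D)%N => b2 b3.
by move: m; do 13?[case=> //]; case: b2; case: b3 => // _ _ _ m3 m4 _;
  (have := m3 isT; case) || (have := m4 isT; case).
Qed.

Lemma hecke_degree :
  [/\ has_degree K (field_of_values K f chi) h -> condition_star D K f eps,
      condition_star D K f eps ->
        has_degree K (field_of_values K f chi) h \/ has_degree K (field_of_values K f chi) (2 * h) &
      condition_star D K f eps ->
        (has_degree K (field_of_values K f chi) h <->
          ~ (forall z, z ^+ (2 * m) = 1 -> genus_field_of_values K f chi z))].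
Proof.
have [d [Gd dinj dsurj]] := value_group_representatives.
have K1 := imag_quadratic_root_of_unity.
have H1 := mu_sub_sqrt_field hK K1 m0 m2 value_group_neq0 value_groupM value_groupV
  value_group_base value_group_mu value_group_root_multiples Gd dinj dsurj.
have H2 := degree_of_mu_sub hK K1 m0 m2 value_group_neq0 value_groupM value_groupV
  value_group_base value_group_mu value_group_root_multiples Gd dinj dsurj.
rewrite genus_field_of_valuesE field_of_valuesE.
by split=> [/H1 /condition_starP|/condition_starP/H2 []|/condition_starP/H2 []].
Qed.

(** Write m = m' 2^e with m' odd. For z in mu_2m, the square of z^m' lies in the 2-part generated by
    xi, so z^m' is a power of sqrt xi up to sign; z^(2^(e+1)) lies in mu_m. These two exponents are
    coprime, so z is recovered from the two powers. *)
Lemma sqrt_generator_mem (xi : C) : generates (mu2_eps K f eps) xi ->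
  (genus_field_of_values K f chi (sqrtC xi) <->
   forall z, z ^+ (2 * m) = 1 -> genus_field_of_values K f chi z).
Proof.
move=> [[/imgP xim _] gen].
have hTg : is_subfield (genus_field_of_values K f chi) := subfield_gen_is_subfield _.
have muT z : z ^+ m = 1 -> genus_field_of_values K f chi z.
  move=> zm; rewrite genus_field_of_valuesE; apply: field_gen_gen.
  split; first exact: value_group_mu.
  by apply: (root_multiplesX hK); exact: root_multiples_root.
split=> [Tx z z2m|]; last by apply; rewrite exprM sqrtCK.
have [e [m' [m'odd mE]]] : exists e m' : nat, odd m' /\ m = (m' * 2 ^ e)%N.
  have [l cop mE] := pfactor_coprime (isT : prime 2) m0.
  by exists (logn 2 m), l; split=> //; rewrite -coprime2n.
have z0 : z != 0.
  by apply: contra_eq_neq z2m => ->; rewrite expr0n gtn_eqF ?muln_gt0 // eq_sym oner_neq0.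
have T1 : genus_field_of_values K f chi (z ^+ m').
  have u2 : ((z ^+ m') ^+ 2) ^+ (2 ^ e) = 1.
    by rewrite -!exprM -[RHS]z2m; congr (_ ^+ _); rewrite mE; ring.
  have : mu2_eps K f eps ((z ^+ m') ^+ 2).
    split; first by apply/imgP; rewrite mE mulnC exprM u2 expr1n.
    have [l lP] := prim_order_exists (expn_gt0 2 e) u2.
    case/(dvdn_pfactor l e (isT : prime 2)) => k _ lE.
    by exists k; rewrite -lE.
  move=> /gen [k uE]; have : (z ^+ m') ^+ 2 = (sqrtC xi ^+ k) ^+ 2.
    by rewrite uE exprAC sqrtCK.
  case/sqrf_eq_sign => ->; last apply: (subfieldN hTg); exact: (subfieldX hTg).
have T2 : genus_field_of_values K f chi (z ^+ (2 ^ e.+1)).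
  apply: muT; rewrite mE mulnC exprM -!exprM.
  have -> : (2 ^ e.+1 * (2 ^ e * m') = (2 * m) * 2 ^ e)%N by rewrite mE expnS; ring.
  by rewrite exprM z2m expr1n.
have cop : coprime m' (2 ^ e.+1) by rewrite coprimeXr // coprimen2.
have m'0 : (0 < m')%N by case: (m') m'odd.
have [a b ab _] := egcdnP (2 ^ e.+1) m'0.
have zE : (z ^+ m') ^+ a = (z ^+ (2 ^ e.+1)) ^+ b * z.
  by rewrite -!exprM mulnC ab (eqP cop) exprD expr1 mulnC.
have -> : z = (z ^+ m') ^+ a / (z ^+ (2 ^ e.+1)) ^+ b.
  by rewrite zE mulrAC divff ?mul1r // !expf_neq0.
by apply: (subfield_div hTg); exact: (subfieldX hTg).
Qed.

End HeckeCharacter.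

(** If a^2 = kO, then chi(a)^2 = chi(kO) is determined by eps and k, so chi(a) and chi'(a) agree up
    to sign. *)
Lemma genus_field_of_values_eps (eps : C -> C) (chi chi' : set C -> C) :
  is_character_mod K f eps -> eps (-1) = -1 ->
  is_hecke_character K f eps chi -> is_hecke_character K f eps chi' ->
  genus_field_of_values K f chi `<=` genus_field_of_values K f chi'.
Proof.
move=> heps epsN1 [c0 cM cP] [c0' cM' cP'].
have hT : is_subfield (genus_field_of_values K f chi') := subfield_gen_is_subfield _.
apply: subfield_gen_min => // x [Kx|[a [Ia [k [Kk k0 aa]]] <-]]; first exact: field_gen_base.
have Ik : If (principal K k) by rewrite -aa; exact: ideals_prime_to_mul.
have [b [g [Pb Pg kE]]] := ideals_prime_to_principal (modulus_proper heps epsN1) Kk k0 Ik.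
have : chi a ^+ 2 = chi' a ^+ 2.
  by rewrite !expr2 -cM // -cM' // aa (cP _ _ _ k0 Pb Pg kE) (cP' _ _ _ k0 Pb Pg kE).
have Ta : genus_field_of_values K f chi' (chi' a).
  by apply: field_gen_gen; exists a => //; split=> //; exists k.
by case/sqrf_eq_sign => -> //; exact: (subfieldN hT).
Qed.

End PrimeToModulus.

End ImaginaryQuadratic.

Theorem theorem3p4 (R : realType) (D h : nat) (f : set R[i])
    (eps : R[i] -> R[i]) (chi : set R[i] -> R[i])
    (K : set R[i] := imag_quadratic D)
    (T : set R[i] := field_of_values K f chi) :
  fundamental_discriminant (- D%:Z) -> (4 < D)%N ->
  is_class_number K h ->
  integral_ideal K f ->
  is_character_mod K f eps -> eps (-1) = -1 ->
  is_hecke_character K f eps chi ->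
  [/\ has_degree K T h -> condition_star D K f eps,
      condition_star D K f eps ->
        (has_degree K T h \/ has_degree K T (2 * h)) /\
        (forall xi : R[i], generates (mu2_eps K f eps) xi ->
          (has_degree K T h <->
           ~ genus_field_of_values K f chi (sqrtC xi))) &
      forall chi' : set R[i] -> R[i], is_hecke_character K f eps chi' ->
        (has_degree K T h <-> has_degree K (field_of_values K f chi') h)].
Proof.
move=> fD D4 hcl hf heps epsN1 hchi.
have [m [m0 m2 imgP]] := character_image fD D4 hf heps epsN1.
have [A1 A2 A3] := hecke_degree fD D4 hf heps epsN1 hchi hcl m0 m2 imgP.
split=> // [st|chi' hchi'].
  split; first exact: A2.
  move=> xi gen; rewrite (A3 st).
  by rewrite (sqrt_generator_mem fD D4 hf heps epsN1 hchi hcl m0 imgP gen).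
have [B1 B2 B3] := hecke_degree fD D4 hf heps epsN1 hchi' hcl m0 m2 imgP.
have Tg : genus_field_of_values K f chi = genus_field_of_values K f chi'.
  by apply/seteqP; split; exact: (genus_field_of_values_eps hf heps epsN1).
(* The condition on eps and the field T_g are common to chi and chi', so the criterion for degree h
   is the same for both. *)
split=> hT; [have st := A1 hT|have st := B1 hT].
  by apply/(B3 st); rewrite -Tg; apply/(A3 st).
by apply/(A3 st); rewrite Tg; apply/(B3 st).
Qed.
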